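(* If $0\le s<\frac12$, then $E_s=H^s(\mathbb R_+^2)$, and there is a constant $c_s>0$ such that the zero extension $\tilde u$ of each $u\in E_s$ satisfies $$\|\tilde u\|_{H^s(\mathbb R^2)}\le c_s\,\|u\|_{H^s(\mathbb R_+^2)}.$$
   Context: $\mathbb R_+^2=(0,\infty)\times(0,\infty)$. For $s\ge0$, $H^s(\mathbb R^2)$ is the set of $\varphi\in L^2(\mathbb R^2)$ with $\|\varphi\|_{H^s(\mathbb R^2)}:=\|(1+|k|^2)^{s/2}\mathcal F\{\varphi\}(k)\|_{L^2(\mathbb R^2)}<\infty$, where $\mathcal F$ is the Fourier transform on $\mathbb R^2$. $H^s(\mathbb R_+^2)$ is the space of restrictions to $\mathbb R_+^2$ of elements of $H^s(\mathbb R^2)$, with norm $\|\phi\|_{H^s(\mathbb R_+^2)}=\inf\{\|\varphi\|_{H^s(\mathbb R^2)}:\varphi|_{\mathbb R_+^2}=\phi\}$. For a function $u$ on $\mathbb R_+^2$, $\tilde u$ denotes its extension by zero to $\mathbb R^2$: $\tilde u=u$ on $\mathbb R_+^2$, $\tilde u=0$ on $\mathbb R^2\setminus\mathbb R_+^2$. For $s\ge0$, $E_s:=\{u\in L^2(\mathbb R_+^2):\tilde u\in H^s(\mathbb R^2)\}$. *)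

(* Defs.v *)
From HB Require Import structures.
From mathcomp Require Import all_boot all_order all_algebra.
From mathcomp Require Import all_classical all_reals all_analysis.
From mathcomp Require Import complex.

Set Implicit Arguments.
Unset Strict Implicit.
Unset Printing Implicit Defensive.
Import Order.TTheory GRing.Theory Num.Theory.
Import numFieldNormedType.Exports.
Import Normc.

Local Open Scope classical_set_scope.
Local Open Scope ring_scope.

Section SobolevPlane.
Variable R : realType.

Local Notation plane := (measurableTypeR R * measurableTypeR R)%type.
Local Notation C := (R[i]).

(* Elements of the L^2 and Sobolev spaces are represented by everywhere defined
   complex-valued functions on the plane; for a space of functions on a set D
   only the values on D matter, and functions are compared almost everywhere. *)

Definition leb2 : {measure set plane -> \bar R} :=
  (@lebesgue_measure R \x @lebesgue_measure R)%E.

Definition quadrant : set plane := [set x | 0 < x.1 /\ 0 < x.2].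

Definition cmeasurable (D : set plane) (f : plane -> C) : Prop :=
  measurable_fun D (fun x => complex.Re (f x)) /\
  measurable_fun D (fun x => complex.Im (f x)).

Definition L1 (f : plane -> C) : Prop :=
  cmeasurable setT f /\ (\int[leb2]_x (normc (f x))%:E < +oo)%E.

Definition L2 (D : set plane) : set (plane -> C) :=
  [set f | cmeasurable D f /\
           (\int[leb2]_(x in D) (normc (f x) ^+ 2)%:E < +oo)%E].

Definition L2norm (f : plane -> C) : \bar R :=
  ('N[leb2]_(2%:E)[(fun x => (normc (f x))%:E)])%E.

Definition cintegral (f : plane -> C) : C :=
  Complex (\int[leb2]_x complex.Re (f x))%R (\int[leb2]_x complex.Im (f x))%R.

Definition dot (k x : plane) : R := k.1 * x.1 + k.2 * x.2.

(* exp (- i t) *)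
Definition expNi (t : R) : C := Complex (cos t) (- sin t).

(* (2 pi)^-1 * \int exp (- i k.x) f(x) dx, the unitary normalisation in
   dimension 2; meaningful for f in L^1 *)
Definition fourier1 (f : plane -> C) (k : plane) : C :=
  Complex ((2 * pi)^-1) 0 * cintegral (fun x => expNi (dot k x) * f x).

(* g is a Fourier transform of f in L^2: the transform on L^2 is the
   continuous extension of fourier1 from the dense subspace L^1 /\ L^2. *)
Definition is_fourier (f g : plane -> C) : Prop :=
  L2 setT g /\
  exists f_ : nat -> plane -> C,
    [/\ forall n, L1 (f_ n) /\ L2 setT (f_ n),
        (fun n => L2norm (fun x => f_ n x - f x)) @ \oo --> 0%E &
        (fun n => L2norm (fun k => fourier1 (f_ n) k - g k)) @ \oo --> 0%E].

(* By Plancherel's theorem, every f in L^2 has a Fourier transform, unique up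
   to almost everywhere equality, so the default value is not used on L^2. *)
Definition fourier (f : plane -> C) : plane -> C :=
  xget (fun=> 0) [set g | is_fourier f g].

Definition Hs_norm (s : R) (f : plane -> C) : \bar R :=
  L2norm (fun k => Complex ((1 + dot k k) `^ (s / 2)) 0 * fourier f k).

Definition Hs (s : R) : set (plane -> C) :=
  [set f | L2 setT f /\ (Hs_norm s f < +oo)%E].

Definition restricts_to (f u : plane -> C) : Prop :=
  {ae leb2, forall x, quadrant x -> f x = u x}.

(* The condition u \in L^2(quadrant) only adds the measurability of the
   representative u, since "almost everywhere" is with respect to a measure
   that is not complete. *)
Definition HsQ (s : R) : set (plane -> C) :=
  [set u | L2 quadrant u /\ exists f, Hs s f /\ restricts_to f u].

Definition HsQ_norm (s : R) (u : plane -> C) : \bar R :=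
  ereal_inf [set Hs_norm s f | f in [set f | Hs s f /\ restricts_to f u]].

Definition zero_ext (u : plane -> C) : plane -> C :=
  patch (fun=> 0) quadrant u.

Definition Es (s : R) : set (plane -> C) :=
  [set u | L2 quadrant u /\ Hs s (zero_ext u)].

End SobolevPlane.

(* Main.v *)
From HB Require Import structures.
Require Import Defs.
From mathcomp Require Import all_boot all_order all_algebra.
From mathcomp Require Import all_classical all_reals all_analysis.
From mathcomp Require Import measurable_realfun complex ring lra.
Set Implicit Arguments.
Unset Strict Implicit.
Unset Printing Implicit Defensive.
Import Order.TTheory GRing.Theory Num.Theory.
Import numFieldNormedType.Exports.
Import Normc.
Local Open Scope classical_set_scope.
Local Open Scope ring_scope.

(** The norm of H^s, 0 < s < 1/2, is equivalent to the energy
      N(f)^2 = |f|^2 + sum_i sum_j 4^(s j) |f(. + 2^-j e_i) - f|^2   (L^2 norms, j >= 0),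
    because the translation by 2^-j e_i multiplies the transform by a phase, and
      1 + sum_i sum_j 4^(s j) (2 - 2 cos (2^-j k_i))
    is comparable to (1 + |k|^2)^s. So it suffices to bound N (1_Q f) by N f. Crossing the
    boundary adds to the j-th difference only the mass a_j of |f|^2 on the strip
    {x in Q, x_i <= 2^-j}. The translation by 2^-(j+1) e_i maps the strip of index j+1 into the
    strip of index j minus that of index j+1, whence
      (2 + e) a_(j+1) <= (1 + e) a_j + (1 + 1/e) |f(. + 2^-(j+1) e_i) - f|^2,
    so that sum_j 4^(s j) a_j is bounded by N(f)^2 as soon as 4^s (1 + e) < 2 + e, which is
    possible precisely because 4^s < 2. For s = 0 the Plancherel theorem is enough.

    Plancherel is proved for the real Hartley transform, with kernel cos + sin: against the weight
    exp (- e (|k_1| + |k_2|)) its square integral becomes a double integral of a(x) a(y) against a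
    product of Poisson kernels, and its defect is an average of |a(. + z) - a|^2, small by
    continuity of translations. Symmetrising in k gives the complex statement. *)

(** * Lebesgue measure on the plane *)

(** The weighted sum over strips is a discrete form of the integral of x_i^(-2 s) |f|^2 over Q, so
    the strip estimate is a fractional Hardy inequality, which fails at s = 1/2. Dyadic differences
    are preferred to a double integral of difference quotients because the translation that measures
    regularity is then the very one that moves a strip off itself. The energy of 1_Q f is not known
    to be finite beforehand. All sums are therefore cut at N terms, with constants independent of N:
    absorbing the sum of the 4^(s j) a_j into the left side is legitimate for finite sums, and N
    goes to infinity only on the Fourier side, by monotone convergence. The kernel cas = cos + sin
    satisfies cas u cas v = cos (u - v) + sin (u + v). An even weight kills the sine term, so that
    only a kernel in x - y is left. The expansion 2 a(x) a(y) = a(x)^2 + a(y)^2 - (a(x) - a(y))^2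
    then gives an exact identity for the regularised square integral. *)

Section PlaneSigmaFinite.
Variable R : realType.

Definition box (r : R) : set (measurableTypeR R * measurableTypeR R) :=
  `[- r, r]%classic `*` `[- r, r]%classic.

Lemma measurable_box (r : R) : measurable (box r).
Proof. exact: measurableX. Qed.

Lemma leb2_box (r : R) : (leb2 R (box r) < +oo)%E.
Proof.
have h : (@lebesgue_measure R `[(- r)%R, r]%classic < +oo)%E.
  by rewrite lebesgue_measure_itv/=; case: ifP => _; exact: ltry.
rewrite /leb2 /box /= product_measure1E//; apply: lte_mul_pinfty => //.
by apply/fin_numPlt; rewrite h (lt_le_trans _ (measure_ge0 _ _))// ltNyr.
Qed.

Lemma box_cover : setT = \bigcup_n box n%:R.
Proof.
apply/seteqP; split=> // x _.
exists (Num.truncn (`|x.1| + `|x.2|)).+1 => //.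
have h : `|x.1| + `|x.2| < (Num.truncn (`|x.1| + `|x.2|)).+1%:R.
  by apply: truncnS_gt.
have := normr_ge0 x.1; have := normr_ge0 x.2.
have := ler_norm x.1; have := ler_norm (- x.1); rewrite normrN.
have := ler_norm x.2; have := ler_norm (- x.2); rewrite normrN.
by move=> *; split; rewrite /= in_itv/=; apply/andP; split; lra.
Qed.

Let leb2_sigma_finite : sigma_finite setT (@leb2 R).
Proof.
exists (fun n => box n%:R); first exact: box_cover.
by move=> n; split; [exact: measurable_box|exact: leb2_box].
Qed.

(* [leb2] has no usable canonical sigma-finite structure; [sleb2] is convertible to it and has
   one, so that the Fubini theorems apply. *)
Definition leb2_fun : set (measurableTypeR R * measurableTypeR R)%type -> \bar R := leb2 R.
HB.instance Definition _ := Measure.on leb2_fun.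
HB.instance Definition _ := Measure_isSigmaFinite.Build _ _ _ leb2_fun leb2_sigma_finite.
Definition sleb2 : {sigma_finite_measure set (measurableTypeR R * measurableTypeR R)%type -> \bar R} := leb2_fun.
End PlaneSigmaFinite.

(** * Fubini and Tonelli for pairs of points of the plane *)

Section PlaneFubini.
Variable R : realType.
Local Notation plane := (measurableTypeR R * measurableTypeR R)%type.
Local Open Scope ereal_scope.
Local Notation mu := (leb2 R).

Lemma tonelli_plane (f : plane * plane -> \bar R) : measurable_fun setT f ->
  (forall z, 0 <= f z) ->
  \int[mu]_x \int[mu]_y f (x, y) = \int[mu]_y \int[mu]_x f (x, y).
Proof. exact: (@fubini_tonelli _ _ _ _ _ (sleb2 R) (sleb2 R)). Qed.

Lemma measurable_tonelli_plane (f : plane * plane -> \bar R) : measurable_fun setT f ->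
  (forall z, 0 <= f z) -> measurable_fun setT (fun x => \int[mu]_y f (x, y)).
Proof. exact: (@measurable_fun_fubini_tonelli_F _ _ _ _ _ (sleb2 R)). Qed.

Lemma fubini_plane (f : plane * plane -> \bar R) : measurable_fun setT f ->
  \int[mu]_x \int[mu]_y `|f (x, y)| < +oo ->
  \int[mu]_x \int[mu]_y f (x, y) = \int[mu]_y \int[mu]_x f (x, y).
Proof.
move=> mf fi; apply: (@Fubini _ _ _ _ _ (sleb2 R) (sleb2 R)).
exact/(@integrable12ltyP _ _ _ _ _ (sleb2 R) (sleb2 R)).
Qed.

(** The integral of a signed function is the difference of those of its two parts, and Tonelli gives
    the measurability of each. This is what makes the sine, cosine and Hartley transforms
    measurable. *)
Lemma measurable_fubini_plane (f : plane * plane -> \bar R) : measurable_fun setT f ->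
  measurable_fun setT (fun x => \int[mu]_y f (x, y)).
Proof.
move=> mf.
rewrite (_ : (fun x => _) = (fun x => \int[mu]_y f^\+ (x, y)) \-
    (fun x => \int[mu]_y f^\- (x, y))); last first.
  apply/funext => x; rewrite [LHS]integralE.
  by under eq_integral do rewrite funepos_comp/=;
     under [X in _ - X = _]eq_integral do rewrite funeneg_comp/=.
apply: emeasurable_funB.
- by apply: (@measurable_tonelli_plane f^\+) => //; exact: measurable_funepos.
- by apply: (@measurable_tonelli_plane f^\-) => //; exact: measurable_funeneg.
Qed.
End PlaneFubini.

(** * Measure-preserving maps and changes of variables *)

Section MeasurePreserving.
Local Open Scope ereal_scope.
Context d (T : measurableType d) (R : realType) (mu : {measure set T -> \bar R}).

Definition preserves (phi : T -> T) :=
  measurable_fun setT phi /\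
  forall A, measurable A -> mu (phi @^-1` A) = mu A.

Lemma ge0_integral_preserves phi (f : T -> \bar R) : preserves phi ->
  measurable_fun setT f -> (forall x, 0 <= f x) ->
  \int[mu]_x f (phi x) = \int[mu]_x f x.
Proof.
move=> [mphi pphi] mf f0.
have := @ge0_integral_pushforward _ _ _ _ _ _ mphi mu setT f measurableT mf.
rewrite preimage_setT => <-; last by move=> y _; exact: f0.
apply: eq_measure_integral => A mA _.
exact: pphi.
Qed.

Lemma integral_preserves phi (f : T -> \bar R) : preserves phi ->
  measurable_fun setT f -> \int[mu]_x f (phi x) = \int[mu]_x f x.
Proof.
move=> pphi mf; rewrite integralE [in RHS]integralE; congr (_ - _).
- under eq_integral do rewrite (funepos_comp f phi).
  by apply: (ge0_integral_preserves (f := f^\+) pphi) => //; exact: measurable_funepos.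
- under eq_integral do rewrite (funeneg_comp f phi).
  by apply: (ge0_integral_preserves (f := f^\-) pphi) => //; exact: measurable_funeneg.
Qed.

Lemma Rintegral_preserves phi (f : T -> R) : preserves phi ->
  measurable_fun setT f -> (\int[mu]_x f (phi x) = \int[mu]_x f x)%R.
Proof.
move=> pphi mf; rewrite /Rintegral.
by rewrite (integral_preserves (f := EFin \o f) pphi)//; exact/measurable_EFinP.
Qed.

End MeasurePreserving.

(** * Translations and point reflection of the plane *)

Section PlaneMaps.
Variable R : realType.
Local Notation line := (measurableTypeR R).
Local Notation plane := (line * line)%type.
Local Notation leb := (@lebesgue_measure R).
Implicit Types (v x : plane) (a : R).

Definition shift v x : plane := (x.1 + v.1, x.2 + v.2).
Definition flip x : plane := (- x.1, - x.2).

(** The pushforward of Lebesgue measure agrees with it on half-open intervals, hence everywhere by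
    uniqueness. *)
Lemma preserves_add1 (a : R) : preserves leb (fun x : line => x + a : line).
Proof.
have madd : measurable_fun setT (fun x : line => x + a : line).
  exact: measurable_funD.
split=> // A mA; apply/esym.
pose m := measure_function_pushforward__canonical__measure_function_Measure leb madd.
rewrite -[RHS]/(m A).
apply: lebesgue_measure_unique => // _ [[b c]] _ <-.
rewrite /m/= /pushforward/=.
rewrite (_ : _ @^-1` _ = `](b - a), (c - a)]%classic); last first.
  by apply/seteqP; split=> x /=; rewrite !in_itv/= => /andP[? ?]; apply/andP; split; lra.
by rewrite !lebesgue_measure_itv/= !lte_fin ltrD2r -!EFinD; case: ifP => // _; congr EFin; lra.
Qed.

Lemma preserves_opp1 : preserves leb (fun x : line => - x : line).
Proof.
split; last exact: lebesgue_measureN.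
exact: measurableT_comp.
Qed.

(** The pushforward of the plane measure agrees with it on measurable rectangles, which determine a
    product measure. *)
Lemma preserves_prod (f g : line -> line) : preserves leb f -> preserves leb g ->
  preserves (@leb2 R) (fun x => (f x.1, g x.2)).
Proof.
move=> [mf pf] [mg pg].
have mfg : measurable_fun setT (fun x : plane => (f x.1, g x.2) : plane).
  apply/measurable_fun_pairP; split.
    exact: (measurableT_comp mf measurable_fst).
  exact: (measurableT_comp mg measurable_snd).
split=> // A mA; apply/esym.
pose m := measure_function_pushforward__canonical__measure_function_Measure (@leb2 R) mfg.
rewrite -[RHS]/(m A).
apply: product_measure_unique => // B C mB mC.
rewrite /m/= /pushforward/=.
rewrite (_ : _ @^-1` _ = (f @^-1` B) `*` (g @^-1` C))//.
have mfB : measurable (f @^-1` B) by rewrite -[X in measurable X]setTI; exact: mf.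
have mgC : measurable (g @^-1` C) by rewrite -[X in measurable X]setTI; exact: mg.
by rewrite /leb2 product_measure1E// pf// pg.
Qed.

Lemma preserves_shift v : preserves (@leb2 R) (shift v).
Proof.
exact: (preserves_prod (preserves_add1 v.1) (preserves_add1 v.2)).
Qed.

Lemma preserves_flip : preserves (@leb2 R) flip.
Proof. exact: (preserves_prod preserves_opp1 preserves_opp1). Qed.

End PlaneMaps.

(** * Poisson kernels *)

Section PoissonLine.
Variable R : realType.
Local Notation line := (measurableTypeR R).
Local Notation leb := (@lebesgue_measure R).
Implicit Types (e z k : R).

Definition decay e k : R := expR (- (e * `|k|)).
(** The cosine transform of [decay e]: 2 pi times the Poisson kernel of the half-plane at height
    [e]. *)
Definition poisson e z : R := 2 * e / (e ^+ 2 + z ^+ 2).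

Lemma decay_gt0 e k : 0 < decay e k. Proof. exact: expR_gt0. Qed.
Lemma decay_le1 e k : 0 <= e -> decay e k <= 1.
Proof. by move=> e0; rewrite /decay -expR0 ler_expR oppr_le0 mulr_ge0. Qed.
Lemma decayN e k : decay e (- k) = decay e k.
Proof. by rewrite /decay normrN. Qed.

Lemma continuous_decay e : continuous (decay e).
Proof.
move=> k; apply: (@continuous_comp _ _ _ (fun k => - (e * `|k|)) expR); last first.
  exact: continuous_expR.
apply: cvgN; apply: cvgM; first exact: cvg_cst.
exact: norm_continuous.
Qed.

Lemma poisson_ge0 e z : 0 < e -> 0 <= poisson e z.
Proof. by move=> e0; rewrite divr_ge0// ?mulr_ge0 ?addr_ge0 ?sqr_ge0// ltW. Qed.

Lemma poissonN e z : poisson e (- z) = poisson e z.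
Proof. by rewrite /poisson sqrrN. Qed.

Lemma continuous_poisson e : 0 < e -> continuous (poisson e).
Proof.
move=> e0 z; apply: cvgM; first exact: cvg_cst.
apply: cvgV; first by rewrite gt_eqF// ltr_wpDr ?sqr_ge0// exprn_gt0.
apply: cvgD; first exact: cvg_cst.
exact: exprn_continuous.
Qed.

(** An antiderivative in [k] of exp (- e k) (1 + cos (k z)), vanishing at infinity. Adding 1 to the
    cosine keeps the integrand nonnegative, as [ge0_continuous_FTC2y] requires on a half-line. *)
Let F e z k : R := expR (- (e * k)) *
  ((e ^+ 2 + z ^+ 2)^-1 * (z * sin (k * z) - e * cos (k * z)) - e^-1).

Let dF e z k : 0 < e -> is_derive k 1 (F e z) (expR (- (e * k)) * (1 + cos (k * z))).
Proof.
move=> e0.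
have h1 : is_derive k 1 (fun k => expR (- (e * k))) (- e * expR (- (e * k))).
  have h : is_derive k 1 (fun k : R => - (e * k)) (- e).
    by apply: is_derive_eq; rewrite /GRing.scale/= mulr1.
  by rewrite mulrC; apply: (is_derive1_comp _ h).
have hz : is_derive k 1 (fun k : R => k * z) z.
  by apply: is_derive_eq; rewrite scaler0 add0r /GRing.scale/= mulr1.
have hs : is_derive k 1 (fun k : R => sin (k * z)) (z * cos (k * z)).
  by rewrite mulrC; apply: (is_derive1_comp _ hz).
have hc : is_derive k 1 (fun k : R => cos (k * z)) (z * - sin (k * z)).
  by rewrite mulrC; apply: (is_derive1_comp _ hz).
have h2 : is_derive k 1 (fun k => ((e ^+ 2 + z ^+ 2)^-1 * (z * sin (k * z) - e * cos (k * z)) - e^-1)) ((e ^+ 2 + z ^+ 2)^-1 * (z * (z * cos (k * z)) - e * (z * - sin (k * z)))).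
  have h : is_derive k 1 (fun k => z * sin (k * z) - e * cos (k * z)) (z * (z * cos (k * z)) - e * (z * - sin (k * z))).
    exact: is_deriveB.
  by apply: is_derive_eq; rewrite /GRing.scale/= subr0.
have := is_deriveM h1 h2; rewrite /F => h; apply: is_derive_eq; rewrite /GRing.scale/=.
have n0 : e ^+ 2 + z ^+ 2 != 0 by rewrite gt_eqF// ltr_wpDr ?sqr_ge0// exprn_gt0.
by field; rewrite n0 gt_eqF.
Qed.

Let F_cvg e z : 0 < e -> F e z k @[k --> +oo] --> 0.
Proof.
move=> e0.
have he : expR (- (e * k)) @[k --> +oo] --> (0 : R).
  apply: (@cvg_comp _ _ _ (fun k => e * k) (fun k => expR (- k))); last exact: cvgr_expR.
  exact: gt0_cvgMry.
pose M := (e ^+ 2 + z ^+ 2)^-1 * (`|z| + e) + e^-1.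
apply: (@squeeze_cvgr _ _ _ _ (fun k => - (expR (- (e * k)) * M)) (fun k => expR (- (e * k)) * M)).
- near=> k; rewrite -ler_norml /F normrM ger0_norm ?expR_ge0// ler_wpM2l ?expR_ge0//.
  rewrite (le_trans (ler_normB _ _))// /M [X in _ + X]ger0_norm ?invr_ge0 ?(ltW e0)// lerD2r.
  rewrite normrM ger0_norm ?invr_ge0 ?addr_ge0 ?sqr_ge0// ler_wpM2l ?invr_ge0 ?addr_ge0 ?sqr_ge0//.
  rewrite (le_trans (ler_normB _ _))// !normrM (ger0_norm (ltW e0)) lerD//.
    by rewrite ler_piMr// ler_norml sin_geN1 sin_le1.
  by rewrite ler_piMr ?(ltW e0)// ler_norml cos_geN1 cos_le1.
- by rewrite -[X in _ --> X]oppr0; apply: cvgN; rewrite -(mul0r M); apply: cvgM => //; exact: cvg_cst.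
- by rewrite -(mul0r M); apply: cvgM => //; exact: cvg_cst.
Unshelve. all: by end_near. Qed.

Lemma integral_decay_cos1 e z : 0 < e ->
  (\int[leb]_k (decay e k * (1 + cos (k * z)))%:E = (2 * (e / (e ^+ 2 + z ^+ 2) + e^-1))%:E)%E.
Proof.
move=> e0; rewrite (@ge0_symfun_integralT _ (fun k => decay e k * (1 + cos (k * z)))); last 3 first.
- move=> k; rewrite mulr_ge0// ?(ltW (decay_gt0 _ _))//; have := cos_geN1 (k * z); lra.
- move=> k; apply: cvgM; first exact: continuous_decay.
  apply: cvgD; first exact: cvg_cst.
  apply: (@continuous_comp _ _ _ (fun k => k * z) cos); last exact: continuous_cos.
  by apply: cvgM; [exact: cvg_id|exact: cvg_cst].
- by move=> k /=; rewrite decayN mulNr cosN.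
have -> : [set x | (0 <= x)%R] = `[0%R, +oo[%classic :> set R.
  by apply/seteqP; split=> x /=; rewrite in_itv/= andbT.
rewrite (@eq_integral _ _ _ leb `[0%R, +oo[%classic (fun k => (expR (- (e * k)) * (1 + cos (k * z)))%:E)); last first.
  by move=> k; rewrite inE/= in_itv/= andbT => k0; rewrite /decay ger0_norm.

have dd k : derivable (F e z) k 1 by have [] := dF z k e0.
rewrite (@ge0_continuous_FTC2y _ _ (F e z) 0 0)//; first last.
- move=> k _; rewrite derive1E; have dk := dF z k e0; exact: derive_val.
- apply: cvg_at_right_filter; apply: differentiable_continuous.
  by apply/derivable1_diffP.
- exact: F_cvg.
- apply: continuous_subspaceT => k; apply: cvgM.
    apply: (@continuous_comp _ _ _ (fun k => - (e * k)) expR); last exact: continuous_expR.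
    by apply: cvgN; apply: cvgM; [exact: cvg_cst|exact: cvg_id].
  apply: cvgD; first exact: cvg_cst.
  apply: (@continuous_comp _ _ _ (fun k => k * z) cos); last exact: continuous_cos.
  by apply: cvgM; [exact: cvg_id|exact: cvg_cst].
rewrite -EFinB -EFinM; congr EFin.
rewrite /F mulr0 oppr0 expR0 mul0r sin0 cos0.
have n0 : e ^+ 2 + z ^+ 2 != 0 by rewrite gt_eqF// ltr_wpDr ?sqr_ge0// exprn_gt0.
by field; rewrite n0 gt_eqF.
Qed.

(** Half of the previous integral at z = 0. *)
Lemma integral_decay e : 0 < e -> (\int[leb]_k (decay e k)%:E = (2 / e)%:E)%E.
Proof.
move=> e0; have := integral_decay_cos1 0 e0.
under eq_integral do rewrite mulr0 cos0.
rewrite (_ : (fun k => (decay e k * (1 + 1))%:E) = (fun k => (2%:E * (decay e k)%:E)%E)); last first.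
  by apply/funext => k; rewrite -EFinM; congr EFin; lra.
rewrite ge0_integralZl_EFin//; last 2 first.
- by move=> k _; rewrite lee_fin ltW// decay_gt0.
- by apply/measurable_EFinP; apply: continuous_measurable_fun; exact: continuous_decay.
move=> h; rewrite -[LHS]mul1e -[1%E]/(1%:E) -(@mulVf _ (2:R))// EFinM -muleA h -EFinM; congr EFin.
by field; rewrite gt_eqF.
Qed.

Lemma integrable_decay e : 0 < e -> leb.-integrable setT (EFin \o decay e).
Proof.
move=> e0; apply/integrableP; split.
  by apply/measurable_EFinP; apply: continuous_measurable_fun; exact: continuous_decay.
under eq_integral do rewrite gee0_abs ?lee_fin ?(ltW (decay_gt0 _ _))//.
by rewrite /comp integral_decay// ltry.
Qed.

Lemma integrable_decayM e (f : line -> R) : 0 < e -> measurable_fun setT f ->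
  (forall k, `|f k| <= 1) -> leb.-integrable setT (fun k => (decay e k * f k)%:E).
Proof.
move=> e0 mf f1; apply: le_integrable (integrable_decay e0) => //.
  apply/measurable_EFinP; apply: measurable_funM => //.
  by apply: continuous_measurable_fun; exact: continuous_decay.
move=> k _ /=; rewrite lee_fin normrM.
by rewrite ler_piMr.
Qed.

Lemma measurable_sinM z : measurable_fun setT (fun k : line => sin (k * z)).
Proof.
apply: continuous_measurable_fun => k.
apply: (@continuous_comp _ _ _ (fun k => k * z) sin); last exact: continuous_sin.
by apply: cvgM; [exact: cvg_id|exact: cvg_cst].
Qed.

Lemma measurable_cosM z : measurable_fun setT (fun k : line => cos (k * z)).
Proof.
apply: continuous_measurable_fun => k.
apply: (@continuous_comp _ _ _ (fun k => k * z) cos); last exact: continuous_cos.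
by apply: cvgM; [exact: cvg_id|exact: cvg_cst].
Qed.

Lemma cos_norm_le1 (t : R) : `|cos t| <= 1.
Proof. by rewrite ler_norml cos_geN1 cos_le1. Qed.
Lemma sin_norm_le1 (t : R) : `|sin t| <= 1.
Proof. by rewrite ler_norml sin_geN1 sin_le1. Qed.

Lemma Rintegral_decay_cos e z : 0 < e ->
  \int[leb]_k (decay e k * cos (k * z)) = poisson e z.
Proof.
move=> e0.
have i1 := integrable_decay e0.
have i2 : leb.-integrable setT (fun k => (decay e k * (1 + cos (k * z)))%:E).
  rewrite (_ : (fun k => _) = (fun k => ((decay e k)%:E + (decay e k * cos (k * z))%:E)%E)); last first.
    by apply/funext => k; rewrite -EFinD mulrDr mulr1.
  apply: integrableD => //; apply: integrable_decayM => //; first exact: measurable_cosM.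
  by move=> k; exact: cos_norm_le1.
rewrite (_ : (fun k => _) = (fun k => decay e k * (1 + cos (k * z)) - decay e k)); last first.
  by apply/funext => k; ring.
rewrite RintegralB// /Rintegral integral_decay// integral_decay_cos1//=.
have n0 : e ^+ 2 + z ^+ 2 != 0 by rewrite gt_eqF// ltr_wpDr ?sqr_ge0// exprn_gt0.
by rewrite /poisson; field; rewrite n0 gt_eqF.
Qed.

(** The integrand is odd, so reflection shows that the integral is its own opposite. *)
Lemma Rintegral_decay_sin e z : 0 < e ->
  \int[leb]_k (decay e k * sin (k * z)) = 0.
Proof.
move=> e0.
have i1 : leb.-integrable setT (fun k => (decay e k * sin (k * z))%:E).
  by apply: integrable_decayM => //; [exact: measurable_sinM|move=> k; exact: sin_norm_le1].
have := @Rintegral_preserves _ _ _ leb _ (fun k => decay e k * sin (k * z)) (preserves_opp1 R).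
have /measurable_EFinP mi := measurable_int _ i1.
move=> /(_ mi).
under eq_Rintegral do rewrite decayN mulNr sinN mulrN -mulN1r.
rewrite RintegralZl// => h; lra.
Qed.

Lemma integral_poisson e : 0 < e -> (\int[leb]_z (poisson e z)%:E = (2 * pi)%:E)%E.
Proof.
move=> e0; rewrite ge0_symfun_integralT; last 3 first.
- by move=> z; exact: poisson_ge0.
- exact: continuous_poisson.
- by move=> z /=; rewrite poissonN.
have -> : [set x | (0 <= x)%R] = `[0%R, +oo[%classic :> set R.
  by apply/seteqP; split=> x /=; rewrite in_itv/= andbT.
(* The antiderivative 2 atan (z / e) goes from 0 to pi on the half-line; evenness doubles this. *)
have dG z : is_derive z 1 (fun z => 2 * atan (z * e^-1)) (poisson e z).
  have hz : is_derive z 1 (fun k : R => k * e^-1) e^-1.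
    by apply: is_derive_eq; rewrite scaler0 add0r /GRing.scale/= mulr1.
  have h := is_derive1_comp _ hz.
  have h1 : is_derive z 1 (fun z => atan (z * e^-1)) ((1 + (z * e^-1) ^+ 2)^-1 * e^-1).
    exact: (is_derive1_comp _ hz).
  apply: is_derive_eq; rewrite /GRing.scale/= /poisson.
  have n0 : e ^+ 2 + z ^+ 2 != 0 by rewrite gt_eqF// ltr_wpDr ?sqr_ge0// exprn_gt0.
  by field; rewrite n0 gt_eqF.
have dd k : derivable (fun z => 2 * atan (z * e^-1)) k 1 by have [] := dG k.
rewrite (@ge0_continuous_FTC2y _ _ (fun z => 2 * atan (z * e^-1)) 0 pi)//; first last.
- by move=> k _; rewrite derive1E; exact: derive_val.
- apply: cvg_at_right_filter.
  apply: (@differentiable_continuous _ _ _ 0 (fun z : R => 2 * atan (z / e))).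
  by apply/derivable1_diffP.
- rewrite (_ : pi = 2 * (pi / 2) :> R); last lra.
  apply: cvgM; first exact: cvg_cst.
  apply: (@cvg_comp _ _ _ (fun k => k * e^-1) atan); last exact: cvgy_atan.
  by apply: gt0_cvgMly => //; rewrite invr_gt0.
- by apply: continuous_subspaceT; exact: continuous_poisson.
- by move=> z _; exact: poisson_ge0.
by rewrite mul0r atan0 mulr0 sube0 -EFinM.
Qed.

End PoissonLine.

(** * Integrals of products of functions of one coordinate *)

Section ProductIntegrals.
Variable R : realType.
Local Notation line := (measurableTypeR R).
Local Notation plane := (line * line)%type.
Local Notation leb := (@lebesgue_measure R).
Local Notation mu := (leb2 R).
Implicit Types f g : line -> R.

Lemma measurable_prodM f g : measurable_fun setT f -> measurable_fun setT g ->
  measurable_fun setT (fun x : plane => f x.1 * g x.2).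
Proof.
move=> mf mg; apply: measurable_funM.
- exact: (measurableT_comp mf measurable_fst).
- exact: (measurableT_comp mg measurable_snd).
Qed.

Lemma ge0_integral_prodM f g : measurable_fun setT f -> measurable_fun setT g ->
  (forall x, 0 <= f x) -> (forall x, 0 <= g x) ->
  (\int[mu]_x (f x.1 * g x.2)%:E = \int[leb]_x (f x)%:E * \int[leb]_x (g x)%:E)%E.
Proof.
move=> mf mg f0 g0; rewrite /leb2.
have mfE : measurable_fun setT (EFin \o f) by exact/measurable_EFinP.
have mgE : measurable_fun setT (EFin \o g) by exact/measurable_EFinP.
rewrite (@fubini_tonelli1 _ _ _ _ _ leb leb (fun x : plane => (f x.1 * g x.2)%:E)); last 2 first.
- by apply/measurable_EFinP; exact: measurable_prodM.
- by move=> x; rewrite lee_fin mulr_ge0.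
rewrite /fubini_F/=.
under eq_integral.
  move=> x _; under eq_integral do rewrite EFinM.
  rewrite ge0_integralZl_EFin//; last by move=> *; rewrite lee_fin.
  over.
rewrite ge0_integralZr//; first by move=> *; rewrite lee_fin.
by apply: integral_ge0 => *; rewrite lee_fin.
Qed.

Lemma integrable_prodM f g : leb.-integrable setT (EFin \o f) ->
  leb.-integrable setT (EFin \o g) ->
  mu.-integrable setT (fun x => (f x.1 * g x.2)%:E).
Proof.
move=> /integrableP[/measurable_EFinP mf fi] /integrableP[/measurable_EFinP mg gi].
apply/integrableP; split; first by apply/measurable_EFinP; exact: measurable_prodM.
under eq_integral do rewrite abse_EFin normrM.
have mnf : measurable_fun setT (fun x => `|f x|) by exact: measurableT_comp.
have mng : measurable_fun setT (fun x => `|g x|) by exact: measurableT_comp.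
rewrite (ge0_integral_prodM mnf mng)//.
apply: lte_mul_pinfty => //.
  by apply: integral_ge0 => *; rewrite lee_fin.
by rewrite ge0_fin_numE//; apply: integral_ge0 => *; rewrite lee_fin.
Qed.

Lemma Rintegral_prodM f g : leb.-integrable setT (EFin \o f) ->
  leb.-integrable setT (EFin \o g) ->
  \int[mu]_x (f x.1 * g x.2) = (\int[leb]_x f x) * (\int[leb]_x g x).
Proof.
move=> fi gi; rewrite {1}/Rintegral {1}/leb2.
rewrite -(@integral12_prod_meas1 _ _ _ _ _ leb leb); last exact: integrable_prodM.
rewrite /fubini_F/=.
have gE : (\int[leb]_x (g x)%:E = (\int[leb]_x g x)%:E)%E.
  by rewrite /Rintegral fineK//; exact: (integrable_fin_num _ gi).
under eq_integral.
  move=> x _; under eq_integral do rewrite EFinM.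
  rewrite integralZl//= gE.
  over.
by rewrite (integralZr measurableT fi)/= fineM//; exact: (integrable_fin_num _ fi).
Qed.

End ProductIntegrals.

(** * The Poisson kernel of the plane *)

Section PoissonPlane.
Variable R : realType.
Local Notation line := (measurableTypeR R).
Local Notation plane := (line * line)%type.
Local Notation leb := (@lebesgue_measure R).
Local Notation mu := (leb2 R).
Implicit Types (e : R) (k x z : plane).

Definition decay2 e k : R := decay e k.1 * decay e k.2.
Definition poisson2 e z : R := poisson e z.1 * poisson e z.2.

Lemma measurable_decay e : measurable_fun setT (decay e : line -> R).
Proof. by apply: continuous_measurable_fun; exact: continuous_decay. Qed.

Lemma measurable_poisson e : 0 < e -> measurable_fun setT (poisson e : line -> R).
Proof. by move=> e0; apply: continuous_measurable_fun; exact: continuous_poisson. Qed.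

Lemma measurable_decay2 e : measurable_fun setT (decay2 e).
Proof. by apply: measurable_prodM; exact: measurable_decay. Qed.

Lemma measurable_poisson2 e : 0 < e -> measurable_fun setT (poisson2 e).
Proof. by move=> e0; apply: measurable_prodM; exact: measurable_poisson. Qed.

Lemma decay2_gt0 e k : 0 < decay2 e k.
Proof. by rewrite mulr_gt0// decay_gt0. Qed.

Lemma decay2_le1 e k : 0 <= e -> decay2 e k <= 1.
Proof. by move=> e0; rewrite mulr_ile1// ?(ltW (decay_gt0 _ _)) ?decay_le1. Qed.

Lemma poisson2_ge0 e z : 0 < e -> 0 <= poisson2 e z.
Proof. by move=> e0; rewrite mulr_ge0// poisson_ge0. Qed.

Lemma poisson2_flip e z : poisson2 e (flip z) = poisson2 e z.
Proof. by rewrite /poisson2 /= !poissonN. Qed.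

Lemma integrable_decay2 e : 0 < e -> mu.-integrable setT (EFin \o decay2 e).
Proof. by move=> e0; apply: integrable_prodM; exact: integrable_decay. Qed.

Lemma integral_poisson2 e : 0 < e ->
  (\int[mu]_z (poisson2 e z)%:E = ((2 * pi) ^+ 2)%:E)%E.
Proof.
move=> e0; rewrite ge0_integral_prodM; try exact: measurable_poisson.
- by rewrite integral_poisson// -EFinM expr2.
- by move=> x; exact: poisson_ge0.
- by move=> x; exact: poisson_ge0.
Qed.

Let icos e (t : R) : 0 < e ->
  leb.-integrable setT (EFin \o (fun k : line => decay e k * cos (k * t))).
Proof.
move=> e0; apply: integrable_decayM => //; [exact: measurable_cosM|].
by move=> k; exact: cos_norm_le1.
Qed.

Let isin e (t : R) : 0 < e ->
  leb.-integrable setT (EFin \o (fun k : line => decay e k * sin (k * t))).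
Proof.
move=> e0; apply: integrable_decayM => //; [exact: measurable_sinM|].
by move=> k; exact: sin_norm_le1.
Qed.

(** The addition formula splits the cosine into products of one-variable functions; the product of
    sines integrates to 0. *)
Lemma Rintegral_decay2_cos e z : 0 < e ->
  \int[mu]_k (decay2 e k * cos (dot k z)) = poisson2 e z.
Proof.
move=> e0.
pose c1 := icos z.1 e0; pose c2 := icos z.2 e0.
pose s1 := isin z.1 e0; pose s2 := isin z.2 e0.
rewrite (_ : (fun k => _) = (fun k =>
   (decay e k.1 * cos (k.1 * z.1)) * (decay e k.2 * cos (k.2 * z.2))
 - (decay e k.1 * sin (k.1 * z.1)) * (decay e k.2 * sin (k.2 * z.2)))); last first.
  by apply/funext => k; rewrite /decay2 /dot cosD; ring.
rewrite (RintegralB _ (integrable_prodM c1 c2) (integrable_prodM s1 s2))//.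
rewrite (Rintegral_prodM c1 c2) (Rintegral_prodM s1 s2).
by rewrite !Rintegral_decay_cos// !Rintegral_decay_sin// mul0r subr0.
Qed.

Lemma Rintegral_decay2_sin e z : 0 < e ->
  \int[mu]_k (decay2 e k * sin (dot k z)) = 0.
Proof.
move=> e0.
pose c1 := icos z.1 e0; pose c2 := icos z.2 e0.
pose s1 := isin z.1 e0; pose s2 := isin z.2 e0.
rewrite (_ : (fun k => _) = (fun k =>
   (decay e k.1 * sin (k.1 * z.1)) * (decay e k.2 * cos (k.2 * z.2))
 + (decay e k.1 * cos (k.1 * z.1)) * (decay e k.2 * sin (k.2 * z.2)))); last first.
  by apply/funext => k; rewrite /decay2 /dot sinD; ring.
rewrite (RintegralD _ (integrable_prodM s1 c2) (integrable_prodM c1 s2))//.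
rewrite (Rintegral_prodM s1 c2) (Rintegral_prodM c1 s2).
by rewrite !Rintegral_decay_sin// mul0r mulr0 addr0.
Qed.

End PoissonPlane.

(** * The Hartley transform *)

Section Hartley.
Variable R : realType.
Local Notation line := (measurableTypeR R).
Local Notation plane := (line * line)%type.
Local Notation mu := (leb2 R).
Implicit Types (e : R) (k x y z : plane) (a b g : plane -> R).

Definition cas (t : R) : R := cos t + sin t.
(** Left unnormalised, which is why the factor (2 pi)^2 appears in [hartley_plancherel]. *)
Definition hartley a k : R := \int[mu]_x (cas (dot k x) * a x).
Definition sqint a : \bar R := (\int[mu]_x ((a x) ^+ 2)%:E)%E.

Lemma cas_le2 t : `|cas t| <= 2.
Proof.
rewrite (le_trans (ler_normD _ _))// (_ : 2 = 1 + 1)//.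
by rewrite lerD// ?cos_norm_le1 ?sin_norm_le1.
Qed.

Lemma measurable_dot : measurable_fun setT (fun p : plane * plane => dot p.1 p.2).
Proof.
apply: measurable_funD; apply: measurable_funM.
- exact: (measurableT_comp measurable_fst measurable_fst).
- exact: (measurableT_comp measurable_fst measurable_snd).
- exact: (measurableT_comp measurable_snd measurable_fst).
- exact: (measurableT_comp measurable_snd measurable_snd).
Qed.

Lemma measurable_cas : measurable_fun setT cas.
Proof.
by apply: measurable_funD; apply: continuous_measurable_fun; [exact: continuous_cos|exact: continuous_sin].
Qed.

Lemma measurable_cas_dot : measurable_fun setT (fun p : plane * plane => cas (dot p.1 p.2)).
Proof. exact: (measurableT_comp measurable_cas measurable_dot). Qed.

Lemma dotC k x : dot k x = dot x k.
Proof. by rewrite /dot mulrC [X in _ + X]mulrC. Qed.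

Lemma integrable_boundedM (f a : plane -> R) (M : R) : measurable_fun setT f ->
  (forall x, `|f x| <= M) -> mu.-integrable setT (EFin \o a) ->
  mu.-integrable setT (EFin \o (fun x => f x * a x)).
Proof.
move=> mf fM ia.
have M0 : 0 <= M by apply: le_trans (fM (0, 0)).
have iMa : mu.-integrable setT (EFin \o (fun x => M * a x)).
  exact: (@integrableZl _ _ _ mu _ measurableT M (EFin \o a)).
apply: le_integrable iMa => //.
  apply/measurable_EFinP; apply: measurable_funM => //.
  by apply/measurable_EFinP; exact: measurable_int ia.
by move=> x _ /=; rewrite lee_fin !normrM ler_wpM2r// (ger0_norm M0).
Qed.

(** The iterated integral is at most M times the product of the L^1 norms of [g] and [b]; this is
    the hypothesis of Fubini in [Rintegral_swap]. *)
Lemma iterated_abs_lty (f : plane * plane -> R) (M : R) (g b : plane -> R) :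
  measurable_fun setT f -> (forall p, `|f p| <= M) ->
  mu.-integrable setT (EFin \o g) -> mu.-integrable setT (EFin \o b) ->
  (\int[mu]_x \int[mu]_y `|(g x * f (x, y) * b y)%:E| < +oo)%E.
Proof.
move=> mf fM ig ib.
have mg : measurable_fun setT g by apply/measurable_EFinP; exact: measurable_int ig.
have mb : measurable_fun setT b by apply/measurable_EFinP; exact: measurable_int ib.
have mng : measurable_fun setT (fun x => `|g x|) by exact: measurableT_comp.
have mnb : measurable_fun setT (fun x => `|b x|) by exact: measurableT_comp.
have mf1 k : measurable_fun setT (fun y => f (k, y)) by exact: measurable_fun_pair2.
have M0 : 0 <= M by apply: le_trans (fM ((0, 0), (0, 0))).
have mF : measurable_fun setT (fun p : plane * plane => `|(g p.1 * f p * b p.2)%:E|%E).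
  apply: measurableT_comp => //; apply/measurable_EFinP; apply: measurable_funM.
    by apply: measurable_funM => //; exact: (measurableT_comp mg measurable_fst).
  exact: (measurableT_comp mb measurable_snd).
have g0 : (0 <= \int[mu]_y (`|g y|)%:E)%E by apply: integral_ge0 => *; rewrite lee_fin.
have b0 : (0 <= \int[mu]_y (`|b y|)%:E)%E by apply: integral_ge0 => *; rewrite lee_fin.
have /integrableP[_ bi] := ib; have /integrableP[_ gi] := ig.
apply: (@le_lt_trans _ _ (\int[mu]_x ((M * `|g x|)%:E * \int[mu]_y (`|b y|)%:E)))%E.
  apply: ge0_le_integral; [exact: measurableT| |exact: (measurable_tonelli_plane mF)| |].
  - by move=> x _; apply: integral_ge0.
  - apply: emeasurable_funM => //; apply/measurable_EFinP; exact: measurable_funM.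
  - move=> x _.
    rewrite -(@ge0_integralZl _ _ _ mu _ measurableT (fun y => (`|b y|)%:E)); last 3 first.
    + exact/measurable_EFinP.
    + by move=> y _; rewrite lee_fin.
    + by rewrite lee_fin mulr_ge0.
    apply: ge0_le_integral; [exact: measurableT| | | |].
    + by move=> y _; exact: abse_ge0.
    + apply: measurableT_comp => //; apply/measurable_EFinP; apply: measurable_funM => //.
      exact: measurable_funM.
    + by apply: emeasurable_funM => //; exact/measurable_EFinP.
    + by move=> y _; rewrite -EFinM lee_fin !normrM ler_wpM2r// mulrC ler_wpM2r.
rewrite ge0_integralZr; last 4 first.
- exact: measurableT.
- by apply/measurable_EFinP; exact: measurable_funM.
- by move=> x _; rewrite lee_fin mulr_ge0.
- exact: b0.
under eq_integral do rewrite EFinM.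
rewrite ge0_integralZl_EFin; last 4 first.
- exact: measurableT.
- by move=> x _; rewrite lee_fin.
- exact/measurable_EFinP.
- exact: M0.
apply: lte_mul_pinfty; [by rewrite mule_ge0| |exact: bi].
by rewrite fin_numM// ge0_fin_numE.
Qed.

(** Fubini for real-valued integrals. Every inner integral is finite, so passing from extended to
    real values by [fine] loses nothing. *)
Lemma Rintegral_swap (f : plane * plane -> R) (M : R) (g b : plane -> R) :
  measurable_fun setT f -> (forall p, `|f p| <= M) ->
  mu.-integrable setT (EFin \o g) -> mu.-integrable setT (EFin \o b) ->
  \int[mu]_k (g k * \int[mu]_y (f (k, y) * b y)) =
  \int[mu]_y (b y * \int[mu]_k (f (k, y) * g k)).
Proof.
move=> mf fM ig ib.
have mg : measurable_fun setT g by apply/measurable_EFinP; exact: measurable_int ig.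
have mb : measurable_fun setT b by apply/measurable_EFinP; exact: measurable_int ib.
have mf1 k : measurable_fun setT (fun y => f (k, y)) by exact: measurable_fun_pair2.
have mf2 y : measurable_fun setT (fun k => f (k, y)) by exact: measurable_fun_pair1.
have M0 : 0 <= M by apply: le_trans (fM ((0, 0), (0, 0))).
pose F (p : plane * plane) := (g p.1 * f p * b p.2)%:E.
have mF : measurable_fun setT F.
  apply/measurable_EFinP; apply: measurable_funM.
    by apply: measurable_funM => //; exact: (measurableT_comp mg measurable_fst).
  exact: (measurableT_comp mb measurable_snd).
have := @fubini_plane R F mF.
rewrite /F/= => H.
rewrite /Rintegral; congr fine.
transitivity (\int[mu]_x \int[mu]_y (g x * f (x, y) * b y)%:E)%E.
  apply: eq_integral => x _.
  rewrite EFinM -/(Rintegral _ _ _) /Rintegral fineK; last first.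
    by apply: integrable_fin_num => //; apply: (integrable_boundedM (f := fun y => f (x, y))).
  rewrite -integralZl//; last by apply: (integrable_boundedM (f := fun y => f (x, y))).
  by apply: eq_integral => y _; rewrite /= -EFinM mulrA.
rewrite H; last exact: (iterated_abs_lty mf fM ig ib).
apply: eq_integral => y _.
rewrite EFinM -/(Rintegral _ _ _) /Rintegral fineK; last first.
  by apply: integrable_fin_num => //; apply: (integrable_boundedM (f := fun k => f (k, y))).
rewrite -integralZl//; last by apply: (integrable_boundedM (f := fun k => f (k, y))).
by apply: eq_integral => x _; rewrite /= -EFinM; congr EFin; ring.
Qed.

Lemma measurable_hartley a : measurable_fun setT a -> measurable_fun setT (hartley a).
Proof.
move=> ma; apply: (measurableT_comp (fine_measurable measurableT)).
apply: (@measurable_fubini_plane _ (fun p => (cas (dot p.1 p.2) * a p.2)%:E)).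
apply/measurable_EFinP; apply: measurable_funM; first exact: measurable_cas_dot.
exact: (measurableT_comp ma measurable_snd).
Qed.

Lemma measurable_dot1 k : measurable_fun setT (fun x => dot k x).
Proof. exact: (measurable_fun_pair2 k measurable_dot). Qed.

Lemma integrable_cas a k : mu.-integrable setT (EFin \o a) ->
  mu.-integrable setT (EFin \o (fun x => cas (dot k x) * a x)).
Proof.
move=> ia; apply: integrable_boundedM ia; last by move=> x; exact: cas_le2.
apply: (measurableT_comp measurable_cas); exact: measurable_dot1.
Qed.

Lemma hartley_bound a k : mu.-integrable setT (EFin \o a) ->
  `|hartley a k| <= 2 * \int[mu]_x `|a x|.
Proof.
move=> ia; rewrite (le_trans (le_normr_Rintegral _ (integrable_cas k ia)))//.
have ina : mu.-integrable setT (EFin \o (fun x => `|a x|)) by exact: (integrable_norm ia).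
rewrite -RintegralZl//; apply: le_Rintegral => //.
- exact: (integrable_norm (integrable_cas k ia)).
- exact: (@integrableZl _ _ _ mu _ measurableT 2 (EFin \o (fun x => `|a x|))).
- by move=> x _; rewrite normrM ler_wpM2r// cas_le2.
Qed.

(** The difference x - y, written as a translation so that changes of variables apply to it. *)
Definition psub x y : plane := shift (flip y) x.

Lemma casM_dot k x y : cas (dot k y) * cas (dot k x) =
  cos (dot k (psub x y)) + sin (dot k (shift y x)).
Proof.
have -> : dot k (psub x y) = dot k x - dot k y by rewrite /dot/=; ring.
have -> : dot k (shift y x) = dot k x + dot k y by rewrite /dot/=; ring.
by rewrite /cas cosB sinD; ring.
Qed.

Lemma Rintegral_casM e x y : 0 < e ->
  \int[mu]_k (cas (dot k y) * (cas (dot k x) * decay2 e k)) = poisson2 e (psub x y).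
Proof.
move=> e0.
have md z : measurable_fun setT (fun k => dot k z).
  exact: (measurable_fun_pair1 z measurable_dot).
under eq_Rintegral do rewrite mulrA casM_dot mulrC mulrDr.
rewrite RintegralD//; last 2 first.
- under [X in _.-integrable _ (_ \o X)]eq_fun do rewrite mulrC.
  apply: (integrable_boundedM (M := 1) (f := fun k => cos (dot k (psub x y)))).
  + apply: (measurableT_comp (f := cos)) => //; apply: continuous_measurable_fun; exact: continuous_cos.
  + by move=> k; exact: cos_norm_le1.
  + exact: integrable_decay2.
- under [X in _.-integrable _ (_ \o X)]eq_fun do rewrite mulrC.
  apply: (integrable_boundedM (M := 1) (f := fun k => sin (dot k (shift y x)))).
  + apply: (measurableT_comp (f := sin)) => //; apply: continuous_measurable_fun; exact: continuous_sin.
  + by move=> k; exact: sin_norm_le1.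
  + exact: integrable_decay2.
by rewrite Rintegral_decay2_cos// Rintegral_decay2_sin// addr0.
Qed.

(** One factor [hartley a k] at a time is expanded and exchanged with the integral in [k]. At this
    point [hartley a] is only known to be bounded, and the weight supplies the integrability that
    Fubini needs. *)
Lemma hartley_regularised a e : 0 < e -> mu.-integrable setT (EFin \o a) ->
  \int[mu]_k (decay2 e k * hartley a k ^+ 2) =
  \int[mu]_x (a x * \int[mu]_y (a y * poisson2 e (psub x y))).
Proof.
move=> e0 ia.
have ma : measurable_fun setT a by apply/measurable_EFinP; exact: measurable_int ia.
have id := integrable_decay2 e0.
have mc := measurable_cas_dot.
have c2 (p : plane * plane) : `|cas (dot p.1 p.2)| <= 2 by exact: cas_le2.
have idH : mu.-integrable setT (EFin \o (fun k => hartley a k * decay2 e k)).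
  apply: (integrable_boundedM (M := 2 * \int[mu]_x `|a x|)) => //.
  - exact: measurable_hartley.
  - by move=> k; exact: hartley_bound.
transitivity (\int[mu]_k ((hartley a k * decay2 e k) * \int[mu]_x (cas (dot k x) * a x))).
  by apply: eq_Rintegral => k _; rewrite -/(hartley a k) expr2; ring.
rewrite (Rintegral_swap mc c2 idH ia).
apply: eq_Rintegral => x _; congr (_ * _).
have icd : mu.-integrable setT (EFin \o (fun k => cas (dot k x) * decay2 e k)).
  apply: (integrable_boundedM (M := 2)) => //.
  - apply: (measurableT_comp measurable_cas); exact: (measurable_fun_pair1 x measurable_dot).
  - by move=> k; exact: cas_le2.
transitivity (\int[mu]_k ((cas (dot k x) * decay2 e k) * \int[mu]_y (cas (dot k y) * a y))).
  by apply: eq_Rintegral => k _; rewrite -/(hartley a k)/=; ring.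
rewrite (Rintegral_swap mc c2 icd ia).
by apply: eq_Rintegral => y _; congr (_ * _); exact: Rintegral_casM.
Qed.

End Hartley.

(** * The energy identity of the regularised Hartley transform *)

Section Energy.
Variable R : realType.
Local Notation line := (measurableTypeR R).
Local Notation plane := (line * line)%type.
Local Notation mu := (leb2 R).
Local Notation mu2 := (sleb2 R \x sleb2 R)%E.
Implicit Types (e : R) (k x y z : plane) (a b g : plane -> R).

Definition sqdiff a z : \bar R := (\int[mu]_x ((a (shift z x) - a x) ^+ 2)%:E)%E.

Lemma measurable_shift2 : measurable_fun setT (fun p : plane * plane => shift p.1 p.2).
Proof.
apply/measurable_fun_pairP; split.
- apply: (measurable_funD (f := fun p : plane * plane => p.2.1) (g := fun p : plane * plane => p.1.1)).
  + exact: (measurableT_comp measurable_fst measurable_snd).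
  + exact: (measurableT_comp measurable_fst measurable_fst).
- apply: (measurable_funD (f := fun p : plane * plane => p.2.2) (g := fun p : plane * plane => p.1.2)).
  + exact: (measurableT_comp measurable_snd measurable_snd).
  + exact: (measurableT_comp measurable_snd measurable_fst).
Qed.

Lemma measurable_shift z : measurable_fun setT (shift z).
Proof. by case: (preserves_shift z). Qed.

Lemma measurable_flip : measurable_fun setT (@flip R).
Proof. by case: (preserves_flip R). Qed.

Lemma measurable_psub : measurable_fun setT (fun p : plane * plane => psub p.1 p.2).
Proof.
apply/measurable_fun_pairP; split.
- apply: (measurable_funB (f := fun p : plane * plane => p.1.1) (g := fun p : plane * plane => p.2.1)).
  + exact: (measurableT_comp measurable_fst measurable_fst).
  + exact: (measurableT_comp measurable_fst measurable_snd).
- apply: (measurable_funB (f := fun p : plane * plane => p.1.2) (g := fun p : plane * plane => p.2.2)).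
  + exact: (measurableT_comp measurable_snd measurable_fst).
  + exact: (measurableT_comp measurable_snd measurable_snd).
Qed.

Lemma preserves_psubr x : preserves mu (psub x).
Proof.
have -> : psub x = (fun y => shift x (flip y)).
  by apply/funext => y; rewrite /psub /shift /flip /=; congr (_, _); rewrite addrC.
have [mf pf] := preserves_flip R; have [ms ps] := preserves_shift x.
split; first exact: (measurableT_comp ms mf).
move=> A mA; rewrite -(ps _ mA) -[in RHS]pf//.
by rewrite -[X in measurable X]setTI; exact: ms.
Qed.

Lemma ge0_integral_mu2 (F : plane * plane -> R) : measurable_fun setT F ->
  (forall p, 0 <= F p) ->
  (\int[mu2]_p (F p)%:E = \int[mu]_x \int[mu]_y (F (x, y))%:E)%E.
Proof.
move=> mF F0; rewrite (fubini_tonelli1 (fun p => (F p)%:E))//.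
exact/measurable_EFinP.
Qed.

(** Makes the cross term of the expanded square integrable, dominated by the two square terms. *)
Lemma normM_le_sqr (w s t : R) : 0 <= w -> `|w * (s * t)| <= `|w * s ^+ 2 + w * t ^+ 2|.
Proof.
move=> w0; rewrite -mulrDr !normrM ler_wpM2l// -normrM.
rewrite [leRHS]ger0_norm ?addr_ge0 ?sqr_ge0// ler_norml.
have h1 : 0 <= (s - t) ^+ 2 by exact: sqr_ge0.
have h2 : 0 <= (s + t) ^+ 2 by exact: sqr_ge0.
have h3 : 0 <= s ^+ 2 by exact: sqr_ge0.
have h4 : 0 <= t ^+ 2 by exact: sqr_ge0.
have e1 : (s - t) ^+ 2 = s ^+ 2 + t ^+ 2 - 2 * (s * t) by ring.
have e2 : (s + t) ^+ 2 = s ^+ 2 + t ^+ 2 + 2 * (s * t) by ring.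
by apply/andP; split; lra.
Qed.

Section Fixed.
Variables (a : plane -> R) (e : R).
Hypotheses (e0 : 0 < e) (ma : measurable_fun setT a).
Hypothesis ia : mu.-integrable setT (EFin \o a).
Hypothesis a2 : (sqint a < +oo)%E.

(** The weight w and the four integrands of w (a(x) - a(y))^2 = w a(x)^2 + w a(y)^2 - 2 w a(x) a(y),
    with w the Poisson kernel at x - y. They are integrated over the product measure, where
    linearity applies once each of them is integrable. *)
Let W (p : plane * plane) := poisson2 e (psub p.1 p.2).
Let g1 (p : plane * plane) := W p * a p.1 ^+ 2.
Let g2 (p : plane * plane) := W p * a p.2 ^+ 2.
Let gG (p : plane * plane) := W p * (a p.1 * a p.2).
Let gD (p : plane * plane) := W p * (a p.1 - a p.2) ^+ 2.

Let mW : measurable_fun setT W.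
Proof. exact: (measurableT_comp (measurable_poisson2 e0) measurable_psub). Qed.
Let W0 p : 0 <= W p. Proof. exact: poisson2_ge0. Qed.
Let ma1 : measurable_fun setT (fun p : plane * plane => a p.1).
Proof. exact: (measurableT_comp ma measurable_fst). Qed.
Let ma2 : measurable_fun setT (fun p : plane * plane => a p.2).
Proof. exact: (measurableT_comp ma measurable_snd). Qed.
Let mg1 : measurable_fun setT g1.
Proof. by apply: measurable_funM => //; exact: measurable_funX. Qed.
Let mg2 : measurable_fun setT g2.
Proof. by apply: measurable_funM => //; exact: measurable_funX. Qed.
Let mgG : measurable_fun setT gG.
Proof. by apply: measurable_funM => //; exact: measurable_funM. Qed.
Let mgD : measurable_fun setT gD.
Proof. by apply: measurable_funM => //; apply: measurable_funX; exact: measurable_funB. Qed.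
Let g10 p : 0 <= g1 p. Proof. by rewrite mulr_ge0// sqr_ge0. Qed.
Let g20 p : 0 <= g2 p. Proof. by rewrite mulr_ge0// sqr_ge0. Qed.
Let gD0 p : 0 <= gD p. Proof. by rewrite mulr_ge0// sqr_ge0. Qed.
Let C := ((2 * pi) ^+ 2 : R).

Let msq : measurable_fun setT (fun x => a x ^+ 2).
Proof. exact: measurable_funX. Qed.

(** Integrating in y first leaves the total mass (2 pi)^2 of the kernel. *)
Let int_g1 : (\int[mu2]_p (g1 p)%:E = C%:E * sqint a)%E.
Proof.
rewrite (ge0_integral_mu2 mg1 g10).
transitivity (\int[mu]_x (C%:E * (a x ^+ 2)%:E))%E; last first.
  rewrite ge0_integralZl_EFin//; last 3 first.
  - by move=> x _; rewrite lee_fin sqr_ge0.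
  - exact/measurable_EFinP.
  - by rewrite sqr_ge0.
apply: eq_integral => x _; rewrite /g1/=.
under eq_integral do rewrite EFinM.
rewrite ge0_integralZr; last 4 first.
- exact: measurableT.
- by apply/measurable_EFinP; exact: (measurable_fun_pair2 x mW).
- by move=> y _; rewrite lee_fin.
- by rewrite lee_fin sqr_ge0.
congr (_ * _)%E.
rewrite (ge0_integral_preserves (f := fun z => (poisson2 e z)%:E) (preserves_psubr x)).
- exact: integral_poisson2.
- by apply/measurable_EFinP; exact: measurable_poisson2.
- by move=> z; rewrite lee_fin poisson2_ge0.
Qed.

Let int_g2 : (\int[mu2]_p (g2 p)%:E = C%:E * sqint a)%E.
Proof.
rewrite (ge0_integral_mu2 mg2 g20).
rewrite (tonelli_plane (f := fun p => (g2 p)%:E)); last 2 first.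
- exact/measurable_EFinP.
- by move=> p; rewrite lee_fin.
transitivity (\int[mu]_x (C%:E * (a x ^+ 2)%:E))%E; last first.
  rewrite ge0_integralZl_EFin//; last 3 first.
  - by move=> x _; rewrite lee_fin sqr_ge0.
  - exact/measurable_EFinP.
  - by rewrite sqr_ge0.
apply: eq_integral => y _; rewrite /g2/=.
under eq_integral do rewrite EFinM.
rewrite ge0_integralZr; last 4 first.
- exact: measurableT.
- by apply/measurable_EFinP; exact: (measurable_fun_pair1 y mW).
- by move=> x _; rewrite lee_fin.
- by rewrite lee_fin sqr_ge0.
congr (_ * _)%E.
rewrite (ge0_integral_preserves (f := fun z => (poisson2 e z)%:E) (preserves_shift (flip y))).
- exact: integral_poisson2.
- by apply/measurable_EFinP; exact: measurable_poisson2.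
- by move=> z; rewrite lee_fin poisson2_ge0.
Qed.

Let ge0_integrable (F : plane * plane -> R) : measurable_fun setT F ->
  (forall p, 0 <= F p) -> (\int[mu2]_p (F p)%:E < +oo)%E -> mu2.-integrable setT (EFin \o F).
Proof.
move=> mF F0 Foo; apply/integrableP; split; first exact/measurable_EFinP.
by under eq_integral do rewrite gee0_abs ?lee_fin//.
Qed.

Let sq_lty : (C%:E * sqint a < +oo)%E.
Proof.
have s0 : (0 <= sqint a)%E by apply: integral_ge0 => x _; rewrite lee_fin sqr_ge0.
by rewrite lte_mul_pinfty// lee_fin sqr_ge0.
Qed.

Let i1 : mu2.-integrable setT (EFin \o g1).
Proof. by apply: ge0_integrable => //; rewrite int_g1. Qed.
Let i2 : mu2.-integrable setT (EFin \o g2).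
Proof. by apply: ge0_integrable => //; rewrite int_g2. Qed.
Let i12 : mu2.-integrable setT (EFin \o (fun p => g1 p + g2 p)).
Proof. exact: (integrableD measurableT i1 i2). Qed.

Let iG : mu2.-integrable setT (EFin \o gG).
Proof.
apply: (le_integrable measurableT _ _ i12); first exact/measurable_EFinP.
move=> p _; rewrite lee_fin; exact: normM_le_sqr.
Qed.

Let iGG : mu2.-integrable setT (EFin \o (fun p => 2 * gG p)).
Proof. exact: (@integrableZl _ _ _ mu2 _ measurableT 2 (EFin \o gG)). Qed.

Let iD : mu2.-integrable setT (EFin \o gD).
Proof.
have -> : gD = (fun p => (g1 p + g2 p) - 2 * gG p).
  by apply/funext => p; rewrite /gD /g1 /g2 /gG; ring.
exact: (integrableB measurableT i12 iGG).
Qed.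

Let intG : (\int[mu2]_p (gG p)%:E = (\int[mu]_k (decay2 e k * hartley a k ^+ 2))%:E)%E.
Proof.
rewrite hartley_regularised//.
rewrite -[LHS]fineK; last exact: (integrable_fin_num _ iG).
congr EFin; rewrite -(@integral12_prod_meas1 _ _ _ _ _ (sleb2 R) (sleb2 R) _ iG).
congr fine; apply: eq_integral => x _; rewrite /fubini_F/=.
have iWa : mu.-integrable setT (EFin \o (fun y => W (x, y) * a y)).
  (* Each of the two factors 2 e / (e^2 + t^2) of the kernel is at most 2 / e. *)
  apply: (integrable_boundedM (M := 4 / e ^+ 2)) => //.
    exact: (measurable_fun_pair2 x mW).
  move=> y; rewrite ger0_norm// /W /poisson2 /poisson.
  have pb (t : R) : 2 * e / (e ^+ 2 + t ^+ 2) <= 2 / e.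
    rewrite ler_pdivrMr ?ltr_wpDr ?sqr_ge0 ?exprn_gt0//.
    have -> : 2 / e * (e ^+ 2 + t ^+ 2) = 2 * e + 2 * t ^+ 2 / e by field; rewrite gt_eqF.
    by rewrite lerDl; apply: divr_ge0; [apply: mulr_ge0; [by []|exact: sqr_ge0]|exact: ltW].
  have p0 (t : R) : 0 <= 2 * e / (e ^+ 2 + t ^+ 2) by exact: poisson_ge0.
  rewrite (le_trans (ler_pM (p0 _) (p0 _) (pb _) (pb _)))//.
  by rewrite le_eqVlt; apply/orP; left; apply/eqP; field; rewrite gt_eqF.
have -> : (\int[mu]_y (a y * poisson2 e (psub x y)) = \int[mu]_y (W (x, y) * a y))%R.
  by apply: eq_Rintegral => y _; rewrite mulrC.
rewrite EFinM /Rintegral fineK; last exact: (integrable_fin_num _ iWa).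
rewrite -integralZl//; apply: eq_integral => y _.
by rewrite -EFinM /gG/=; congr EFin; ring.
Qed.

Lemma hartley_energy_D :
  ((2 * \int[mu]_k (decay2 e k * hartley a k ^+ 2))%:E + \int[mu2]_p (gD p)%:E
   = (2 * C)%:E * sqint a)%E.
Proof.
rewrite EFinM -intG -(integralZl measurableT iG).
transitivity (\int[mu2]_p (g1 p + g2 p)%:E)%E.
  rewrite -(integralD measurableT iGG iD).
  by apply: eq_integral => p _; rewrite -EFinD; congr EFin; rewrite /gD /g1 /g2 /gG; ring.
rewrite (integralD measurableT i1 i2)/= int_g1 int_g2.
rewrite -muleDl//; last first.
  rewrite ge0_fin_numE//; apply: integral_ge0 => x _; rewrite lee_fin sqr_ge0//.
by rewrite -EFinD; congr (_ * _)%E; congr EFin; ring.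
Qed.

(** The substitution y = x + z for fixed x, followed by an exchange of the integrals in x and z. *)
Lemma int_gD : (\int[mu2]_p (gD p)%:E = \int[mu]_z ((poisson2 e z)%:E * sqdiff a z))%E.
Proof.
rewrite (ge0_integral_mu2 mgD gD0).
transitivity (\int[mu]_x \int[mu]_z (poisson2 e z * (a (shift z x) - a x) ^+ 2)%:E)%E.
  apply: eq_integral => x _.
  rewrite -(ge0_integral_preserves (f := fun y => (gD (x, y))%:E) (preserves_shift x)); last 2 first.
  - by apply/measurable_EFinP; exact: (measurable_fun_pair2 x mgD).
  - by move=> y; rewrite lee_fin.
  apply: eq_integral => z _; rewrite /gD /W/=.
  have -> : psub x (shift x z) = flip z by rewrite /psub /shift /flip /=; congr (_, _); ring.
  have -> : shift x z = shift z x by rewrite /shift; congr (_, _); rewrite addrC.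
  by rewrite poisson2_flip; congr EFin; ring.
have mF : measurable_fun setT (fun p : plane * plane => (poisson2 e p.2 * (a (shift p.2 p.1) - a p.1) ^+ 2)).
  apply: measurable_funM; first exact: (measurableT_comp (measurable_poisson2 e0) measurable_snd).
  apply: measurable_funX; apply: measurable_funB; last exact: ma1.
  apply: (measurableT_comp ma).
  apply: (measurableT_comp measurable_shift2 (g := fun p : plane * plane => (p.2, p.1))).
  apply/measurable_fun_pairP; split; [exact: measurable_snd|exact: measurable_fst].
rewrite (tonelli_plane (f := fun p => (poisson2 e p.2 * (a (shift p.2 p.1) - a p.1) ^+ 2)%:E)); last 2 first.
- exact/measurable_EFinP.
- by move=> p; rewrite lee_fin mulr_ge0 ?sqr_ge0 ?poisson2_ge0.
apply: eq_integral => z _; rewrite /=; under eq_integral do rewrite EFinM.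
rewrite ge0_integralZl_EFin//.
- by move=> x _; rewrite lee_fin sqr_ge0.
- apply/measurable_EFinP; apply: measurable_funX; apply: measurable_funB => //.
  exact: (measurableT_comp ma (measurable_shift z)).
- exact: poisson2_ge0.
Qed.

(** A Parseval identity with an explicit defect. The defect is nonnegative, which gives one
    inequality of Plancherel, and small for a suitable [e], which gives the other. *)
Lemma hartley_energy :
  ((2 * \int[mu]_k (decay2 e k * hartley a k ^+ 2))%:E
     + \int[mu]_z ((poisson2 e z)%:E * sqdiff a z)
   = (2 * (2 * pi) ^+ 2)%:E * sqint a)%E.
Proof. by rewrite -int_gD hartley_energy_D. Qed.

End Fixed.
End Energy.

(** * Continuity of translations in L^2 *)

Section TranslationContinuity.
Import HBSimple HBNNSimple.
Variable R : realType.
Local Notation line := (measurableTypeR R).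
Local Notation plane := (line * line)%type.
Local Notation leb := (@lebesgue_measure R).
Local Notation mu := (leb2 R).
Implicit Types (e : R) (k x y z : plane) (a b g : plane -> R).

Lemma sqint_ge0 a : (0 <= sqint a)%E.
Proof. by apply: integral_ge0 => x _; rewrite lee_fin sqr_ge0. Qed.

Lemma measurable_sqE a : measurable_fun setT a -> measurable_fun setT (fun x => ((a x) ^+ 2)%:E).
Proof. by move=> ma; apply/measurable_EFinP; exact: measurable_funX. Qed.

Lemma sqint_leD a b g (r s : R) : measurable_fun setT a -> measurable_fun setT b ->
  measurable_fun setT g -> 0 <= r -> 0 <= s ->
  (forall x, g x ^+ 2 <= r * a x ^+ 2 + s * b x ^+ 2) ->
  (sqint g <= r%:E * sqint a + s%:E * sqint b)%E.
Proof.
move=> ma mb mg r0 s0 H; rewrite /sqint.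
have [mA mB] := (measurable_sqE ma, measurable_sqE mb).
rewrite -(ge0_integralZl_EFin _ measurableT _ mA r0); last by move=> x _; rewrite lee_fin sqr_ge0.
rewrite -(ge0_integralZl_EFin _ measurableT _ mB s0); last by move=> x _; rewrite lee_fin sqr_ge0.
rewrite -ge0_integralD; last 5 first.
- exact: measurableT.
- by move=> x _; rewrite -EFinM lee_fin mulr_ge0 ?sqr_ge0.
- exact: measurable_funeM.
- by move=> x _; rewrite -EFinM lee_fin mulr_ge0 ?sqr_ge0.
- exact: measurable_funeM.
apply: ge0_le_integral; [exact: measurableT| | | |].
- by move=> x _; rewrite lee_fin sqr_ge0.
- exact: measurable_sqE.
- by apply: emeasurable_funD; exact: measurable_funeM.
- by move=> x _; rewrite -!EFinM -EFinD lee_fin.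
Qed.

Lemma sqint_shift a z : measurable_fun setT a -> sqint (fun x => a (shift z x)) = sqint a.
Proof.
move=> ma; rewrite /sqint (ge0_integral_preserves (f := fun x => ((a x) ^+ 2)%:E) (preserves_shift z))//.
- exact: measurable_sqE.
- by move=> x; rewrite lee_fin sqr_ge0.
Qed.

Lemma measurable_shift_comp a z : measurable_fun setT a ->
  measurable_fun setT (fun x => a (shift z x)).
Proof. by move=> ma; exact: (measurableT_comp ma (measurable_shift z)). Qed.

Lemma sqrB_le2 (u v : R) : (u - v) ^+ 2 <= 2 * u ^+ 2 + 2 * v ^+ 2.
Proof.
have h : 0 <= (u + v) ^+ 2 by exact: sqr_ge0.
have e : (u + v) ^+ 2 = 2 * u ^+ 2 + 2 * v ^+ 2 - (u - v) ^+ 2 by ring.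
lra.
Qed.

Lemma sqdiff_le4 a z : measurable_fun setT a -> (sqdiff a z <= 4%:E * sqint a)%E.
Proof.
move=> ma; have h := sqint_leD (measurable_shift_comp z ma) ma
  (measurable_funB (measurable_shift_comp z ma) ma) (ler0n R 2) (ler0n R 2).
apply: le_trans (h _) _ => [x|].
  exact: sqrB_le2.
rewrite sqint_shift// -ge0_muleDl ?lee_fin// -EFinD.
by rewrite (_ : 2 + 2 = 4 :> R) // -natrD.
Qed.

Lemma sqdiff_leD a b z : measurable_fun setT a -> measurable_fun setT b ->
  (sqdiff (fun x => a x + b x)%R z <= 2%:E * sqdiff a z + 2%:E * sqdiff b z)%E.
Proof.
move=> ma mb; apply: sqint_leD => //.
- by apply: measurable_funB => //; exact: measurable_shift_comp.
- by apply: measurable_funB => //; exact: measurable_shift_comp.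
- apply: measurable_funB; last exact: measurable_funD.
  by apply: measurable_funD; exact: measurable_shift_comp.
move=> x.
have -> : a (shift z x) + b (shift z x) - (a x + b x) =
  (a (shift z x) - a x) - - (b (shift z x) - b x) by ring.
by rewrite -[X in _ + 2 * X]sqrrN; exact: sqrB_le2.
Qed.

(** Continuity at z = 0 of the translates a(. + z) in L^2, expressed with squared norms. *)
Definition tcont a := forall eta : R, 0 < eta -> exists2 delta : R, 0 < delta &
  forall z, `|z.1| < delta -> `|z.2| < delta -> (sqdiff a z <= eta%:E)%E.

Lemma tcontD a b : measurable_fun setT a -> measurable_fun setT b ->
  tcont a -> tcont b -> tcont (fun x => a x + b x).
Proof.
move=> ma mb ta tb eta eta0.
have eta4 : 0 < eta / 4 by rewrite divr_gt0.
have [d1 d10 h1] := ta _ eta4; have [d2 d20 h2] := tb _ eta4.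
exists (Num.min d1 d2); first by rewrite lt_min d10.
move=> z; rewrite !lt_min => /andP[z11 z12] /andP[z21 z22].
apply: le_trans (sqdiff_leD z ma mb) _.
rewrite (_ : eta = 2 * (eta / 4) + 2 * (eta / 4)); last by field.
rewrite [leRHS]EFinD; apply: leeD; rewrite EFinM lee_pmul2l// ?lte_fin//.
  exact: h1.
exact: h2.
Qed.

Lemma sqdiffZ (c : R) a z : measurable_fun setT a ->
  (sqdiff (fun x => c * a x)%R z = (c ^+ 2)%:E * sqdiff a z)%E.
Proof.
move=> ma; rewrite /sqdiff -ge0_integralZl_EFin//.
- by apply: eq_integral => x _; rewrite -EFinM; congr EFin; ring.
- by move=> x _; rewrite lee_fin sqr_ge0.
- by apply: measurable_sqE; apply: measurable_funB => //; exact: measurable_shift_comp.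
- exact: sqr_ge0.
Qed.

Lemma tcontZ c a : measurable_fun setT a -> tcont a -> tcont (fun x => c * a x).
Proof.
move=> ma ta eta eta0.
have c0 : 0 < c ^+ 2 + 1 by rewrite ltr_wpDl ?sqr_ge0.
have [d d0 h] := ta _ (divr_gt0 eta0 c0).
exists d => // z z1 z2; rewrite sqdiffZ//.
apply: (@le_trans _ _ ((c ^+ 2)%:E * (eta / (c ^+ 2 + 1))%:E)%E).
  by rewrite lee_wpmul2l ?lee_fin ?sqr_ge0//; exact: h.
rewrite -EFinM lee_fin mulrA ler_pdivrMr// mulrC ler_wpM2l ?(ltW eta0)//.
by rewrite lerDl.
Qed.

Lemma tcontB a b : measurable_fun setT a -> measurable_fun setT b ->
  tcont a -> tcont b -> tcont (fun x => a x - b x).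
Proof.
move=> ma mb ta tb.
have -> : (fun x => a x - b x) = (fun x => a x + (-1) * b x) by apply/funext => x; ring.
apply: tcontD => //; last exact: tcontZ.
exact: measurable_funM.
Qed.

Lemma sqint_dominated (h : nat -> plane -> R) a g :
  (forall n, measurable_fun setT (h n)) -> measurable_fun setT a -> measurable_fun setT g ->
  (forall x, h n x @[n --> \oo] --> a x) -> (forall n x, `|h n x| <= g x) ->
  (sqint g < +oo)%E -> (sqint (fun x => h n x - a x)%R @[n --> \oo] --> 0)%E.
Proof.
move=> mh ma mg cvh hg gi.
have ag x : `|a x| <= g x.
  apply: (@closed_cvg _ _ \oo _ (fun n => `|h n x|) [set r | r <= g x]) => //.
  - by near=> n; exact: hg.
  - exact: cvg_norm.
have g0 x : 0 <= g x by exact: le_trans (ag x).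
have mhB n : measurable_fun setT (fun x => h n x - a x) by exact: measurable_funB.
(* Both |h n| and |a| are at most g, so |h n - a|^2 <= 4 g^2. *)
have dom : mu.-integrable setT (fun x => (4 * g x ^+ 2)%:E).
  apply/integrableP; split.
    by apply/measurable_EFinP; apply: measurable_funM => //; exact: measurable_funX.
  under eq_integral do rewrite gee0_abs ?lee_fin ?mulr_ge0 ?sqr_ge0// EFinM.
  rewrite ge0_integralZl_EFin//.
  + by rewrite lte_mul_pinfty.
  + by move=> x _; rewrite lee_fin sqr_ge0.
  + exact: measurable_sqE.
have cvF : {ae mu, forall x, setT x -> (fun n => ((h n x - a x) ^+ 2)%:E) @ \oo --> (cst 0%E x : \bar R)}.
  apply: aeW => x _ /=.
  apply: cvg_EFin; first by near=> n.
  rewrite /comp/= (_ : 0 = (a x - a x) * (a x - a x)); last by rewrite subrr mul0r.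
  have h0 : h n x - a x @[n --> \oo] --> a x - a x by apply: cvgB => //; exact: cvg_cst.
  under eq_fun do rewrite expr2.
  exact: cvgM.
have domF : {ae mu, forall x n, setT x -> (`|((h n x - a x) ^+ 2)%:E| <= (4 * g x ^+ 2)%:E)%E}.
  apply: aeW => x n _; rewrite lee_fin /=.
  have -> : 4 * g x ^+ 2 = (2 * g x) ^+ 2 by ring.
  rewrite ger0_norm ?sqr_ge0// -real_normK ?num_real// lerXn2r ?nnegrE ?mulr_ge0//.
  by rewrite (le_trans (ler_normB _ _))// mulr_natl mulr2n lerD.
have [_ _] := dominated_convergence measurableT (fun n => measurable_sqE (mhB n)) (measurable_cst _) cvF dom domF.
by rewrite integral_cst// mul0e.
Unshelve. all: by end_near. Qed.

Lemma cvge0_small (u : nat -> \bar R) (eta : R) : (u n @[n --> \oo] --> 0)%E -> 0 < eta ->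
  exists n, (u n <= eta%:E)%E.
Proof.
move=> cu eta0.
have /cu [N _ HN] : nbhs (0%E : \bar R) [set x | (x <= eta%:E)%E].
  exists eta => //= r /=; rewrite sub0r normrN => h.
  by rewrite lee_fin ltW// (le_lt_trans (ler_norm _)).
by exists N; apply: HN => /=.
Qed.

Lemma tcont_approx a : measurable_fun setT a ->
  (forall eta, 0 < eta -> exists b, [/\ measurable_fun setT b, tcont b &
    (sqint (fun x => b x - a x)%R <= eta%:E)%E]) -> tcont a.
Proof.
move=> ma H eta eta0.
(* The final bound is 2 (eta / 16) + 2 . 4 (eta / 16) <= eta, with the factors of [sqdiff_leD] and
   [sqdiff_le4]. *)
have eta16 : 0 < eta / 16 by rewrite divr_gt0.
have [b [mb tb ab]] := H _ eta16.
have [d d0 hd] := tb _ eta16.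
have mba : measurable_fun setT (fun x => b x - a x) by exact: measurable_funB.
exists d => // z z1 z2.
have -> : a = (fun x => b x + (-1) * (b x - a x)) by apply/funext => x; ring.
have mba' : measurable_fun setT (fun x => (-1) * (b x - a x)) by exact: measurable_funM.
apply: le_trans (sqdiff_leD z mb mba') _.
rewrite sqdiffZ// sqrrN expr1n mul1e.
apply: (@le_trans _ _ (2%:E * (eta / 16)%:E + 2%:E * (4%:E * (eta / 16)%:E)))%E.
  rewrite leeD// lee_pmul2l// ?lte_fin//; first exact: hd.
  by apply: le_trans (sqdiff_le4 z mba) _; rewrite lee_pmul2l// lte_fin.
by rewrite -!EFinM -EFinD lee_fin; lra.
Qed.

Lemma tcont_dominated (h : nat -> plane -> R) a g :
  (forall n, measurable_fun setT (h n)) -> measurable_fun setT a -> measurable_fun setT g ->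
  (forall x, h n x @[n --> \oo] --> a x) -> (forall n x, `|h n x| <= g x) ->
  (sqint g < +oo)%E -> (forall n, tcont (h n)) -> tcont a.
Proof.
move=> mh ma mg cvh hg gi th; apply: tcont_approx => // eta eta0.
have [n hn] := cvge0_small (sqint_dominated mh ma mg cvh hg gi) eta0.
by exists (h n).
Qed.

(** A translation by t can change the indicator of an interval only within distance |t| of its
    endpoints; [edge] is such a neighbourhood. *)
Let edge (c t : R) : set R := `[c - t, c + t]%classic.

Let leb_edge c t : 0 <= t -> leb (edge c t) = (2 * t)%:E.
Proof.
move=> t0; rewrite /edge lebesgue_measure_itv/= lte_fin.
case: ltP => h; first by rewrite -EFinB; congr EFin; ring.
by congr EFin; lra.
Qed.

Let medge c t : measurable (edge c t : set line).
Proof. exact: measurable_itv. Qed.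

Let indic01 (A : set R) (y : R) : (\1_A y = 0 :> R) \/ (\1_A y = 1 :> R).
Proof. by rewrite indicE; case: (_ \in A); [right|left]. Qed.

Let indic_shift (c d t x : R) :
  `|\1_(`]c, d]%classic : set R) (x + t) - \1_(`]c, d]%classic : set R) x| <=
  \1_(edge c `|t|) x + \1_(edge d `|t|) x :> R.
Proof.
have le1 : `|\1_(`]c, d]%classic : set R) (x + t) - \1_(`]c, d]%classic : set R) x| <= 1 :> R.
  by case: (indic01 `]c, d]%classic (x + t)) => ->; case: (indic01 `]c, d]%classic x) => ->;
    rewrite ?subrr ?subr0 ?sub0r ?normrN ?normr0 ?normr1.
have i0 (A : set R) (y : R) : 0 <= \1_A y :> R by case: (indic01 A y) => ->.
have [hc|hc] := boolP (c - `|t| <= x <= c + `|t|).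
  have -> : \1_(edge c `|t|) x = 1 :> R by rewrite indicE mem_setE in_itv/= hc.
  by rewrite (le_trans le1)// lerDl.
have [hd|hd] := boolP (d - `|t| <= x <= d + `|t|).
  have -> : \1_(edge d `|t|) x = 1 :> R by rewrite indicE mem_setE in_itv/= hd.
  by rewrite (le_trans le1)// lerDr.
have h1 := ler_norm t; have := ler_norm (- t); rewrite normrN => h2.
rewrite (_ : \1_ _ (x + t) = \1_(`]c, d]%classic : set R) x) ?subrr ?normr0 ?addr_ge0//.
rewrite !indicE !mem_setE !in_itv/=; congr ((_ && _)%:R).
- by case: (ltP c x) hc => ? hc; case: (ltP c (x + t)) => ? //; case/negP: hc; apply/andP; split; lra.
- by case: (leP x d) hd => ? hd; case: (leP (x + t) d) => ? //; case/negP: hd; apply/andP; split; lra.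
Qed.

Let int_indic (A : set R) : measurable A -> (\int[leb]_x (\1_A x)%:E = leb A)%E.
Proof. by move=> mA; rewrite integral_indic// setIT. Qed.

(** From i j - i' j' = (i - i') j + i' (j - j') and j <= E2 + j'. In the application the primed
    values are the unshifted indicators, so the bound is a sum of products of one-variable functions
    of known integral. *)
Let rect_ineq (i i' j j' E1 E2 : R) : i = 0 \/ i = 1 -> i' = 0 \/ i' = 1 ->
  j = 0 \/ j = 1 -> j' = 0 \/ j' = 1 -> `|i - i'| <= E1 -> `|j - j'| <= E2 ->
  (i * j - i' * j') ^+ 2 <= E1 * (E2 + j') + i' * E2.
Proof.
move=> hi hi' hj hj' h1 h2; have n1 := le_trans (normr_ge0 _) h1.
have n2 := le_trans (normr_ge0 _) h2; have n12 := mulr_ge0 n1 n2.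
by move: h1 h2 n1 n2 n12; case: hi => ->; case: hi' => ->; case: hj => ->; case: hj' => ->;
  rewrite ?subrr ?subr0 ?sub0r ?normrN ?normr0 ?normr1 => h1 h2 n1 n2 n12; nra.
Qed.

Lemma tcont_rect (a b c d : R) :
  tcont (\1_((`]a, b]%classic : set line) `*` (`]c, d]%classic : set line)) : plane -> R).
Proof.
pose I : set R := `]a, b]%classic; pose J : set R := `]c, d]%classic.
have fin (u v : R) : exists2 L : R, 0 <= L & leb `]u, v]%classic = L%:E.
  exists (fine (leb `]u, v]%classic)); first exact: fine_ge0.
  by rewrite fineK// lebesgue_measure_itv/=; case: ifP.
have [LI LI0 hI] := fin a b; have [LJ LJ0 hJ] := fin c d.
move=> eta eta0.
(* The integral is bounded by 4 |z.1| (4 |z.2| + LJ) + 4 LI |z.2|. With |z.2| <= 1 and both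
   coordinates below eta / K this is at most eta. *)
pose K := 16 + 4 * LJ + 4 * LI.
have K0 : 0 < K by rewrite /K; lra.
exists (Num.min 1 (eta / K)); first by rewrite lt_min ltr01 divr_gt0.
move=> z; rewrite !lt_min => /andP[z11 z12] /andP[z21 z22].
pose E1 (x : line) : R := \1_(edge a `|z.1|) x + \1_(edge b `|z.1|) x.
pose E2 (x : line) : R := \1_(edge c `|z.2|) x + \1_(edge d `|z.2|) x.
have mE1 : measurable_fun setT E1 by apply: measurable_funD; apply: measurable_indic; exact: medge.
have mE2 : measurable_fun setT E2 by apply: measurable_funD; apply: measurable_indic; exact: medge.
have measI : measurable (I : set line) by exact: measurable_itv.
have mI : measurable_fun setT (\1_I : line -> R) by exact: measurable_indic.
have measJ : measurable (J : set line) by exact: measurable_itv.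
have mJ : measurable_fun setT (\1_J : line -> R) by exact: measurable_indic.
have mEJ : measurable_fun setT (fun x : line => E2 x + \1_J x) by exact: measurable_funD.
have E10 (x : line) : 0 <= E1 x by rewrite addr_ge0 ?indicE.
have E20 (x : line) : 0 <= E2 x by rewrite addr_ge0 ?indicE.
have i0 (A : set R) (x : R) : 0 <= \1_A x :> R by rewrite indicE.
have iE1 : (\int[leb]_x (E1 x)%:E = (4 * `|z.1|)%:E)%E.
  rewrite /E1; under eq_integral do rewrite EFinD.
  rewrite ge0_integralD; last 5 first.
  - exact: measurableT.
  - by move=> x _; rewrite lee_fin.
  - by apply/measurable_EFinP; apply: measurable_indic; exact: medge.
  - by move=> x _; rewrite lee_fin.
  - by apply/measurable_EFinP; apply: measurable_indic; exact: medge.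
  by rewrite !int_indic ?leb_edge//; [rewrite -EFinD; congr EFin; ring|exact: medge|exact: medge].
have iE2 : (\int[leb]_x (E2 x)%:E = (4 * `|z.2|)%:E)%E.
  rewrite /E2; under eq_integral do rewrite EFinD.
  rewrite ge0_integralD; last 5 first.
  - exact: measurableT.
  - by move=> x _; rewrite lee_fin.
  - by apply/measurable_EFinP; apply: measurable_indic; exact: medge.
  - by move=> x _; rewrite lee_fin.
  - by apply/measurable_EFinP; apply: measurable_indic; exact: medge.
  by rewrite !int_indic ?leb_edge//; [rewrite -EFinD; congr EFin; ring|exact: medge|exact: medge].
have iEJ : (\int[leb]_x (E2 x + \1_J x)%:E = (4 * `|z.2| + LJ)%:E)%E.
  under eq_integral do rewrite EFinD.
  rewrite ge0_integralD; last 5 first.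
  - exact: measurableT.
  - by move=> x _; rewrite lee_fin.
  - exact/measurable_EFinP.
  - by move=> x _; rewrite lee_fin.
  - exact/measurable_EFinP.
  by rewrite iE2 int_indic// hJ.
apply: (@le_trans _ _ (\int[mu]_x ((E1 x.1 * (E2 x.2 + \1_J x.2))%:E + (\1_I x.1 * E2 x.2)%:E)))%E.
  apply: ge0_le_integral; [exact: measurableT| | | |].
  - by move=> x _; rewrite lee_fin sqr_ge0.
  - apply: measurable_sqE; apply: measurable_funB; last by apply: measurable_indic; exact: measurableX.
    by apply: (measurable_shift_comp z); apply: measurable_indic; exact: measurableX.
  - apply: emeasurable_funD; apply/measurable_EFinP.
      exact: (measurable_prodM mE1 mEJ).
    exact: (measurable_prodM mI mE2).
  - move=> x _; rewrite -EFinD lee_fin.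
    have h1 := indic_shift a b z.1 x.1; have h2 := indic_shift c d z.2 x.2.
    rewrite -/I -/E1 in h1; rewrite -/J -/E2 in h2.
    have ix y : \1_((I : set line) `*` (J : set line)) y = \1_I y.1 * \1_J y.2 :> R.
      by rewrite !indicE in_setX; case: (_ \in I); case: (_ \in J); rewrite /= ?mulr1 ?mulr0.
    rewrite -/I -/J !ix /=.
    exact: (rect_ineq (indic01 _ _) (indic01 _ _) (indic01 _ _) (indic01 _ _)).
rewrite ge0_integralD; last 5 first.
- exact: measurableT.
- by move=> x _; rewrite lee_fin mulr_ge0// addr_ge0.
- by apply/measurable_EFinP; exact: (measurable_prodM mE1 mEJ).
- by move=> x _; rewrite lee_fin mulr_ge0.
- by apply/measurable_EFinP; exact: (measurable_prodM mI mE2).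
rewrite (ge0_integral_prodM mE1 mEJ)//; last by move=> x; rewrite addr_ge0.
rewrite (ge0_integral_prodM mI mE2)// iE1 iEJ iE2 int_indic// hI -!EFinM -EFinD lee_fin.
have n1 := normr_ge0 z.1; have n2 := normr_ge0 z.2.
move: z12 z22; rewrite !ltr_pdivlMr// /K => z12 z22.
have : `|z.1| * `|z.2| <= `|z.1| by rewrite ler_piMr// ltW.
nra.
Qed.

Let hS (n : nat) : set line := `](- n%:R), n%:R]%classic.
Let hB n : set plane := hS n `*` hS n.

Let mhB n : measurable (hB n).
Proof. by apply: measurableX; exact: measurable_itv. Qed.

Let tcont_ocitv (I J : set line) : ocitv I -> ocitv J -> tcont (\1_(I `*` J) : plane -> R).
Proof. by move=> [[a b] _ <-] [[c d] _ <-]; exact: tcont_rect. Qed.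

Let ocitv_hS n : ocitv (hS n). Proof. by exists (- n%:R, n%:R). Qed.

Lemma indicIM (A B : set plane) (x : plane) : \1_(A `&` B) x = \1_A x * \1_B x :> R.
Proof. by rewrite !indicE in_setI -mulnb natrM. Qed.

(* The intersection with a bounded square makes the indicator function square integrable. *)
Definition tcont_set (A : set plane) :=
  measurable A /\ forall n, tcont (\1_(A `&` hB n) : plane -> R).

Lemma sqint_indic (A : set plane) : measurable A -> sqint (\1_A : plane -> R) = mu A.
Proof.
move=> mA; rewrite /sqint -[in RHS](setIT A) -integral_indic//.
by apply: eq_integral => x _; rewrite indicE; case: (_ \in _); rewrite ?expr1n ?expr0n.
Qed.

Let hB_lty n : (mu (hB n) < +oo)%E.
Proof.
apply: le_lt_trans (leb2_box (n%:R : R)); apply: le_measure; rewrite ?inE//.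
- exact: measurable_box.
- move=> x [h1 h2]; move: h1 h2; rewrite /hS /= !in_itv/= => /andP[/ltW ? ?] /andP[/ltW ? ?].
  by split; rewrite /= in_itv/=; apply/andP.
Qed.

(** Differences follow from linearity, increasing unions from dominated convergence under the
    indicator of the bounded square. *)
Lemma tcont_set_lambda : lambda_system setT tcont_set.
Proof.
split=> [//| |A B BA [mA tA] [mB tB]|F ndF tF].
- by split=> // n; rewrite setTI; exact: tcont_ocitv.
- split=> [|n]; first exact: measurableD.
  have -> : (\1_((A `\` B) `&` hB n) : plane -> R) =
     (fun x => \1_(A `&` hB n) x - \1_(B `&` hB n) x).
    apply/funext => x; rewrite setDE !indicIM !indicE in_setC.
    have BAx : x \in B -> x \in A by move=> /set_mem/BA/mem_set.
    by case: (x \in B) BAx => [/(_ isT) ->|_] /=; ring.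
  by apply: tcontB => //; apply: measurable_indic; exact: measurableI.
- have mF i : measurable (F i) by case: (tF i).
  have mU : measurable (\bigcup_i F i) by exact: bigcupT_measurable.
  split=> // n.
  pose U : set plane := \bigcup_i F i; pose G (k : nat) : set plane := F k.
  rewrite -/U; apply: (@tcont_dominated (fun k : nat => \1_(G k `&` hB n) : plane -> R) (\1_(U `&` hB n) : plane -> R) (\1_(hB n) : plane -> R)).
  + by move=> k; apply: measurable_indic; exact: measurableI.
  + by apply: measurable_indic; exact: measurableI.
  + exact: measurable_indic.
  + move=> x; have [[i _ Fix]|nF] := pselect ((\bigcup_i F i) x).
      apply: cvg_near_cst; exists i => // k /= ik.
      have Fkx : F k x by have /subsetPset := ndF _ _ ik; apply.
      by rewrite !(indicIM _ (hB n)) (indicE _ (G k)) (indicE _ U) (mem_set (Fkx : G k x)) (mem_set (_ : U x))//; exists i.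
    apply: cvg_near_cst; near=> k.
    rewrite !(indicIM _ (hB n)) (indicE _ U) (indicE _ (G k)) (memNset (nF : ~ U x)) (memNset (A := G k))//.
    by move=> Fkx; apply: nF; exists k.
  + move=> k x; rewrite (indicIM _ (hB n)) !indicE; case: (x \in G k); case: (x \in hB n);
      by rewrite /= ?mulr1 ?mulr0 ?normr0 ?normr1.
  + by rewrite sqint_indic.
  + by move=> k; case: (tF k).
Unshelve. all: by end_near. Qed.

(** Used with [Phi] the product by a fixed side, to vary one side of a rectangle at a time. *)
Lemma lambda_preimage (S T : Type) (H : set (set T)) (Phi : set S -> set T) :
  lambda_system setT H -> H (Phi setT) ->
  (forall A B, Phi (A `\` B) = Phi A `\` Phi B) ->
  (forall A B, A `<=` B -> Phi A `<=` Phi B) ->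
  (forall F : nat -> set S, Phi (\bigcup_i F i) = \bigcup_i Phi (F i)) ->
  lambda_system setT [set X | H (Phi X)].
Proof.
move=> [_ HT HD Hn] HPT PD PS PU; split=> //.
- by move=> A B BA HA HB; rewrite /= PD; apply: HD => //; exact: PS.
- move=> F ndF HF; rewrite /= PU; apply: Hn => // i j ij.
  by apply/subsetPset; apply: PS; apply/subsetPset; exact: ndF.
Qed.

Let setXDl (T1 T2 : Type) (A B : set T1) (J : set T2) : (A `\` B) `*` J = (A `*` J) `\` (B `*` J).
Proof. by apply/seteqP; split=> [[x y] [/= [? ?] ?]|[x y] [/= [? ?] h]]; split=> //=; [case|split=> // ?; apply: h]. Qed.

Let setXDr (T1 T2 : Type) (A B : set T2) (J : set T1) : J `*` (A `\` B) = (J `*` A) `\` (J `*` B).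
Proof. by apply/seteqP; split=> [[x y] [/= ? [? ?]]|[x y] [/= [? ?] h]]; split=> //=; [case|split=> // ?; apply: h]. Qed.

Let tcont_ocT (I J : set line) : I = setT \/ ocitv I -> J = setT \/ ocitv J ->
  tcont_set (I `*` J).
Proof.
move=> hI hJ.
have m (K : set line) : K = setT \/ ocitv K -> measurable K.
  by case=> [->//|[[a b] _ <-]]; exact: measurable_itv.
split=> [|n]; first by apply: measurableX; exact: m.
rewrite (_ : _ `&` _ = (I `&` hS n) `*` (J `&` hS n)); last first.
  by apply/seteqP; split=> [x [[? ?] [? ?]]|x [[? ?] [? ?]]].
apply: tcont_ocitv.
- by case: hI => [->|hI]; [rewrite setTI|apply: ocitvI].
- by case: hJ => [->|hJ]; [rewrite setTI|apply: ocitvI].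
Qed.

(** The pi-lambda theorem on the first side, with the half-open intervals as pi-system. [tcont_X]
    repeats it on the second side, and [tcont_measurable] applies it to the rectangles. *)
Let tcont_XocT (X J : set line) : measurable X -> J = setT \/ ocitv J -> tcont_set (X `*` J).
Proof.
move=> mX hJ.
have L : lambda_system setT [set X : set line | tcont_set (X `*` J)].
  apply: (lambda_preimage (Phi := fun X => X `*` J) tcont_set_lambda).
  - by apply: tcont_ocT => //; left.
  - by move=> A B; exact: setXDl.
  - by move=> A B AB x [/= ? ?]; split=> //; exact: AB.
  - move=> F; apply/seteqP; split=> [x [[i _ Fx] Jx]|x [i _ [Fx Jx]]]; first by exists i.
    by split=> //; exists i.
have := @lambda_system_subset _ _ (@ocitvI R) setT _ L.
apply; [by move=> I hI; apply: tcont_ocT => //; right|by []|exact: mX].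
Qed.

Let tcont_X (X Y : set line) : measurable X -> measurable Y -> tcont_set (X `*` Y).
Proof.
move=> mX mY.
have L : lambda_system setT [set Y : set line | tcont_set (X `*` Y)].
  apply: (lambda_preimage (Phi := fun Y => X `*` Y) tcont_set_lambda).
  - by apply: tcont_XocT => //; left.
  - by move=> A B; exact: setXDr.
  - by move=> A B AB x [/= ? ?]; split=> //; exact: AB.
  - move=> F; apply/seteqP; split=> [x [Xx [i _ Fx]]|x [i _ [Xx Fx]]]; first by exists i.
    by split=> //; exists i.
have := @lambda_system_subset _ _ (@ocitvI R) setT _ L.
apply; [by move=> I hI; apply: tcont_XocT => //; right|by []|exact: mY].
Qed.

Lemma tcont_measurable (A : set plane) : measurable A -> tcont_set A.
Proof.
move=> mA.
pose G := [set X `*` Y | X in (measurable : set (set line)) & Y in (measurable : set (set line))].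
have GI : setI_closed G.
  move=> _ _ [X1 mX1 [Y1 mY1 <-]] [X2 mX2 [Y2 mY2 <-]].
  exists (X1 `&` X2); first exact: measurableI.
  exists (Y1 `&` Y2); first exact: measurableI.
  by apply/seteqP; split=> [x [[? ?] [? ?]]|x [[? ?] [? ?]]].
have := @lambda_system_subset _ _ GI setT _ tcont_set_lambda.
apply; [by move=> _ [X mX [Y mY <-]]; exact: tcont_X|by []|].
by rewrite -measurable_prod_measurableType.
Qed.

(** A simple function is a finite combination of indicators of its level sets, so linearity
    applies. *)
Lemma tcont_nnsfun (phi : {nnsfun plane >-> R}) n :
  tcont (fun x => phi x * \1_(hB n) x).
Proof.
have mphi (y : R) : measurable (phi @^-1` [set y]) by exact: measurable_funPTI.
pose G (y : R) (x : plane) : R := y * \1_((phi @^-1` [set y]) `&` hB n) x.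
have mG (y : R) : measurable_fun setT (G y).
  by apply: measurable_funM => //; apply: measurable_indic; exact: measurableI.
have tG (y : R) : tcont (G y).
  apply: tcontZ; first by apply: measurable_indic; exact: measurableI.
  by case: (tcont_measurable (mphi y)).
have -> : (fun x => phi x * \1_(hB n) x) = (fun x => \sum_(y <- finmap.enum_fset (fset_set (range phi))) G y x).
  apply/funext => x; rewrite fimfunE fsbig_finite//= mulr_suml.
  by apply: eq_bigr => y _; rewrite /G (indicIM _ (hB n)) mulrA.
elim: (finmap.enum_fset _) => [|y s ih].
  under eq_fun do rewrite big_nil.
  move=> eta eta0; exists 1 => // z _ _; rewrite /sqdiff.
  under eq_integral do rewrite subrr expr0n/=.
  by rewrite integral0 lee_fin ltW.
under eq_fun do rewrite big_cons.
apply: tcontD => //; exact: measurable_sum.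
Qed.

Lemma ge0_tcont a : measurable_fun setT a -> (forall x, 0 <= a x) ->
  (sqint a < +oo)%E -> tcont a.
Proof.
move=> ma a0 ai.
have maE : measurable_fun setT (EFin \o a) by exact/measurable_EFinP.
pose phi := nnsfun_approx measurableT maE.
have phi_le n x : phi n x <= a x.
  rewrite -lee_fin /phi nnsfun_approxE.
  by apply: (le_approx (f := EFin \o a)) => // y _; rewrite lee_fin.
(* The approximations lie between 0 and [a], so [a] itself dominates; the squares exhaust the plane,
   so each point ends up inside. *)
apply: (@tcont_dominated (fun n x => phi n x * \1_(hB n) x) a a) => //.
- by move=> n; apply: measurable_funM => //; exact: measurable_indic.
- move=> x.
  have cphi : phi n x @[n --> \oo] --> a x.
    have /fine_cvgP[_] := @cvg_nnsfun_approx _ _ _ _ measurableT _ maE (fun x _ => a0 x : (0 <= (a x)%:E)%E) x I.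
    exact.
  rewrite -[X in _ --> X]mulr1; apply: cvgM => //.
  apply: cvg_near_cst.
  exists (Num.truncn (`|x.1| + `|x.2|)).+1 => // n /= hn.
  have h : `|x.1| + `|x.2| < n%:R.
    by apply: lt_le_trans (truncnS_gt _) _; rewrite ler_nat.
  rewrite indicE mem_set// /hB /hS /=.
  have := normr_ge0 x.1; have := normr_ge0 x.2.
  have := ler_norm x.1; have := ler_norm (- x.1); rewrite normrN.
  have := ler_norm x.2; have := ler_norm (- x.2); rewrite normrN.
  by move=> *; split; rewrite /= in_itv/=; apply/andP; split; lra.
- move=> n x; rewrite ger0_norm ?mulr_ge0 ?indicE//.
  by rewrite (le_trans _ (phi_le n x))// ler_piMr//; case: (_ \in _).
- by move=> n; exact: tcont_nnsfun.
Qed.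

Theorem tcont_L2 a : measurable_fun setT a -> (sqint a < +oo)%E -> tcont a.
Proof.
move=> ma ai.
pose p x := Num.max (a x) 0; pose m x := Num.max (- a x) 0.
have mp : measurable_fun setT p by exact: measurable_maxr.
have mm : measurable_fun setT m by apply: measurable_maxr => //; exact: measurableT_comp.
have -> : a = (fun x => p x - m x).
  by apply/funext => x; rewrite /p /m; case: (leP (a x) 0); case: (leP (- a x) 0) => *; lra.
have bound (f : plane -> R) : measurable_fun setT f -> (forall x, `|f x| <= `|a x|) -> (sqint f < +oo)%E.
  move=> mf fa; apply: le_lt_trans ai; apply: ge0_le_integral; [exact: measurableT| | | |].
  - by move=> x _; rewrite lee_fin sqr_ge0.
  - exact: measurable_sqE.
  - exact: measurable_sqE.
  - by move=> x _; rewrite lee_fin -[leLHS]real_normK ?num_real// -[leRHS]real_normK ?num_real// lerXn2r ?nnegrE.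
apply: tcontB => //; apply: ge0_tcont => //.
- by move=> x; rewrite /p le_max lexx orbT.
- apply: bound => // x; rewrite /p; case: (leP (a x) 0) => *; rewrite ?normr0//.
- by move=> x; rewrite /m le_max lexx orbT.
- apply: bound => // x; rewrite /m; case: (leP (- a x) 0) => *; rewrite ?normr0 ?normrN//.
Qed.

End TranslationContinuity.

(** * The Plancherel theorem *)

Section HartleyPlancherel.
Variable R : realType.
Local Notation line := (measurableTypeR R).
Local Notation plane := (line * line)%type.
Local Notation mu := (leb2 R).
Variable a : plane -> R.
Hypothesis ia : mu.-integrable setT (EFin \o a).
Hypothesis a2 : (sqint a < +oo)%E.
Let C := ((2 * pi) ^+ 2 : R).

Let ma : measurable_fun setT a.
Proof. by apply/measurable_EFinP; exact: measurable_int ia. Qed.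

Let C0 : 0 <= C. Proof. exact: sqr_ge0. Qed.

Lemma measurable_sqdiff : measurable_fun setT (sqdiff a).
Proof.
apply: (@measurable_tonelli_plane _ (fun p => ((a (shift p.1 p.2) - a p.2) ^+ 2)%:E)).
- apply/measurable_EFinP; apply: measurable_funX; apply: measurable_funB.
    apply: (measurableT_comp ma); exact: measurable_shift2.
  exact: (measurableT_comp ma measurable_snd).
- by move=> p; rewrite lee_fin sqr_ge0.
Qed.

Let mH := measurable_hartley ma.

Let sqa : sqint a = (fine (sqint a))%:E.
Proof. by rewrite fineK// ge0_fin_numE// sqint_ge0. Qed.

Let regE (e : R) : 0 < e ->
  ((\int[mu]_k (decay2 e k * hartley a k ^+ 2))%R%:E = \int[mu]_k (decay2 e k * hartley a k ^+ 2)%:E)%E.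
Proof.
move=> e0; rewrite /Rintegral fineK//.
have : mu.-integrable setT (EFin \o (fun k => hartley a k ^+ 2 * decay2 e k)).
  apply: (integrable_boundedM (M := (2 * \int[mu]_x `|a x|) ^+ 2)).
  - exact: measurable_funX.
  - by move=> k; rewrite normrX lerXn2r ?nnegrE ?(le_trans (normr_ge0 _) (hartley_bound k ia))// hartley_bound.
  - exact: integrable_decay2.
under [X in _.-integrable _ (_ \o X)]eq_fun do rewrite mulrC.
by move=> h; exact: (integrable_fin_num _ h).
Qed.

Let reg_le (e : R) : 0 < e ->
  (\int[mu]_k (decay2 e k * hartley a k ^+ 2)%:E <= C%:E * sqint a)%E.
Proof.
move=> e0; have := hartley_energy e0 ma ia a2.
rewrite -/C (EFinM 2 C) EFinM regE// => h.
rewrite -(@lee_pmul2l _ 2%:E)// ?lte_fin// muleA -h leeDl//.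
apply: integral_ge0 => z _; rewrite mule_ge0 ?lee_fin ?poisson2_ge0//.
exact: sqint_ge0.
Qed.

(** The weights with e = 1 / (n + 1) increase to 1, so monotone convergence removes them from the
    uniform bound [reg_le]. *)
Lemma hartley_le : (sqint (hartley a) <= C%:E * sqint a)%E.
Proof.
pose g (n : nat) (k : plane) := (decay2 (n.+1%:R^-1 : R) k * hartley a k ^+ 2)%:E.
have ginc (k : plane) : nondecreasing_seq (g ^~ k).
  move=> m n mn; rewrite lee_fin ler_wpM2r ?sqr_ge0// /decay2 /decay.
  have h (t : R) : expR (- (m.+1%:R^-1 * `|t|)) <= expR (- (n.+1%:R^-1 * `|t|)).
    by rewrite ler_expR lerN2 ler_wpM2r// lef_pV2 ?posrE// ler_nat ltnS.
  by rewrite ler_pM ?expR_ge0.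
have gcv (k : plane) : limn (g ^~ k) = ((hartley a k) ^+ 2)%:E.
  apply/cvg_lim => //; apply: cvg_EFin; first by near=> n.
  rewrite /comp /= -[X in _ --> X]mul1r; apply: cvgM; last exact: cvg_cst.
  rewrite -[X in _ --> X](mulr1 1) /decay2.
  have h (t : R) : decay (n.+1%:R^-1 : R) t @[n --> \oo] --> (1 : R).
    have c1 : - (n.+1%:R^-1 * `|t|) @[n --> \oo] --> (- (0 * `|t|) : R).
      apply: cvgN; apply: cvgM; last exact: cvg_cst.
      exact: cvg_harmonic.
    have := cvg_comp _ _ c1 (@continuous_expR R _).
    by rewrite mul0r oppr0 expR0.
  by apply: cvgM; exact: h.
rewrite /sqint; under eq_integral do rewrite -gcv.
rewrite monotone_convergence//.
- apply: lime_le.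
    apply: ereal_nondecreasing_is_cvgn => m n mn; apply: ge0_le_integral => //.
    + by move=> k _; rewrite lee_fin mulr_ge0 ?sqr_ge0// ltW// decay2_gt0.
    + by apply/measurable_EFinP; apply: measurable_funM; [exact: measurable_decay2|exact: measurable_funX].
    + by apply/measurable_EFinP; apply: measurable_funM; [exact: measurable_decay2|exact: measurable_funX].
    + by move=> k _; exact: ginc.
  by near=> n; exact: reg_le.
- move=> n; apply/measurable_EFinP; apply: measurable_funM; [exact: measurable_decay2|exact: measurable_funX].
- by move=> n k _; rewrite lee_fin mulr_ge0 ?sqr_ge0// ltW// decay2_gt0.
Unshelve. all: by end_near. Qed.

(** The supremum of (1 + t^2) / t^2 over |t| >= delta. *)
Let tailK (delta : R) := (1 + delta ^+ 2) / delta ^+ 2.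

(** Away from 0 the kernel is O(e) times a fixed kernel of finite mass, which controls the tail
    without computing it. *)
Let poisson_tail (delta e t : R) : 0 < delta -> 0 < e -> delta <= `|t| ->
  poisson e t <= e * tailK delta * poisson 1 t.
Proof.
move=> d0 e0 dt; rewrite /poisson expr1n mulr1.
have t2 : delta ^+ 2 <= t ^+ 2.
  by rewrite -(real_normK (num_real t)) lerXn2r ?nnegrE// ltW.
have d2 : 0 < delta ^+ 2 by rewrite exprn_gt0.
have t20 : 0 < t ^+ 2 by exact: lt_le_trans t2.
have p1 : 0 < 1 + t ^+ 2 by rewrite addr_gt0.
have p2 : 0 < e ^+ 2 + t ^+ 2 by rewrite addr_gt0// exprn_gt0.
rewrite ler_pdivrMr//.
have -> : e * tailK delta * (2 / (1 + t ^+ 2)) * (e ^+ 2 + t ^+ 2) =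
   2 * e * ((1 + delta ^+ 2) * (e ^+ 2 + t ^+ 2) / (delta ^+ 2 * (1 + t ^+ 2))).
  by rewrite /tailK; field; rewrite !gt_eqF.
rewrite ler_peMr ?mulr_ge0 ?(ltW e0)// ler_pdivlMr ?mulr_gt0// mul1r.
have e2 := sqr_ge0 e.
nra.
Qed.

(** The approximate identity argument: near 0 the translates are close to [a]; elsewhere one
    coordinate of z is at least d in absolute value, and its kernel is small by [poisson_tail]. *)
Lemma sqdiff_average_small (eta : R) : 0 < eta -> exists2 e : R, 0 < e &
  (\int[mu]_z ((poisson2 e z)%:E * sqdiff a z) <= eta%:E)%E.
Proof.
move=> eta0.
(* The final bound is C eta1 + 2 C c with 2 c <= eta1, hence at most 2 C eta1 <= eta. *)
pose eta1 := eta / (2 * C + 1).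
have c1 : 0 < 2 * C + 1 by rewrite ltr_wpDl// mulr_ge0.
have eta10 : 0 < eta1 by rewrite divr_gt0.
have [d d0 hd] := tcont_L2 ma a2 eta10.
pose N := fine (sqint a).
have N0 : 0 <= N by rewrite fine_ge0// sqint_ge0.
have K0 : 0 < tailK d by rewrite divr_gt0 ?addr_gt0 ?exprn_gt0.
have NK : 0 < 8 * N * tailK d + 1.
  by rewrite ltr_wpDl// mulr_ge0 ?(ltW K0)// mulr_ge0.
(* Makes 2 c = 8 N e (tailK d) at most eta1. *)
pose e := eta1 / (8 * N * tailK d + 1).
have e0 : 0 < e by rewrite divr_gt0.
exists e => //.
have p10 (t : R) : 0 <= poisson 1 t :> R by exact: poisson_ge0.
have pe0 (t : R) : 0 <= poisson e t :> R by exact: poisson_ge0.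
have m1 := measurable_poisson (ltr01 : 0 < (1 : R)).
have me := measurable_poisson e0.
(* The kernels that remain when the first, respectively the second, coordinate is the large one;
   each has mass C. *)
pose T1 (z : plane) := poisson 1 z.1 * poisson e z.2.
pose T2 (z : plane) := poisson e z.1 * poisson 1 z.2.
have mT1 : measurable_fun setT T1 by exact: measurable_prodM.
have mT2 : measurable_fun setT T2 by exact: measurable_prodM.
have iT1 : (\int[mu]_z (T1 z)%:E = C%:E)%E.
  by rewrite ge0_integral_prodM// !integral_poisson// -EFinM -expr2.
have iT2 : (\int[mu]_z (T2 z)%:E = C%:E)%E.
  by rewrite ge0_integral_prodM// !integral_poisson// -EFinM -expr2.
(* The factor 4 N bounds [sqdiff a z] for every z. *)
pose c := 4 * N * (e * tailK d).
have eK0 : 0 <= e * tailK d by rewrite mulr_ge0 ?ltW.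
have c0 : 0 <= c by rewrite /c mulr_ge0// mulr_ge0.
apply: (@le_trans _ _ (\int[mu]_z (eta1%:E * (poisson2 e z)%:E + c%:E * (T1 z + T2 z)%:E)))%E.
  apply: ge0_le_integral; [exact: measurableT| | | |].
  - by move=> z _; rewrite mule_ge0 ?lee_fin ?poisson2_ge0//; exact: sqint_ge0.
  - by apply: emeasurable_funM; [apply/measurable_EFinP; exact: measurable_poisson2|exact: measurable_sqdiff].
  - apply: emeasurable_funD; apply: measurable_funeM; apply/measurable_EFinP.
      exact: measurable_poisson2.
    exact: measurable_funD.
  - move=> z _.
    have [hz|hz] := boolP ((`|z.1| < d) && (`|z.2| < d)).
      have /andP[z1 z2] := hz.
      apply: (@le_trans _ _ ((poisson2 e z)%:E * eta1%:E)%E).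
        by rewrite lee_wpmul2l ?lee_fin ?poisson2_ge0//; exact: hd.
      by rewrite muleC leeDl// -EFinM lee_fin mulr_ge0// addr_ge0// mulr_ge0.
    apply: (@le_trans _ _ ((poisson2 e z)%:E * (4%:E * sqint a))%E).
      by rewrite lee_wpmul2l ?lee_fin ?poisson2_ge0//; exact: sqdiff_le4.
    rewrite sqa -!EFinM -EFinD lee_fin.
    have : poisson2 e z <= e * tailK d * (T1 z + T2 z).
      rewrite mulrDr /poisson2; move: hz; rewrite negb_and -!leNgt => /orP[h|h].
        apply: (@le_trans _ _ (e * tailK d * T1 z)); last by rewrite lerDl mulr_ge0// mulr_ge0.
        by rewrite /T1 mulrA ler_wpM2r//; exact: poisson_tail.
      apply: (@le_trans _ _ (e * tailK d * T2 z)); last by rewrite lerDr mulr_ge0// mulr_ge0.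
      by rewrite /T2 [leRHS]mulrCA ler_wpM2l//; exact: poisson_tail.
    move=> h; rewrite -/N.
    apply: (@le_trans _ _ (c * (T1 z + T2 z))); last first.
      by rewrite lerDr mulr_ge0 ?(ltW eta10)// poisson2_ge0.
    by rewrite /c mulrC -mulrA ler_wpM2l// mulr_ge0.
have mp := measurable_poisson2 e0.
rewrite ge0_integralD; last 5 first.
- exact: measurableT.
- by move=> z _; rewrite -EFinM lee_fin mulr_ge0 ?(ltW eta10)// poisson2_ge0.
- by apply: measurable_funeM; apply/measurable_EFinP.
- by move=> z _; rewrite -EFinM lee_fin mulr_ge0// addr_ge0// mulr_ge0.
- by apply: measurable_funeM; apply/measurable_EFinP; exact: measurable_funD.
rewrite ge0_integralZl_EFin; last 4 first.
- exact: measurableT.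
- by move=> z _; rewrite lee_fin poisson2_ge0.
- by apply/measurable_EFinP.
- exact: ltW.
rewrite ge0_integralZl_EFin; last 4 first.
- exact: measurableT.
- by move=> z _; rewrite lee_fin addr_ge0// mulr_ge0.
- by apply/measurable_EFinP; exact: measurable_funD.
- exact: c0.
under [X in (_ + _ * X)%E]eq_integral do rewrite EFinD.
rewrite ge0_integralD; last 5 first.
- exact: measurableT.
- by move=> z _; rewrite lee_fin mulr_ge0.
- by apply/measurable_EFinP.
- by move=> z _; rewrite lee_fin mulr_ge0.
- by apply/measurable_EFinP.
rewrite integral_poisson2// iT1 iT2 -/C.
have -> : (eta1%:E * C%:E + c%:E * (C%:E + C%:E) = (eta1 * C + c * (C + C))%:E)%E by [].
rewrite lee_fin.
have ce : c * 2 <= eta1.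
  have -> : c * 2 = e * (8 * N * tailK d) by rewrite /c; ring.
  have <- : e * (8 * N * tailK d + 1) = eta1 by rewrite /e divfK// gt_eqF.
  by rewrite mulrDr mulr1 lerDl ltW.
have : eta1 * (2 * C + 1) = eta by rewrite /eta1 divfK// gt_eqF.
have h := ler_wpM2r C0 ce; have := ltW eta10; have -> : c * (C + C) = c * 2 * C by ring.
lra.
Qed.

Theorem hartley_plancherel : sqint (hartley a) = (C%:E * sqint a)%E.
Proof.
apply/eqP; rewrite eq_le hartley_le /=.
apply/lee_addgt0Pr => eta eta0.
have [e e0 he] := sqdiff_average_small eta0.
have := hartley_energy e0 ma ia a2.
rewrite -/C (EFinM 2 C) EFinM regE// => h.
have r0 : (0 <= \int[mu]_k (decay2 e k * hartley a k ^+ 2)%:E)%E.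
  by apply: integral_ge0 => k _; rewrite lee_fin mulr_ge0 ?sqr_ge0// ltW// decay2_gt0.
have rH : (\int[mu]_k (decay2 e k * hartley a k ^+ 2)%:E <= sqint (hartley a))%E.
  apply: ge0_le_integral; [exact: measurableT| | | |].
  - by move=> k _; rewrite lee_fin mulr_ge0 ?sqr_ge0// ltW// decay2_gt0.
  - by apply/measurable_EFinP; apply: measurable_funM; [exact: measurable_decay2|exact: measurable_funX].
  - exact: measurable_sqE.
  - by move=> k _; rewrite lee_fin ler_piMl ?sqr_ge0// decay2_le1// ltW.
rewrite -(@lee_pmul2l _ 2%:E)// ?lte_fin// muleA -h.
rewrite (ge0_muleDr _ (sqint_ge0 _) _); last by rewrite lee_fin ltW.
apply: leeD; first by rewrite lee_pmul2l// lte_fin.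
apply: (le_trans he); rewrite -EFinM lee_fin; lra.
Qed.

End HartleyPlancherel.

(** * From the Hartley transform to the complex Fourier transform *)

Section ComplexFourier.
Variable R : realType.
Local Notation line := (measurableTypeR R).
Local Notation plane := (line * line)%type.
Local Notation C := (R[i]).
Local Notation mu := (leb2 R).
Local Notation Re := (@complex.Re R).
Local Notation Im := (@complex.Im R).
Implicit Types (k x v : plane) (a b : plane -> R) (f g : plane -> C) (z : C).

(** The squared modulus as a polynomial in the two parts, so that no square root occurs and
    identities follow by [ring]. *)
Definition nsq z : R := Re z ^+ 2 + Im z ^+ 2.
Definition csqint f : \bar R := (\int[mu]_x (nsq (f x))%:E)%E.

Lemma nsq_ge0 z : 0 <= nsq z. Proof. by rewrite addr_ge0 ?sqr_ge0. Qed.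

Lemma normc_sqr z : normc z ^+ 2 = nsq z.
Proof. by case: z => a b; rewrite /normc sqr_sqrtr// addr_ge0 ?sqr_ge0. Qed.

Lemma nsqM z w : nsq (z * w) = nsq z * nsq w.
Proof. by case: z w => a b [c d]; rewrite /nsq/=; ring. Qed.

(** Young's inequality with a parameter: for real numbers the right side minus the left is (e s -
    t)^2 / e. The factor 1 + e on one term, as close to 1 as desired, serves in limits and in the
    strip estimate. *)
Lemma nsqD_le (e : R) z w : 0 < e ->
  nsq (z + w) <= (1 + e) * nsq z + (1 + e^-1) * nsq w.
Proof.
move=> e0; case: z w => a b [c d]; rewrite /nsq/=.
have h (s t : R) : (s + t) ^+ 2 <= (1 + e) * s ^+ 2 + (1 + e^-1) * t ^+ 2.
  rewrite -subr_ge0.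
  have -> : (1 + e) * s ^+ 2 + (1 + e^-1) * t ^+ 2 - (s + t) ^+ 2 = (e * s - t) ^+ 2 / e.
    by field; rewrite gt_eqF.
  by rewrite divr_ge0 ?sqr_ge0// ltW.
by have := h a c; have := h b d; lra.
Qed.

Lemma measurable_nsq f : cmeasurable setT f -> measurable_fun setT (fun x => nsq (f x)).
Proof. by move=> [m1 m2]; apply: measurable_funD; exact: measurable_funX. Qed.

Lemma csqint_ge0 f : (0 <= csqint f)%E.
Proof. by apply: integral_ge0 => x _; rewrite lee_fin nsq_ge0. Qed.

Lemma csqintE f : cmeasurable setT f ->
  csqint f = (sqint (fun x => Re (f x)) + sqint (fun x => Im (f x)))%E.
Proof.
move=> [m1 m2]; rewrite /csqint /nsq /sqint -ge0_integralD//.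
- by move=> x _; rewrite lee_fin sqr_ge0.
- exact: measurable_sqE.
- by move=> x _; rewrite lee_fin sqr_ge0.
- exact: measurable_sqE.
Qed.

Lemma csqint_leD (r s : R) f g h : cmeasurable setT f -> cmeasurable setT g ->
  cmeasurable setT h -> 0 <= r -> 0 <= s ->
  (forall x, nsq (h x) <= r * nsq (f x) + s * nsq (g x)) ->
  (csqint h <= r%:E * csqint f + s%:E * csqint g)%E.
Proof.
move=> /measurable_nsq mf /measurable_nsq mg /measurable_nsq mh r0 s0 H; rewrite /csqint.
have [mA mB] : measurable_fun setT (fun x => (nsq (f x))%:E) /\ measurable_fun setT (fun x => (nsq (g x))%:E).
  by split; exact/measurable_EFinP.
rewrite -(ge0_integralZl_EFin _ measurableT _ mA r0); last by move=> x _; rewrite lee_fin nsq_ge0.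
rewrite -(ge0_integralZl_EFin _ measurableT _ mB s0); last by move=> x _; rewrite lee_fin nsq_ge0.
rewrite -ge0_integralD; last 5 first.
- exact: measurableT.
- by move=> x _; rewrite -EFinM lee_fin mulr_ge0 ?nsq_ge0.
- exact: measurable_funeM.
- by move=> x _; rewrite -EFinM lee_fin mulr_ge0 ?nsq_ge0.
- exact: measurable_funeM.
apply: ge0_le_integral; [exact: measurableT| | | |].
- by move=> x _; rewrite lee_fin nsq_ge0.
- exact/measurable_EFinP.
- by apply: emeasurable_funD; exact: measurable_funeM.
- by move=> x _; rewrite -!EFinM -EFinD lee_fin.
Qed.

Lemma normc_sqE f x : ((normc (f x))%:E `^ 2 = (nsq (f x))%:E)%E.
Proof. by rewrite poweR_EFin powR_mulrn ?normc_sqr// /normc; case: (f x) => a b; exact: sqrtr_ge0. Qed.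

Lemma normc_nneg z : 0 <= normc z.
Proof. by case: z => a b; exact: sqrtr_ge0. Qed.

Lemma L2norm_sq f : (L2norm f `^ 2 = csqint f)%E.
Proof.
rewrite /L2norm poweR_Lnorm//; apply: eq_integral => x _.
by rewrite gee0_abs ?lee_fin ?normc_nneg// normc_sqE.
Qed.

Lemma L2normE f : (L2norm f = csqint f `^ 2^-1)%E.
Proof.
rewrite -L2norm_sq -poweRrM mulfV// poweRe1//; exact: Lnorm_ge0.
Qed.

Lemma L2_csqint f : L2 setT f <-> cmeasurable setT f /\ (csqint f < +oo)%E.
Proof.
rewrite /L2 /csqint /=; under eq_integral do rewrite normc_sqr.
by [].
Qed.

Lemma L2norm_le (e : R) f : 0 <= e -> ((L2norm f <= e%:E)%E <-> (csqint f <= (e ^+ 2)%:E)%E).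
Proof.
move=> e0.
have le_pow (r : R) (x y : \bar R) : 0 <= r -> (0 <= x)%E -> (x <= y)%E -> (x `^ r <= y `^ r)%E.
  move=> r0 x0 xy; apply: gt0_ler_poweR => //; rewrite in_itv/= leey andbT//.
  exact: le_trans xy.
split=> h.
- rewrite -L2norm_sq (le_trans (le_pow 2 _ _ _ _ h))//; first exact: Lnorm_ge0.
  by rewrite poweR_EFin powR_mulrn.
- rewrite L2normE (le_trans (le_pow 2^-1 _ _ _ (csqint_ge0 f) h))//.
  by rewrite poweR_EFin powR12_sqrt ?sqr_ge0// sqrtr_sqr ger0_norm.
Qed.

Lemma cvge0P (u : nat -> \bar R) : (forall n, (0 <= u n)%E) ->
  ((u n @[n --> \oo] --> 0)%E <-> forall e : R, 0 < e -> exists N, forall n, (N <= n)%N -> (u n <= e%:E)%E).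
Proof.
move=> u0; split=> [cu e e0|H].
  have /cu [N _ HN] : nbhs (0%E : \bar R) [set x | (x <= e%:E)%E].
    exists e => //= r /=; rewrite sub0r normrN => h.
    by rewrite lee_fin ltW// (le_lt_trans (ler_norm _)).
  by exists N => n Nn; apply: HN => /=.
apply/fine_cvgP; split.
  have [N HN] := H 1 ltr01; exists N => // n /= Nn.
  by rewrite ge0_fin_numE// (le_lt_trans (HN n Nn))// ltry.
apply/cvgrPdist_le => e e0; have [N HN] := H e e0; exists N => // n /= Nn.
rewrite sub0r normrN ger0_norm ?fine_ge0// -lee_fin fineK ?HN//.
by rewrite ge0_fin_numE// (le_lt_trans (HN n Nn))// ltry.
Qed.

Lemma cvg_L2norm (u : nat -> plane -> C) :
  ((L2norm (u n) @[n --> \oo] --> 0) <-> (csqint (u n) @[n --> \oo] --> 0))%E.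
Proof.
rewrite !cvge0P; [|by move=> n; exact: csqint_ge0|by move=> n; exact: Lnorm_ge0].
split=> H e e0.
- have se0 : 0 < Num.sqrt e by rewrite sqrtr_gt0.
  have [N HN] := H _ se0; exists N => n Nn.
  by have /(L2norm_le _ (ltW se0)) := HN n Nn; rewrite sqr_sqrtr// ltW.
- have [N HN] := H _ (exprn_gt0 2 e0); exists N => n Nn.
  by apply/(L2norm_le _ (ltW e0)); exact: HN.
Qed.

Definition costr a k : R := \int[mu]_x (cos (dot k x) * a x).
Definition sintr a k : R := \int[mu]_x (sin (dot k x) * a x).

Lemma measurable_cos_dot k : measurable_fun setT (fun x => cos (dot k x)).
Proof.
apply: (measurableT_comp (f := cos)); first by apply: continuous_measurable_fun; exact: continuous_cos.
exact: measurable_dot1.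
Qed.

Lemma measurable_sin_dot k : measurable_fun setT (fun x => sin (dot k x)).
Proof.
apply: (measurableT_comp (f := sin)); first by apply: continuous_measurable_fun; exact: continuous_sin.
exact: measurable_dot1.
Qed.

Lemma integrable_cos_dot a k : mu.-integrable setT (EFin \o a) ->
  mu.-integrable setT (EFin \o (fun x => cos (dot k x) * a x)).
Proof.
move=> ia; apply: (integrable_boundedM (M := 1)) ia; first exact: measurable_cos_dot.
by move=> x; exact: cos_norm_le1.
Qed.

Lemma integrable_sin_dot a k : mu.-integrable setT (EFin \o a) ->
  mu.-integrable setT (EFin \o (fun x => sin (dot k x) * a x)).
Proof.
move=> ia; apply: (integrable_boundedM (M := 1)) ia; first exact: measurable_sin_dot.
by move=> x; exact: sin_norm_le1.
Qed.

Lemma hartleyE a k : mu.-integrable setT (EFin \o a) -> hartley a k = costr a k + sintr a k.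
Proof.
move=> ia; rewrite /hartley /costr /sintr -RintegralD//; last 2 first.
- exact: integrable_cos_dot.
- exact: integrable_sin_dot.
by apply: eq_Rintegral => x _; rewrite /cas mulrDl.
Qed.

Lemma dot_flip k x : dot (flip k) x = - dot k x.
Proof. by rewrite /dot /=; ring. Qed.

Lemma costr_flip a k : costr a (flip k) = costr a k.
Proof. by apply: eq_Rintegral => x _; rewrite dot_flip cosN. Qed.

Lemma sintr_flip a k : mu.-integrable setT (EFin \o a) -> sintr a (flip k) = - sintr a k.
Proof.
move=> ia; rewrite /sintr -[RHS]mulN1r -RintegralZl//; last exact: integrable_sin_dot.
by apply: eq_Rintegral => x _; rewrite dot_flip sinN mulNr mulN1r.
Qed.

Lemma costr_shift a v k : mu.-integrable setT (EFin \o a) ->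
  costr (fun x => a (shift v x)) k = cos (dot k v) * costr a k + sin (dot k v) * sintr a k.
Proof.
move=> ia; have ma : measurable_fun setT a by apply/measurable_EFinP; exact: measurable_int ia.
have i1 := integrable_cos_dot k ia; have i2 := integrable_sin_dot k ia.
rewrite /costr /sintr -!RintegralZl// -RintegralD//; last 2 first.
- exact: (@integrableZl _ _ _ mu _ measurableT (cos (dot k v)) (EFin \o (fun x => cos (dot k x) * a x))).
- exact: (@integrableZl _ _ _ mu _ measurableT (sin (dot k v)) (EFin \o (fun x => sin (dot k x) * a x))).
(* Translating the variable on the right-hand side reduces the claim to an identity between
   integrands, settled by cos^2 + sin^2 = 1. *)
rewrite -[RHS](Rintegral_preserves (preserves_shift v)); last first.
  apply: measurable_funD; apply: measurable_funM => //; apply: measurable_funM => //.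
    exact: measurable_cos_dot.
  exact: measurable_sin_dot.
apply: eq_Rintegral => x _ /=.
have -> : dot k (shift v x) = dot k x + dot k v by rewrite /dot/=; ring.
have h := cos2Dsin2 (dot k v).
rewrite cosD sinD.
transitivity ((cos (dot k v) ^+ 2 + sin (dot k v) ^+ 2) * (cos (dot k x) * a (shift v x))).
  by rewrite h mul1r.
ring.
Qed.

Lemma sintr_shift a v k : mu.-integrable setT (EFin \o a) ->
  sintr (fun x => a (shift v x)) k = cos (dot k v) * sintr a k - sin (dot k v) * costr a k.
Proof.
move=> ia; have ma : measurable_fun setT a by apply/measurable_EFinP; exact: measurable_int ia.
have i1 := integrable_cos_dot k ia; have i2 := integrable_sin_dot k ia.
rewrite /costr /sintr -!RintegralZl// -RintegralB//; last 2 first.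
- exact: (@integrableZl _ _ _ mu _ measurableT (cos (dot k v)) (EFin \o (fun x => sin (dot k x) * a x))).
- exact: (@integrableZl _ _ _ mu _ measurableT (sin (dot k v)) (EFin \o (fun x => cos (dot k x) * a x))).
rewrite -[RHS](Rintegral_preserves (preserves_shift v)); last first.
  apply: measurable_funB; apply: measurable_funM => //; apply: measurable_funM => //.
    exact: measurable_sin_dot.
  exact: measurable_cos_dot.
apply: eq_Rintegral => x _ /=.
have -> : dot k (shift v x) = dot k x + dot k v by rewrite /dot/=; ring.
have h := cos2Dsin2 (dot k v).
rewrite cosD sinD.
transitivity ((cos (dot k v) ^+ 2 + sin (dot k v) ^+ 2) * (sin (dot k x) * a (shift v x))).
  by rewrite h mul1r.
ring.
Qed.

Lemma costrB a b k : mu.-integrable setT (EFin \o a) -> mu.-integrable setT (EFin \o b) ->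
  costr (fun x => a x - b x) k = costr a k - costr b k.
Proof.
move=> ia ib; rewrite /costr -RintegralB//; last 2 first.
- exact: integrable_cos_dot.
- exact: integrable_cos_dot.
by apply: eq_Rintegral => x _; rewrite mulrBr.
Qed.

Lemma sintrB a b k : mu.-integrable setT (EFin \o a) -> mu.-integrable setT (EFin \o b) ->
  sintr (fun x => a x - b x) k = sintr a k - sintr b k.
Proof.
move=> ia ib; rewrite /sintr -RintegralB//; last 2 first.
- exact: integrable_sin_dot.
- exact: integrable_sin_dot.
by apply: eq_Rintegral => x _; rewrite mulrBr.
Qed.

Lemma normc_Re z : `|Re z| <= normc z.
Proof.
case: z => a b; rewrite /= -sqrtr_sqr; apply: ler_wsqrtr; by rewrite lerDl sqr_ge0.
Qed.

Lemma normc_Im z : `|Im z| <= normc z.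
Proof.
case: z => a b; rewrite /= -sqrtr_sqr; apply: ler_wsqrtr; by rewrite lerDr sqr_ge0.
Qed.

Lemma measurable_normc f : cmeasurable setT f -> measurable_fun setT (fun x => normc (f x)).
Proof.
move=> mf; rewrite (_ : (fun x => _) = (fun x => Num.sqrt (nsq (f x)))).
  apply: measurableT_comp; last exact: measurable_nsq.
  by apply: continuous_measurable_fun; exact: sqrt_continuous.
by apply/funext => x; rewrite /nsq; case: (f x).
Qed.

Lemma L1_Re f : L1 f -> mu.-integrable setT (EFin \o (fun x => Re (f x))).
Proof.
move=> [[m1 m2] fi]; apply/integrableP; split; first exact/measurable_EFinP.
apply: le_lt_trans fi; apply: ge0_le_integral; [exact: measurableT| | | |].
- by move=> x _; exact: abse_ge0.
- by apply: measurableT_comp => //; exact/measurable_EFinP.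
- by apply/measurable_EFinP; exact: measurable_normc.
- by move=> x _; rewrite /= lee_fin normc_Re.
Qed.

Lemma L1_Im f : L1 f -> mu.-integrable setT (EFin \o (fun x => Im (f x))).
Proof.
move=> [[m1 m2] fi]; apply/integrableP; split; first exact/measurable_EFinP.
apply: le_lt_trans fi; apply: ge0_le_integral; [exact: measurableT| | | |].
- by move=> x _; exact: abse_ge0.
- by apply: measurableT_comp => //; exact/measurable_EFinP.
- by apply/measurable_EFinP; exact: measurable_normc.
- by move=> x _; rewrite /= lee_fin normc_Im.
Qed.

Lemma fourier1E f k : L1 f -> fourier1 f k =
  Complex ((2 * pi)^-1 * (costr (Re \o f) k + sintr (Im \o f) k))
          ((2 * pi)^-1 * (costr (Im \o f) k - sintr (Re \o f) k)).
Proof.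
move=> f1; have ir := L1_Re f1; have ii := L1_Im f1.
rewrite /fourier1 /cintegral.
have -> : (\int[mu]_x Re (expNi (dot k x) * f x))%R = costr (Re \o f) k + sintr (Im \o f) k.
  rewrite /costr /sintr -RintegralD//; last 2 first.
  - exact: integrable_cos_dot.
  - exact: integrable_sin_dot.
  by apply: eq_Rintegral => x _; rewrite /expNi /=; case: (f x) => p q /=; ring.
have -> : (\int[mu]_x Im (expNi (dot k x) * f x))%R = costr (Im \o f) k - sintr (Re \o f) k.
  rewrite /costr /sintr -RintegralB//; last 2 first.
  - exact: integrable_cos_dot.
  - exact: integrable_sin_dot.
  by apply: eq_Rintegral => x _; rewrite /expNi /=; case: (f x) => p q /=; ring.
by apply/eqP; rewrite eq_complex /=; apply/andP; split; apply/eqP; ring.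
Qed.

Lemma measurable_costr a : measurable_fun setT a -> measurable_fun setT (costr a).
Proof.
move=> ma; apply: (measurableT_comp (fine_measurable measurableT)).
apply: (@measurable_fubini_plane _ (fun p => (cos (dot p.1 p.2) * a p.2)%:E)).
apply/measurable_EFinP; apply: measurable_funM; last exact: (measurableT_comp ma measurable_snd).
apply: (measurableT_comp (f := cos)); last exact: measurable_dot.
by apply: continuous_measurable_fun; exact: continuous_cos.
Qed.

Lemma measurable_sintr a : measurable_fun setT a -> measurable_fun setT (sintr a).
Proof.
move=> ma; apply: (measurableT_comp (fine_measurable measurableT)).
apply: (@measurable_fubini_plane _ (fun p => (sin (dot p.1 p.2) * a p.2)%:E)).
apply/measurable_EFinP; apply: measurable_funM; last exact: (measurableT_comp ma measurable_snd).
apply: (measurableT_comp (f := sin)); last exact: measurable_dot.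
by apply: continuous_measurable_fun; exact: continuous_sin.
Qed.

Lemma cmeasurable_fourier1 f : L1 f -> cmeasurable setT (fourier1 f).
Proof.
move=> f1; have [[m1 m2] _] := f1.
split; (under eq_fun do rewrite fourier1E//); rewrite /=; apply: measurable_funM => //.
  by apply: measurable_funD; [exact: measurable_costr|exact: measurable_sintr].
by apply: measurable_funB; [exact: measurable_costr|exact: measurable_sintr].
Qed.

Lemma sqint_lty_Re f : L2 setT f -> (sqint (fun x => Re (f x)) < +oo)%E.
Proof.
move=> /L2_csqint[mf]; rewrite csqintE//; apply: le_lt_trans.
by rewrite leeDl// sqint_ge0.
Qed.

Lemma sqint_lty_Im f : L2 setT f -> (sqint (fun x => Im (f x)) < +oo)%E.
Proof.
move=> /L2_csqint[mf]; rewrite csqintE//; apply: le_lt_trans.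
by rewrite leeDr// sqint_ge0.
Qed.

Lemma cmeasurable_flip f : cmeasurable setT f -> cmeasurable setT (fun k => f (flip k)).
Proof.
move=> [m1 m2]; split.
- exact: (measurableT_comp m1 (@measurable_flip R)).
- exact: (measurableT_comp m2 (@measurable_flip R)).
Qed.

Lemma csqint_flip f : cmeasurable setT f -> csqint (fun k => f (flip k)) = csqint f.
Proof.
move=> /measurable_nsq mf; rewrite /csqint.
rewrite (ge0_integral_preserves (f := fun k => (nsq (f k))%:E) (preserves_flip R))//.
- exact/measurable_EFinP.
- by move=> k; rewrite lee_fin nsq_ge0.
Qed.

Lemma csqintD f g : cmeasurable setT f -> cmeasurable setT g ->
  (\int[mu]_x (nsq (f x) + nsq (g x))%:E = csqint f + csqint g)%E.
Proof.
move=> /measurable_nsq mf /measurable_nsq mg; under eq_integral do rewrite EFinD.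
rewrite ge0_integralD//.
- by move=> x _; rewrite lee_fin nsq_ge0.
- exact/measurable_EFinP.
- by move=> x _; rewrite lee_fin nsq_ge0.
- exact/measurable_EFinP.
Qed.

(** For f = a + i b the modulus of the transform differs pointwise from that of the pair of Hartley
    transforms of a and b. But [costr] is even and [sintr] odd in k, so in the sum over k and - k
    all cross terms cancel and the two agree up to (2 pi)^-2. *)
Theorem plancherel f : L1 f -> L2 setT f -> csqint (fourier1 f) = csqint f.
Proof.
move=> f1 f2; have [[m1 m2] _] := f1.
have ir := L1_Re f1; have ii := L1_Im f1.
have mF := cmeasurable_fourier1 f1.
have mn := measurable_nsq mF.
pose a x := Re (f x); pose b x := Im (f x).
have mHa : measurable_fun setT (hartley a) by exact: measurable_hartley.
have mHb : measurable_fun setT (hartley b) by exact: measurable_hartley.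
have pi0 : 2 * pi != 0 :> R by rewrite mulf_neq0// gt_eqF// pi_gt0.
pose G k : C := Complex (hartley a k) (hartley b k).
have mG : cmeasurable setT G by split.
have key : (csqint (fourier1 f) + csqint (fourier1 f) =
   ((2 * pi) ^- 2)%:E * (csqint G + csqint G))%E.
  rewrite -{2}(csqint_flip mF) -{2}(csqint_flip mG).
  have mFf := cmeasurable_flip mF; have mGf := cmeasurable_flip mG.
  rewrite -(csqintD mF mFf) -(csqintD mG mGf).
  have mGG : measurable_fun setT (fun k => nsq (G k) + nsq (G (flip k))).
    exact: (measurable_funD (measurable_nsq mG) (measurable_nsq mGf)).
  rewrite -(ge0_integralZl_EFin _ measurableT); last 3 first.
  - by move=> k _; rewrite lee_fin addr_ge0 ?nsq_ge0.
  - exact/measurable_EFinP.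
  - by rewrite invr_ge0 sqr_ge0.
  apply: eq_integral => k _; rewrite -EFinM; congr EFin.
  rewrite !fourier1E// /G !hartleyE// !costr_flip !sintr_flip// /nsq/=.
  rewrite -[Re \o f]/a -[Im \o f]/b -exprVn.
  by set c := (2 * pi)^-1; ring.
have GE := csqintE mG; rewrite /= -/(hartley a) -/(hartley b) in GE.
have Ha := hartley_plancherel ir (sqint_lty_Re f2).
have Hb := hartley_plancherel ii (sqint_lty_Im f2).
rewrite -/a in Ha; rewrite -/b in Hb.
have f2E := csqintE (conj m1 m2); rewrite -/a -/b in f2E.
have fa : sqint a \is a fin_num by rewrite ge0_fin_numE ?sqint_ge0//; exact: sqint_lty_Re.
have fb : sqint b \is a fin_num by rewrite ge0_fin_numE ?sqint_ge0//; exact: sqint_lty_Im.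
move: key; rewrite GE Ha Hb f2E -(fineK fa) -(fineK fb).
set r := fine _; set s := fine _.
have -> : (((2 * pi) ^- 2)%:E * (((2 * pi) ^+ 2)%:E * r%:E + ((2 * pi) ^+ 2)%:E * s%:E +
    (((2 * pi) ^+ 2)%:E * r%:E + ((2 * pi) ^+ 2)%:E * s%:E)) =
   ((2 * pi) ^- 2 * ((2 * pi) ^+ 2 * r + (2 * pi) ^+ 2 * s +
    ((2 * pi) ^+ 2 * r + (2 * pi) ^+ 2 * s)))%:E)%E by [].
have -> : (r%:E + s%:E = (r + s)%:E)%E by [].
(* An infinite value is excluded: +oo by [key], whose right side is real, and -oo by
   nonnegativity. *)
have := csqint_ge0 (fourier1 f); case: (csqint (fourier1 f)) => [t _ []| _ /eqP| /=]; last 2 first.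
- by rewrite /adde /=.
- by rewrite leNgt ltNy0.
move=> H; congr EFin.
suff : t + t = (r + s) + (r + s) by lra.
by rewrite H -!mulrDr mulKf ?expf_neq0.
Qed.

End ComplexFourier.

(** * The Fourier transform on L^2 *)

Section RieszFischer.
Variable R : realType.
Local Notation line := (measurableTypeR R).
Local Notation plane := (line * line)%type.
Local Notation mu := (leb2 R).
Implicit Types (x v : plane) (b : plane -> R).

Variables (a : nat -> plane -> R) (c : R).
Hypothesis ma : forall n, measurable_fun setT (a n).
Hypothesis ca : forall n m, (n <= m)%N -> (sqint (fun x => a m x - a n x)%R <= (c / 16 ^+ n)%:E)%E.

(** The weight 4^n is a compromise: increments of squared norm c / 16^n leave the convergent series
    of c / 4^n for the integral of [S], while a finite [S x] forces the increments at x to be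
    O(2^-n). *)
Let t n x : \bar R := (4 ^+ n * (a n.+1 x - a n x) ^+ 2)%:E.
Let S x : \bar R := (\sum_(n <oo) t n x)%E.
Let E : set plane := [set x | (S x < +oo)%E].

Let t_ge0 n x : (0 <= t n x)%E.
Proof. by rewrite lee_fin mulr_ge0 ?sqr_ge0// exprn_ge0. Qed.

Let mt n : measurable_fun setT (t n).
Proof.
apply/measurable_EFinP; apply: measurable_funM => //; apply: measurable_funX.
exact: measurable_funB.
Qed.

Let mS : measurable_fun setT S.
Proof.
rewrite /S; apply: (@ge0_emeasurable_sum _ _ _ _ t xpredT) => // n x _ _; exact: t_ge0.
Qed.

Let S_ge0 x : (0 <= S x)%E.
Proof. by apply: nneseries_ge0 => n _ _; exact: t_ge0. Qed.

Let int_S : (\int[mu]_x S x < +oo)%E.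
Proof.
rewrite /S integral_nneseries//.
apply: (@le_lt_trans _ _ (\sum_(n <oo) (`|c| * (1 / 4) ^+ n)%:E)%E).
  apply: lee_nneseries => [n _ _|n _]; first by apply: integral_ge0 => x _; exact: t_ge0.
  rewrite /t; under eq_integral do rewrite EFinM.
  rewrite ge0_integralZl_EFin; last 4 first.
  - exact: measurableT.
  - by move=> x _; rewrite lee_fin sqr_ge0.
  - by apply: measurable_sqE; exact: measurable_funB.
  - exact: exprn_ge0.
  apply: (@le_trans _ _ ((4 ^+ n)%:E * (c / 16 ^+ n)%:E)%E).
    apply: lee_wpmul2l; first by rewrite lee_fin exprn_ge0.
    exact: ca (leqnSn n).
  rewrite -EFinM lee_fin.
  have -> : (16 : R) = 4 * 4 by ring.
  have -> : 4 ^+ n * (c / (4 * 4) ^+ n) = c * (1 / 4) ^+ n.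
    rewrite exprMn expr_div_n expr1n; field.
    by rewrite expf_neq0.
  by rewrite ler_wpM2r ?exprn_ge0 ?divr_ge0// ler_norm.
have -> : (\sum_(n <oo) (`|c| * (1 / 4) ^+ n)%:E)%E = (`|c| / (1 - 1 / 4))%:E.
  apply/cvg_lim => //.
  rewrite (_ : (fun n => _) = EFin \o series (geometric `|c| (1 / 4))).
    apply: cvg_comp; first (apply: cvg_geometric_series; rewrite ger0_norm; lra).
    exact: cvg_id.
  by apply/funext => n; rewrite /= /series /= sumEFin.
exact: ltry.
Qed.

Let mE : measurable E.
Proof.
rewrite (_ : E = S @^-1` `[0%E, +oo%E[%classic).
  by rewrite -[_ @^-1` _]setTI; apply: mS => //; exact: emeasurable_itv.
by apply/seteqP; split=> x /=; rewrite /E /= in_itv/= S_ge0.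
Qed.

(** Setting the sequence to 0 off [E] makes it converge at every point, so that its pointwise limit
    is measurable. *)
Let aE n x : R := a n x * \1_E x.

Let maE n : measurable_fun setT (aE n).
Proof. by apply: measurable_funM. Qed.

Let aeE : {ae mu, forall x, \1_E x = 1 :> R}.
Proof.
have iS : mu.-integrable setT S.
  apply/integrableP; split=> //; under eq_integral do rewrite gee0_abs//.
  exact: int_S.
have := integrable_ae measurableT iS; apply: filterS => x /(_ I) Sf.
by rewrite indicE mem_set//= /E/= -ge0_fin_numE.
Qed.

Let aE_cvg x : cvgn (fun n => aE n x).
Proof.
have [xE|xE] := boolP (x \in E); last first.
  rewrite (_ : (fun n => aE n x) = cst 0); first exact: is_cvg_cst.
  by apply/funext => n; rewrite /aE indicE (negbTE xE) mulr0.
rewrite (_ : (fun n => aE n x) = a ^~ x); last first.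
  by apply/funext => n; rewrite /aE indicE xE mulr1.
have Sx : S x \is a fin_num by rewrite ge0_fin_numE//; move: xE; rewrite inE.
pose s := fine (S x).
have s0 : 0 <= s by exact: fine_ge0.
have dle n : `|a n.+1 x - a n x| <= Num.sqrt s * (1 / 2) ^+ n.
  have tn : 4 ^+ n * (a n.+1 x - a n x) ^+ 2 <= s.
    rewrite -lee_fin /s fineK// -/(t n x).
    have := @nneseries_lim_ge _ (t ^~ x) xpredT 0%N n.+1 (fun (k : nat) _ _ => t_ge0 k x).
    apply: le_trans; rewrite big_nat_recr//= leeDr//; apply: sume_ge0 => k _; exact: t_ge0.
  rewrite -ler_sqr ?nnegrE ?mulr_ge0 ?exprn_ge0 ?sqrtr_ge0 ?divr_ge0//.
  rewrite real_normK ?num_real// exprMn sqr_sqrtr// -exprM mulnC exprM.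
  have -> : (1 / 2 : R) ^+ 2 = 4^-1 by field.
  by rewrite exprVn ler_pdivlMr ?exprn_gt0// mulrC.
have sc : cvgn (series (telescope (a ^~ x))).
  apply: normed_cvg; apply: (series_le_cvg (v_ := geometric (Num.sqrt s) (1 / 2))).
  - by move=> n; exact: normr_ge0.
  - by move=> n /=; rewrite mulr_ge0 ?sqrtr_ge0 ?exprn_ge0// divr_ge0.
  - by move=> n /=; exact: dle.
  - by apply: is_cvg_geometric_series; rewrite ger0_norm; lra.
rewrite (_ : a ^~ x = (fun n => a 0%N x + series (telescope (a ^~ x)) n)).
  by apply: is_cvgD => //; exact: is_cvg_cst.
by apply/funext => n; exact: eq_sum_telescope.
Qed.

Lemma riesz_fischer : exists2 b : plane -> R, measurable_fun setT b &
  forall n, (sqint (fun x => a n x - b x)%R <= (c / 16 ^+ n)%:E)%E.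
Proof.
pose b x : R := limn (fun n => aE n x).
have cb x : aE n x @[n --> \oo] --> b x by exact: aE_cvg.
have mb : measurable_fun setT b.
  by apply: (measurable_fun_cvg maE) => x _; exact: cb.
exists b => // n.
(* The indices k + n stay above n, where the Cauchy bound holds for every k; Fatou's lemma passes it
   to the limit. *)
pose F (k : nat) x : \bar R := ((aE n x - aE (k + n)%N x) ^+ 2)%:E.
have mF k : measurable_fun setT (F k) by apply: measurable_sqE; exact: measurable_funB.
have F0 k x : (0 <= F k x)%E by rewrite lee_fin sqr_ge0.
have -> : sqint (fun x => a n x - b x) = (\int[mu]_x limn_einf (F ^~ x))%E.
  transitivity (sqint (fun x => aE n x - b x)).
    apply: ge0_ae_eq_integral => //.
    - by apply: measurable_sqE; exact: measurable_funB.
    - by apply: measurable_sqE; exact: measurable_funB.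
    - by move=> x _; rewrite lee_fin sqr_ge0.
    - by move=> x _; rewrite lee_fin sqr_ge0.
    - by apply: filterS aeE => x h _; rewrite /aE h mulr1.
  apply: eq_integral => x _; apply/esym.
  have h : F k x @[k --> \oo] --> ((aE n x - b x) ^+ 2)%:E.
    apply: cvg_EFin; first exact: nearW.
    have h1 : (aE n x - aE (k + n)%N x) @[k --> \oo] --> aE n x - b x.
      by apply: cvgB; [exact: cvg_cst|rewrite (cvg_shiftn n (fun k => aE k x)); exact: cb].
    exact: (cvgM h1 h1).
  by case: (cvg_limn_einf_sup h) => -> _.
apply: le_trans (fatou _ measurableT mF (fun k x _ => F0 k x)) _.
rewrite limn_einf_lim; apply: lime_le; first exact: is_cvg_einfs.
apply: nearW => k; rewrite /einfs.
apply: (@le_trans _ _ (\int[mu]_x F k x)%E); first by apply: ereal_inf_lbound; exists k => /=.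
apply: le_trans (ca (leq_addl k n)).
apply: ge0_le_integral; [exact: measurableT| | | |].
- by move=> x _; exact: F0.
- exact: mF.
- by apply: measurable_sqE; exact: measurable_funB.
move=> x _; rewrite /F lee_fin /aE -mulrBl exprMn.
have -> : (a n x - a (k + n)%N x) ^+ 2 = (a (k + n)%N x - a n x) ^+ 2 by ring.
by rewrite indicE; case: (_ \in _); rewrite ?expr1n ?expr0n ?mulr1 ?mulr0 ?sqr_ge0.
Qed.

End RieszFischer.

(** * Isometry of the L^2 transform, and its action on differences *)

Section FourierTransform.
Variable R : realType.
Local Notation line := (measurableTypeR R).
Local Notation plane := (line * line)%type.
Local Notation C := (R[i]).
Local Notation mu := (leb2 R).
Local Notation Re := (@complex.Re R).
Local Notation Im := (@complex.Im R).
Implicit Types (k x v : plane) (f g : plane -> C) (z : C).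

Lemma cmeasurableB f g : cmeasurable setT f -> cmeasurable setT g ->
  cmeasurable setT (fun x => f x - g x).
Proof.
move=> [f1 f2] [g1 g2]; split; (under eq_fun do rewrite raddfB); exact: measurable_funB.
Qed.

Lemma cmeasurableM f g : cmeasurable setT f -> cmeasurable setT g ->
  cmeasurable setT (fun x => f x * g x).
Proof.
move=> [f1 f2] [g1 g2]; split.
  rewrite (_ : (fun x => _) = (fun x => Re (f x) * Re (g x) - Im (f x) * Im (g x))).
    by apply: measurable_funB; exact: measurable_funM.
  by apply/funext => x; case: (f x) (g x) => ? ? [].
rewrite (_ : (fun x => _) = (fun x => Re (f x) * Im (g x) + Im (f x) * Re (g x))).
  by apply: measurable_funD; exact: measurable_funM.
by apply/funext => x; case: (f x) (g x) => ? ? [].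
Qed.

Lemma cmeasurable_shift f v : cmeasurable setT f -> cmeasurable setT (fun x => f (shift v x)).
Proof. by move=> [f1 f2]; split; exact: (measurable_shift_comp (a := fun x => _ (f x))). Qed.

Lemma csqint_shift f v : cmeasurable setT f -> csqint (fun x => f (shift v x)) = csqint f.
Proof.
move=> mf; rewrite /csqint.
rewrite (ge0_integral_preserves (f := fun x => (nsq (f x))%:E) (preserves_shift v))//.
- by apply/measurable_EFinP; exact: measurable_nsq.
- by move=> x; rewrite lee_fin nsq_ge0.
Qed.

Lemma nsqB_le z (w : C) : nsq (z - w) <= 2 * nsq z + 2 * nsq w.
Proof.
have := @nsqD_le _ 1 z (- w) ltr01.
by rewrite invr1 (_ : nsq (- w) = nsq w) //; case: w => p q; rewrite /nsq/=; ring.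
Qed.

Lemma nsqBC z (w : C) : nsq (z - w) = nsq (w - z).
Proof. by case: z w => p q [r s]; rewrite /nsq/=; ring. Qed.

Lemma csqint_leB f g : cmeasurable setT f -> cmeasurable setT g ->
  (csqint (fun x => f x - g x)%R <= 2%:E * csqint f + 2%:E * csqint g)%E.
Proof.
move=> mf mg; apply: csqint_leD => //; first exact: cmeasurableB.
by move=> x; exact: nsqB_le.
Qed.

Lemma csqint_leZ (r : R) f g : cmeasurable setT f -> cmeasurable setT g -> 0 <= r ->
  (forall x, nsq (g x) <= r * nsq (f x)) -> (csqint g <= r%:E * csqint f)%E.
Proof.
move=> mf mg r0 H; have h x : nsq (g x) <= r * nsq (f x) + 0 * nsq (f x) by rewrite mul0r addr0.
by have := csqint_leD mf mf mg r0 (lexx 0) h; rewrite mul0e adde0.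
Qed.

Lemma cvge0_leZ (r : R) (u w : nat -> \bar R) : 0 < r -> (forall n, (0 <= u n)%E) ->
  (forall n, (u n <= r%:E * w n)%E) -> (forall n, (0 <= w n)%E) ->
  (w n @[n --> \oo] --> 0)%E -> (u n @[n --> \oo] --> 0)%E.
Proof.
move=> r0 u0 uw w0 /(cvge0P w0) H; apply/(cvge0P u0) => e e0.
have [N HN] := H (e / r) (divr_gt0 e0 r0); exists N => n Nn.
apply: le_trans (uw n) _.
apply: (@le_trans _ _ (r%:E * (e / r)%:E)%E).
  by apply: lee_wpmul2l; [rewrite lee_fin ltW|exact: HN].
by rewrite -EFinM lee_fin mulrC divfK// gt_eqF.
Qed.

(** Lets Plancherel pass to L^2 limits; exchanging the two sequences gives the reverse inequality.
    Young's inequality with parameter e replaces the triangle inequality of norms. *)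
Lemma csqint_limit_le (u w : nat -> plane -> C) f g :
  (forall n, cmeasurable setT (u n)) -> (forall n, cmeasurable setT (w n)) ->
  cmeasurable setT f -> cmeasurable setT g ->
  (csqint (fun x => u n x - f x)%R @[n --> \oo] --> 0)%E ->
  (csqint (fun x => w n x - g x)%R @[n --> \oo] --> 0)%E ->
  (forall n, csqint (u n) = csqint (w n)) -> (csqint f <= csqint g)%E.
Proof.
move=> mun mwn mf mg cu cw uw.
have [gy|gfin] := eqVneq (csqint g) +oo%E; first by rewrite gy leey.
have gf : csqint g \is a fin_num by rewrite ge0_fin_numE ?csqint_ge0// ltey.
have main (e : R) : 0 < e -> (csqint f <= ((1 + e) * ((1 + e) * fine (csqint g)) + e)%:E)%E.
  move=> e0; have i0 : 0 < e^-1 by rewrite invr_gt0.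
  (* The total coefficient of the two approximation errors, so that errors below e / K cost at most
     e. *)
  pose K : R := (1 + e) * (1 + e^-1) + (1 + e^-1).
  have K0 : 0 < K by rewrite addr_gt0 ?mulr_gt0 ?addr_gt0.
  have d0 : 0 < e / K by exact: divr_gt0.
  have [N1 H1] := (cvge0P (fun n => csqint_ge0 _)).1 cu _ d0.
  have [N2 H2] := (cvge0P (fun n => csqint_ge0 _)).1 cw _ d0.
  pose n := maxn N1 N2.
  have {}H1 := H1 n (leq_maxl _ _); have {}H2 := H2 n (leq_maxr _ _).
  have e1 : 0 <= 1 + e by rewrite addr_ge0// ltW.
  have e2 : 0 <= 1 + e^-1 by rewrite addr_ge0// ltW.
  have A : (csqint f <= (1 + e)%:E * csqint (u n) + (1 + e^-1)%:E * csqint (fun x => u n x - f x)%R)%E.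
    apply: csqint_leD => //; first exact: cmeasurableB.
    by move=> x; rewrite nsqBC -{1}(subrKC (u n x) (f x)); exact: nsqD_le.
  have B : (csqint (w n) <= (1 + e)%:E * csqint g + (1 + e^-1)%:E * csqint (fun x => w n x - g x)%R)%E.
    apply: csqint_leD => //; first exact: cmeasurableB.
    by move=> x; rewrite -{1}(subrKC (g x) (w n x)); exact: nsqD_le.
  have B' : (csqint (w n) <= ((1 + e) * fine (csqint g) + (1 + e^-1) * (e / K))%:E)%E.
    apply: le_trans B _; rewrite [leRHS]EFinD; apply: leeD; first by rewrite EFinM fineK.
    rewrite EFinM.
    by apply: lee_wpmul2l; rewrite ?lee_fin.
  apply: le_trans A _; rewrite uw.
  apply: (@le_trans _ _ ((1 + e)%:E * ((1 + e) * fine (csqint g) + (1 + e^-1) * (e / K))%:E +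
     (1 + e^-1)%:E * (e / K)%:E)%E).
    by apply: leeD; apply: lee_wpmul2l; rewrite ?lee_fin.
  rewrite -!EFinM -EFinD lee_fin.
  have -> : (1 + e) * ((1 + e) * fine (csqint g) + (1 + e^-1) * (e / K)) + (1 + e^-1) * (e / K) =
    (1 + e) * ((1 + e) * fine (csqint g)) + K * (e / K) by rewrite /K; ring.
  by rewrite (mulrC K) divfK// gt_eqF.
have ff : csqint f \is a fin_num.
  by rewrite ge0_fin_numE ?csqint_ge0// (le_lt_trans (main 1 ltr01))// ltry.
rewrite -(fineK gf) -(fineK ff) lee_fin; apply/ler_addgt0Pr => e e0.
set G := fine (csqint g) in main *; set F := fine (csqint f).
have G0 : 0 <= G by rewrite fine_ge0// csqint_ge0.
have D0 : 0 < 3 * G + 1 by rewrite ltr_wpDl ?mulr_ge0.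
(* For d <= 1 one has (1 + d)^2 G + d <= G + d (3 G + 1). *)
pose d := Num.min 1 (e / (3 * G + 1)).
have d0 : 0 < d by rewrite lt_min ltr01 divr_gt0.
have d1 : d <= 1 by rewrite ge_min lexx.
have de : d * (3 * G + 1) <= e by rewrite -ler_pdivlMr// ge_min lexx orbT.
have := main d d0; rewrite -(fineK ff) lee_fin -/F => /le_trans; apply.
have : d * d <= d by rewrite ler_piMr// ltW.
move=> dd; have : d * d * G <= d * G by rewrite ler_wpM2r.
lra.
Qed.

Theorem is_fourier_csqint f g : L2 setT f -> is_fourier f g -> csqint g = csqint f.
Proof.
move=> f2 [g2 [h [h12 /cvg_L2norm cf /cvg_L2norm cg]]].
have [mf _] := f2; have [mg _] := g2.
have mh n : cmeasurable setT (h n) by have [[]] := h12 n.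
have mF n : cmeasurable setT (fourier1 (h n)).
  by apply: cmeasurable_fourier1; have [] := h12 n.
have P n : csqint (fourier1 (h n)) = csqint (h n) by have [] := h12 n; exact: plancherel.
by apply/eqP; rewrite eq_le; apply/andP; split;
  [exact: csqint_limit_le cg cf P|apply: csqint_limit_le cf cg _].
Qed.

Definition tdiff v f x : C := f (shift v x) - f x.

Lemma normcB_le z (w : C) : normc (z - w) <= normc z + normc w.
Proof. by rewrite -(normcN w); exact: le_normcD. Qed.

Lemma L1B f g : L1 f -> L1 g -> L1 (fun x => f x - g x).
Proof.
move=> [mf fi] [mg gi].
split; first exact: cmeasurableB.
have mn := measurable_normc mf; have mns := measurable_normc mg.
apply: (@le_lt_trans _ _ (\int[mu]_x ((normc (f x))%:E + (normc (g x))%:E))%E).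
  apply: ge0_le_integral; [exact: measurableT| | | |].
  - by move=> x _; rewrite lee_fin normc_nneg.
  - by apply/measurable_EFinP; apply: measurable_normc; exact: cmeasurableB.
  - by apply: emeasurable_funD; exact/measurable_EFinP.
  - by move=> x _; rewrite -EFinD lee_fin normcB_le.
rewrite ge0_integralD; last 5 first.
- exact: measurableT.
- by move=> x _; rewrite lee_fin normc_nneg.
- exact/measurable_EFinP.
- by move=> x _; rewrite lee_fin normc_nneg.
- exact/measurable_EFinP.
exact: lte_add_pinfty.
Qed.

Lemma L1_shift v f : L1 f -> L1 (fun x => f (shift v x)).
Proof.
move=> [mf fi]; split; first exact: cmeasurable_shift.
rewrite (ge0_integral_preserves (f := fun x => (normc (f x))%:E) (preserves_shift v))//.
- by apply/measurable_EFinP; exact: measurable_normc.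
- by move=> x; rewrite lee_fin normc_nneg.
Qed.

Lemma L1_tdiff v f : L1 f -> L1 (tdiff v f).
Proof. by move=> f1; exact: L1B (L1_shift v f1) f1. Qed.

Lemma fourier1B f g k : L1 f -> L1 g ->
  fourier1 (fun x => f x - g x) k = fourier1 f k - fourier1 g k.
Proof.
move=> f1 g1; rewrite !fourier1E//; last exact: L1B.
have -> : Re \o (fun x => f x - g x) = (fun x => Re (f x) - Re (g x)).
  by apply/funext => x; rewrite /= raddfB.
have -> : Im \o (fun x => f x - g x) = (fun x => Im (f x) - Im (g x)).
  by apply/funext => x; rewrite /= raddfB.
rewrite (costrB k (L1_Re f1) (L1_Re g1)) (costrB k (L1_Im f1) (L1_Im g1)).
rewrite (sintrB k (L1_Re f1) (L1_Re g1)) (sintrB k (L1_Im f1) (L1_Im g1)).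
rewrite -![_ \o f]/(fun x => _) -![_ \o g]/(fun x => _).
by apply/eqP; rewrite eq_complex /=; apply/andP; split; apply/eqP; ring.
Qed.

Lemma fourier1_shift v f k : L1 f ->
  fourier1 (fun x => f (shift v x)) k = expNi (- dot k v) * fourier1 f k.
Proof.
move=> f1; have ir := L1_Re f1; have ii := L1_Im f1.
rewrite !fourier1E//; last exact: L1_shift.
rewrite -[Re \o _]/(fun x => Re (f (shift v x))) -[Im \o _]/(fun x => Im (f (shift v x))).
rewrite (costr_shift v k ir) (costr_shift v k ii) (sintr_shift v k ir) (sintr_shift v k ii).
rewrite -![_ \o f]/(fun x => _) /expNi cosN sinN.
by apply/eqP; rewrite eq_complex /=; apply/andP; split; apply/eqP; ring.
Qed.

Lemma csqint_tdiff v f : cmeasurable setT f -> (csqint (tdiff v f) <= 4%:E * csqint f)%E.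
Proof.
move=> mf; apply: le_trans (csqint_leB (cmeasurable_shift v mf) mf) _.
rewrite csqint_shift// -ge0_muleDl ?lee_fin// -EFinD.
by have -> : 2 + 2 = 4 :> R by ring.
Qed.

Lemma L2_tdiff v f : L2 setT f -> L2 setT (tdiff v f).
Proof.
move=> /L2_csqint[mf fi]; apply/L2_csqint; split.
  by apply: cmeasurableB => //; exact: cmeasurable_shift.
by apply: le_lt_trans (csqint_tdiff v mf) _; rewrite lte_mul_pinfty.
Qed.

(** Since [expNi (- t)] is exp (i t), this is the multiplier exp (i k.v) - 1 of the difference
    operator [tdiff v]. *)
Definition symb k v : C := expNi (- dot k v) - 1.

Lemma nsq_symb k v : nsq (symb k v) = 2 - 2 * cos (dot k v).
Proof.
rewrite /nsq /symb /= cosN sinN; have := cos2Dsin2 (dot k v).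
set c := cos _; set s := sin _ => h.
have -> : (c - 1) ^+ 2 + (- - s - 0) ^+ 2 = (c ^+ 2 + s ^+ 2) + 1 - 2 * c by ring.
by rewrite h; ring.
Qed.

Lemma nsq_symb_le4 k v : nsq (symb k v) <= 4.
Proof. by rewrite nsq_symb; have := cos_geN1 (dot k v); lra. Qed.

Lemma cmeasurable_symb v : cmeasurable setT (symb^~ v).
Proof.
have E : symb^~ v = fun k => Complex (cos (dot v k) - 1) (sin (dot v k)).
  apply/funext => k; rewrite /symb /expNi (dotC k) cosN sinN opprK.
  by apply/eqP; rewrite eq_complex /= subr0 !eqxx.
rewrite E; split => /=; last exact: measurable_sin_dot.
by apply: measurable_funB => //; exact: measurable_cos_dot.
Qed.

Lemma fourier1_tdiff v f k : L1 f -> fourier1 (tdiff v f) k = symb k v * fourier1 f k.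
Proof.
move=> f1; rewrite /tdiff fourier1B//; last exact: L1_shift.
by rewrite fourier1_shift// /symb mulrBl mul1r.
Qed.

(** Both [tdiff v] and multiplication by [symb] are bounded on L^2, with factor 4 on squared norms,
    so the approximating sequence of [f] can be differenced term by term. *)
Lemma is_fourier_tdiff v f g : L2 setT f -> is_fourier f g ->
  is_fourier (tdiff v f) (fun k => symb k v * g k).
Proof.
move=> f2 [g2 [h [h12 /cvg_L2norm cf /cvg_L2norm cg]]].
have [mf _] := f2; have [mg gi] := (L2_csqint _).1 g2.
have ms := cmeasurable_symb v.
have mh n : cmeasurable setT (h n) by have [[]] := h12 n.
have mF n : cmeasurable setT (fourier1 (h n)).
  by apply: cmeasurable_fourier1; have [] := h12 n.
have symb_le f' : cmeasurable setT f' -> (csqint (fun k => symb k v * f' k)%R <= 4%:E * csqint f')%E.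
  move=> mf'; apply: csqint_leZ => //; first exact: cmeasurableM.
  by move=> k; rewrite nsqM ler_wpM2r ?nsq_ge0// nsq_symb_le4.
split.
  apply/L2_csqint; split; first exact: cmeasurableM.
  by apply: le_lt_trans (symb_le _ mg) _; rewrite lte_mul_pinfty.
exists (fun n => tdiff v (h n)); split.
- by move=> n; have [] := h12 n; split; [exact: L1_tdiff|exact: L2_tdiff].
- apply/cvg_L2norm; apply: (@cvge0_leZ 4) cf => // n; try exact: csqint_ge0.
  rewrite (_ : (fun x => _) = tdiff v (fun x => h n x - f x)); last first.
    by apply/funext => x; rewrite /tdiff; ring.
  by apply: csqint_tdiff; exact: cmeasurableB.
- apply/cvg_L2norm; apply: (@cvge0_leZ 4) cg => // n; try exact: csqint_ge0.
  rewrite (_ : (fun k => _) = (fun k => symb k v * (fourier1 (h n) k - g k))); last first.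
    apply/funext => k; rewrite fourier1_tdiff; last by have [] := h12 n.
    by rewrite mulrBr.
  by apply: symb_le; exact: cmeasurableB.
Qed.

End FourierTransform.

(** * Existence of the Fourier transform on L^2 *)

Section FourierExistence.
Variable R : realType.
Local Notation line := (measurableTypeR R).
Local Notation plane := (line * line)%type.
Local Notation C := (R[i]).
Local Notation mu := (leb2 R).
Local Notation Re := (@complex.Re R).
Local Notation Im := (@complex.Im R).
Implicit Types (k x v : plane) (z : C).
Variable f : plane -> C.
Hypothesis f2 : L2 setT f.

Let mf : cmeasurable setT f. Proof. by have [] := f2. Qed.
Let fi : (csqint f < +oo)%E. Proof. by have /L2_csqint[] := f2. Qed.

Let B (n : nat) : set plane := box n%:R.
(** Truncations to bounded boxes, which lie in L^1 as well as in L^2. *)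
Let h n x : C := Complex (Re (f x) * \1_(B n) x) (Im (f x) * \1_(B n) x).

Let mB n : measurable (B n). Proof. exact: measurable_box. Qed.

Let mh n : cmeasurable setT (h n).
Proof.
by have [m1 m2] := mf; split => /=; apply: measurable_funM => //; exact: measurable_indic.
Qed.

Let hE n x : h n x = if x \in B n then f x else 0.
Proof.
rewrite /h indicE; case: (_ \in _); case: (f x) => p q /=; by rewrite ?mulr1 ?mulr0.
Qed.

Let L2h n : L2 setT (h n).
Proof.
apply/L2_csqint; split => //; apply: le_lt_trans fi.
rewrite -[leRHS]mul1e; apply: csqint_leZ => // x.
by rewrite hE mul1r; case: ifP => // _; rewrite [nsq 0]/nsq/= expr0n addr0 nsq_ge0.
Qed.

Let L1h n : L1 (h n).
Proof.
split => //.
apply: (@le_lt_trans _ _ (\int[mu]_x ((nsq (f x))%:E + (\1_(B n) x)%:E))%E).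
  apply: ge0_le_integral; [exact: measurableT| | | |].
  - by move=> x _; rewrite lee_fin normc_nneg.
  - by apply/measurable_EFinP; exact: measurable_normc.
  - apply: emeasurable_funD; apply/measurable_EFinP; first exact: measurable_nsq.
    exact: measurable_indic.
  - move=> x _; rewrite -EFinD lee_fin hE indicE; case: (_ \in _) => /=.
      (* The bound t <= t^2 + 1 follows from (t - 1/2)^2 >= 0. *)
      rewrite -normc_sqr; set t := normc _; have : 0 <= (t - 2^-1) ^+ 2 by exact: sqr_ge0.
      by rewrite sqrrB; lra.
    by rewrite expr0n /= addr0 sqrtr0 addr0 nsq_ge0.
rewrite ge0_integralD; last 5 first.
- exact: measurableT.
- by move=> x _; rewrite lee_fin nsq_ge0.
- by apply/measurable_EFinP; exact: measurable_nsq.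
- by move=> x _; rewrite lee_fin.
- by apply/measurable_EFinP; exact: measurable_indic.
rewrite integral_indic// setIT; apply: lte_add_pinfty => //; exact: leb2_box.
Qed.

Let inB x : \forall n \near \oo, x \in B n.
Proof.
have : [set: plane] x by [].
rewrite box_cover => -[N _ xN]; exists N => // n /= Nn; rewrite inE.
move: xN; rewrite /B /box /=!in_itv/= => -[/andP[a1 a2] /andP[b1 b2]].
have NnR : N%:R <= n%:R :> R by rewrite ler_nat.
by split; apply/andP; split; lra.
Qed.

Let trunc_cvg (a : plane -> R) : measurable_fun setT a -> (sqint a < +oo)%E ->
  (sqint (fun x => a x * \1_(B n) x - a x)%R @[n --> \oo] --> 0)%E.
Proof.
move=> ma ai; apply: (sqint_dominated (h := fun n x => a x * \1_(B n) x) (g := fun x => `|a x|)).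
- by move=> n; apply: measurable_funM => //; exact: measurable_indic.
- exact: ma.
- exact: measurableT_comp.
- move=> x; apply: cvg_near_cst; apply: filterS (inB x) => n xn.
  by rewrite indicE xn mulr1.
- move=> n x; rewrite normrM ler_piMr// indicE; case: (_ \in _); by rewrite ?normr1 ?normr0.
- by rewrite /sqint; under eq_integral do rewrite real_normK ?num_real//.
Qed.

Let h_cvg : (csqint (fun x => h n x - f x)%R @[n --> \oo] --> 0)%E.
Proof.
have [m1 m2] := mf.
have -> : (fun n => csqint (fun x => h n x - f x)) =
   (fun n => (sqint (fun x => Re (f x) * \1_(B n) x - Re (f x))%R +
             sqint (fun x => Im (f x) * \1_(B n) x - Im (f x))%R)%E).
  apply/funext => n; rewrite csqintE; last exact: cmeasurableB.
  by congr (_ + _)%E; congr sqint; apply/funext => x; rewrite raddfB.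
rewrite -[0%E]adde0; apply: cvgeD => //; apply: trunc_cvg => //.
- exact: sqint_lty_Re.
- exact: sqint_lty_Im.
Qed.

Lemma is_fourier_exists : exists g, is_fourier f g.
Proof.
(* A subsequence with errors 16^-n provides the rate that [riesz_fischer] expects. *)
have ex n : exists m, (csqint (fun x => h m x - f x)%R <= (16 ^- n)%:E)%E.
  have [N HN] := (cvge0P (fun n => csqint_ge0 _)).1 h_cvg (16 ^- n) ltac:(by rewrite invr_gt0 exprn_gt0).
  by exists N; exact: HN.
have [phi Hphi] := choice ex.
pose u n := h (phi n); pose F n := fourier1 (u n).
have mF n : cmeasurable setT (F n) by apply: cmeasurable_fourier1; exact: L1h.
have FF n m : (n <= m)%N -> (csqint (fun x => F m x - F n x)%R <= (4 / 16 ^+ n)%:E)%E.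
  move=> nm.
  have mu_ i : cmeasurable setT (u i) by exact: mh.
  have -> : (fun x => F m x - F n x) = fourier1 (fun x => u m x - u n x).
    by apply/funext => x; rewrite fourier1B//; exact: L1h.
  rewrite plancherel; last 2 first.
  - by apply: L1B; exact: L1h.
  - apply/L2_csqint; split; first exact: cmeasurableB.
    apply: le_lt_trans (csqint_leB (mu_ m) (mu_ n)) _.
    have ufi i : (csqint (u i) < +oo)%E by have [] := (L2_csqint _).1 (L2h (phi i)).
    by apply: lte_add_pinfty; rewrite lte_mul_pinfty.
  have h0 x : nsq (u m x - u n x) <= 2 * nsq (u m x - f x) + 2 * nsq (u n x - f x).
    have -> : u m x - u n x = (u m x - f x) - (u n x - f x) by ring.
    exact: nsqB_le.
  apply: le_trans (csqint_leD (cmeasurableB (mu_ m) mf) (cmeasurableB (mu_ n) mf)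
    (cmeasurableB (mu_ m) (mu_ n)) _ _ h0) _ => //.
  apply: (@le_trans _ _ (2%:E * (16 ^- n)%:E + 2%:E * (16 ^- n)%:E)%E).
    apply: leeD; apply: lee_wpmul2l => //; apply: le_trans (Hphi _) _; rewrite lee_fin//.
    by rewrite lef_pV2 ?posrE ?exprn_gt0// ler_weXn2l// ler1n.
  by rewrite -!EFinM -EFinD lee_fin; lra.
(* Completeness was proved for real functions, so it is applied to the real and imaginary parts in
   turn. *)
have RF (p : C -> R) : (forall n, measurable_fun setT (fun x => p (F n x))) ->
    (forall z (w : C), (p z - p w) ^+ 2 <= nsq (z - w)) ->
    exists2 b : plane -> R, measurable_fun setT b &
      forall n, (sqint (fun x => p (F n x) - b x)%R <= (4 / 16 ^+ n)%:E)%E.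
  move=> mp hp; apply: riesz_fischer => // n m nm; apply: le_trans (FF _ _ nm).
  apply: ge0_le_integral; [exact: measurableT| | | |].
  - by move=> x _; rewrite lee_fin sqr_ge0.
  - by apply: measurable_sqE; exact: measurable_funB.
  - by apply/measurable_EFinP; apply: measurable_nsq; exact: cmeasurableB.
  - by move=> x _; rewrite lee_fin.
have [b1 mb1 H1] : exists2 b : plane -> R, measurable_fun setT b &
      forall n, (sqint (fun x => Re (F n x) - b x)%R <= (4 / 16 ^+ n)%:E)%E.
  apply: RF => [n|z w]; first by have [] := mF n.
  by case: z w => ? ? [? ?]; rewrite /nsq/= lerDl sqr_ge0.
have [b2 mb2 H2] : exists2 b : plane -> R, measurable_fun setT b &
      forall n, (sqint (fun x => Im (F n x) - b x)%R <= (4 / 16 ^+ n)%:E)%E.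
  apply: RF => [n|z w]; first by have [] := mF n.
  by case: z w => ? ? [? ?]; rewrite /nsq/= lerDr sqr_ge0.
pose g x := Complex (b1 x) (b2 x).
have mg : cmeasurable setT g by split.
have Fg n : (csqint (fun x => F n x - g x)%R <= (8 / 16 ^+ n)%:E)%E.
  rewrite csqintE; last exact: cmeasurableB.
  have -> : 8 / 16 ^+ n = 4 / 16 ^+ n + 4 / 16 ^+ n :> R by rewrite -mulrDl; congr (_ / _); ring.
  by rewrite EFinD; apply: leeD;
    [apply: le_trans (H1 n)|apply: le_trans (H2 n)]; rewrite le_eqVlt; apply/orP; left; apply/eqP; congr sqint; apply/funext => x; rewrite raddfB.
have small (r : R) (w : nat -> \bar R) : 0 < r -> (forall n, (0 <= w n)%E) ->
   (forall n, (w n <= (r / 16 ^+ n)%:E)%E) -> (w n @[n --> \oo] --> 0)%E.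
  move=> r0 w0 H; apply: (@squeeze_cvge _ _ _ _ (cst 0%E) _ (fun n => (r / 16 ^+ n)%:E)).
  - by apply: nearW => n; rewrite w0 H.
  - exact: cvg_cst.
  - apply: cvg_EFin; first exact: nearW.
    have := @cvg_geometric R r (1 / 16) ltac:(rewrite ger0_norm; lra).
    by apply: cvg_trans; apply: near_eq_cvg; apply: nearW => n /=; rewrite expr_div_n expr1n mul1r.
exists g; split.
  apply/L2_csqint; split => //.
  have h0 x : nsq (g x) <= 2 * nsq (F 0%N x) + 2 * nsq (F 0%N x - g x).
    have {1}-> : g x = F 0%N x - (F 0%N x - g x) by ring.
    exact: nsqB_le.
  apply: le_lt_trans (csqint_leD (mF 0%N) (cmeasurableB (mF 0%N) mg) mg _ _ h0) _ => //.
  apply: lte_add_pinfty; rewrite lte_mul_pinfty//; rewrite ?csqint_ge0//.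
    by rewrite /F plancherel; [have [] := (L2_csqint _).1 (L2h (phi 0%N))|exact: L1h|exact: L2h].
  by apply: le_lt_trans (Fg 0%N) _; rewrite ltry.
exists u; split.
- by move=> n; split; [exact: L1h|exact: L2h].
- apply/cvg_L2norm; apply: (small 1) => // n; first exact: csqint_ge0.
  by rewrite mul1r; exact: Hphi.
- by apply/cvg_L2norm; apply: (small 8) => // n; exact: csqint_ge0.
Qed.

(** Turns the arbitrary choice made in [fourier] into the relation [is_fourier], on which the
    estimates rest. *)
Lemma fourierP : is_fourier f (fourier f).
Proof. by have [g hg] := is_fourier_exists; exact: (xgetPex _ (ex_intro _ g hg)). Qed.

End FourierExistence.

(** * The dyadic energy and its symbol *)

Section Symbol.
Variable R : realType.
Local Notation line := (measurableTypeR R).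
Local Notation plane := (line * line)%type.
Implicit Types (t q M : R) (k : plane).

Lemma expn_bracket (p : nat) M : (1 < p)%N -> 1 <= M ->
  exists n : nat, p%:R ^+ n <= M /\ M < p%:R ^+ n.+1.
Proof.
move=> p1 M1; have M0 : 0 <= M by apply: le_trans M1.
have m0 : (0 < Num.truncn M)%N by rewrite truncn_gt0.
have /andP[h1 h2] := trunc_log_bounds p1 m0; have /andP[g1 g2] := truncn_itv M0.
exists (trunc_log p (Num.truncn M)); split.
- by apply: le_trans g1; rewrite -natrX ler_nat.
- by apply: lt_le_trans g2 _; rewrite -natrX ler_nat.
Qed.

(** This is |exp (i t) - 1|^2, the squared modulus of the multiplier of a difference. *)
Definition osc t : R := 2 - 2 * cos t.

Lemma osc_ge0 t : 0 <= osc t.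
Proof. by rewrite /osc; have := cos_le1 t; lra. Qed.

Lemma osc_le4 t : osc t <= 4.
Proof. by rewrite /osc; have := cos_geN1 t; lra. Qed.

Lemma oscN t : osc (- t) = osc t.
Proof. by rewrite /osc cosN. Qed.

Lemma sin_norm_le t : `|sin t| <= `|t|.
Proof.
wlog t0 : t / 0 <= t => [H|].
  by have [/H//|/ltW t0] := leP 0 t; rewrite -normrN -sinN -(normrN t) H// oppr_ge0.
have [c _] := @MVT_segment _ sin cos 0 t t0 (fun x _ => is_derive_sin x)
  (continuous_subspaceT (@continuous_sin R)).
by rewrite sin0 !subr0 => ->; rewrite normrM ler_piMl// ler_norml cos_geN1 cos_le1.
Qed.

Lemma osc_le_sqr t : osc t <= t ^+ 2.
Proof.
have -> : osc t = 4 * sin (t / 2) ^+ 2.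
  rewrite /osc {1}(_ : t = (t / 2) *+ 2); last by rewrite mulr2n; lra.
  rewrite cos_mulr2n; have := cos2Dsin2 (t / 2); rewrite mulr2n; lra.
have h : sin (t / 2) ^+ 2 <= (t / 2) ^+ 2.
  rewrite -(real_normK (num_real (sin _))) -[leRHS](real_normK (num_real _)).
  by rewrite ler_sqr ?nnegrE// sin_norm_le.
have -> : t ^+ 2 = 4 * (t / 2) ^+ 2 by field.
lra.
Qed.

(** The witness is [osc 1]: cosine decreases on [0, pi], which contains [1, 2]. *)
Lemma osc_lower : exists2 d, 0 < d & forall t, 1 <= `|t| -> `|t| <= 2 -> d <= osc t.
Proof.
have in_pi (x : R) : 0 <= x -> x <= 2 -> x \in `[0, pi].
  by move=> x0 x2; rewrite in_itv/= x0/=; exact: le_trans (pi_ge2 R).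
exists (osc 1) => [|t t1 t2].
  have : cos 1 < cos 0 :> R by rewrite ltr_cos ?in_pi//; lra.
  by rewrite /osc cos0; lra.
have -> : osc t = osc `|t|.
  by have [//|t0] := ler0P t; rewrite ?oscN.
by rewrite /osc lerD2l lerN2 ler_pM2l// leNgt ltr_cos ?in_pi ?ler1n// -leNgt.
Qed.

Lemma geometric_half (n : nat) : \sum_(i < n) (1 / 2 : R) ^+ i <= 2.
Proof.
have := subrX1 (1 / 2 : R) n; set S := \sum_(_ < _) _ => h.
have : 0 <= (1 / 2 : R) ^+ n by rewrite exprn_ge0.
lra.
Qed.

(** For j <= n the bound osc <= 4 and a geometric sum of ratio q give 8 / (q - 1). For j > n the
    bound osc (t / 2^j) <= t^2 / 4^j makes the ratio q / 4 <= 1 / 2, which gives 4. *)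
Lemma osc_sum_upper q (n N : nat) t : 1 < q -> q <= 2 -> `|t| ^+ 2 < 4 ^+ n.+1 ->
  \sum_(j < N) q ^+ j * osc (t / 2 ^+ j) <= (8 / (q - 1) + 4) * q ^+ n.
Proof.
move=> q1 q2 tn.
have q0 : 0 < q by apply: lt_trans q1.
have q10 : 0 < q - 1 by rewrite subr_gt0.
pose F (j : nat) := q ^+ j * osc (t / 2 ^+ j).
have F0 j : 0 <= F j by rewrite mulr_ge0 ?osc_ge0// exprn_ge0// ltW.
(* Extra nonnegative terms let the sum be split after j = n however small N is. *)
apply: (@le_trans _ _ (\sum_(0 <= j < n.+1 + N) F j)).
  rewrite -(big_mkord xpredT F) [leRHS](@big_cat_nat _ _ _ N)//=; last exact: leq_addl.
  by rewrite lerDl sumr_ge0.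
rewrite (@big_cat_nat _ _ _ n.+1)//=; last exact: leq_addr.
have H1 : \sum_(0 <= j < n.+1) F j <= 8 / (q - 1) * q ^+ n.
  apply: (@le_trans _ _ (4 * \sum_(j < n.+1) q ^+ j)).
    rewrite big_mkord mulr_sumr; apply: ler_sum => j _; rewrite mulrC /F.
    by rewrite [leRHS]mulrC mulrC ler_wpM2l ?osc_le4// exprn_ge0// ltW.
  have := subrX1 q n.+1; set S := \sum_(_ < _) _ => h.
  have -> : S = (q ^+ n.+1 - 1) / (q - 1) by rewrite h (mulrC (q - 1)) mulfK// gt_eqF.
  rewrite mulrA [leRHS]mulrAC ler_wpM2r ?invr_ge0 ?(ltW q10)//.
  have : q * q ^+ n <= 2 * q ^+ n by rewrite ler_wpM2r// exprn_ge0// ltW.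
  by rewrite exprS; lra.
have H2 : \sum_(n.+1 <= j < n.+1 + N) F j <= 4 * q ^+ n.
  rewrite -{1}(add0n n.+1) big_addn addKn.
  apply: (@le_trans _ _ (\sum_(i < N) q ^+ n.+1 * (1 / 2) ^+ i)).
    rewrite big_mkord; apply: ler_sum => i _; rewrite /F.
    apply: (@le_trans _ _ (q ^+ (i + n.+1) * (4 ^+ n.+1 / 4 ^+ (i + n.+1)))).
      apply: ler_wpM2l; first by rewrite exprn_ge0// ltW.
      apply: le_trans (osc_le_sqr _) _.
      rewrite expr_div_n -exprM mulnC exprM.
      have -> : (2 : R) ^+ 2 = 4 by ring.
      rewrite ler_wpM2r ?invr_ge0 ?exprn_ge0//.
      by rewrite -(real_normK (num_real t)) ltW.
    rewrite !exprD [q ^+ i * _]mulrC -mulrA ler_wpM2l ?exprn_ge0 ?(ltW q0)//.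
    rewrite invfM [4 ^+ n.+1 * _]mulrCA mulfV ?expf_neq0// mulr1 -exprVn -exprMn.
    by apply: lerXn2r; rewrite ?nnegrE ?mulr_ge0 ?divr_ge0 ?(ltW q0)//; lra.
  rewrite -mulr_sumr; have := geometric_half N; set S := \sum_(_ < _) _ => h.
  apply: (@le_trans _ _ (q ^+ n.+1 * 2)).
    by rewrite ler_wpM2l// exprn_ge0// ltW.
  have : q * q ^+ n <= 2 * q ^+ n by rewrite ler_wpM2r// exprn_ge0// ltW.
  by rewrite exprS; lra.
by rewrite mulrDl; lra.
Qed.

Variable s : R.
Hypotheses (s0 : 0 < s) (s1 : s < 1 / 2).

(** The ratio 4^s of the weights: s > 0 gives [1 < wq], for the geometric sums, and s < 1/2 gives
    [wq < 2], for the strip estimate. *)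
Definition wq : R := 4 `^ s.

Lemma wqX (n : nat) : wq ^+ n = (4 ^+ n) `^ s.
Proof.
rewrite /wq -powR_mulrn ?powR_ge0// -powRrM mulrC powRrM powR_mulrn//.
Qed.

Lemma wq_gt1 : 1 < wq.
Proof.
have -> : 1 = 1 `^ s :> R by rewrite powR1.
by apply: gt0_ltr_powR; rewrite ?nnegrE//; lra.
Qed.

Lemma wq_lt2 : wq < 2.
Proof.
have -> : 2 = 4 `^ (1 / 2) :> R.
  by rewrite div1r powR12_sqrt// (_ : 4 = 2 ^+ 2 :> R) ?sqrtr_sqr ?ger0_norm//; ring.
have -> : 1 / 2 = s + (1 / 2 - s) by lra.
rewrite powRD; last by rewrite pnatr_eq0 implybT.
rewrite -[ltLHS]mulr1 ltr_pM2l ?powR_gt0//.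
have r0 : 0 < 1 / 2 - s by rewrite subr_gt0.
have := gt0_ltr_powR r0 (_ : 1 \in Num.nneg) (_ : 4 \in Num.nneg) (_ : 1 < 4).
by rewrite powR1; apply; rewrite ?nnegrE// ltr1n.
Qed.

Lemma wqX_ge0 (n : nat) : 0 <= wq ^+ n.
Proof. by rewrite exprn_ge0// powR_ge0. Qed.

(** The Fourier multiplier of the energy truncated to N scales, see [energyE]. *)
Definition symbol_sum (N : nat) k : R :=
  1 + \sum_(j < N) wq ^+ j * (osc (k.1 / 2 ^+ j) + osc (k.2 / 2 ^+ j)).

Lemma symbol_sum_ge1 N k : 1 <= symbol_sum N k.
Proof.
rewrite /symbol_sum lerDl sumr_ge0// => j _.
by apply: mulr_ge0; [exact: wqX_ge0|apply: addr_ge0; exact: osc_ge0].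
Qed.

Lemma symbol_sum_le N N' k : (N <= N')%N -> symbol_sum N k <= symbol_sum N' k.
Proof.
move=> NN; rewrite /symbol_sum lerD2l.
pose F (j : nat) := wq ^+ j * (osc (k.1 / 2 ^+ j) + osc (k.2 / 2 ^+ j)).
rewrite -(big_mkord xpredT F) -[leRHS](big_mkord xpredT F).
rewrite [leRHS](@big_cat_nat _ _ _ N)//= lerDl sumr_ge0// => j _.
by apply: mulr_ge0; [exact: wqX_ge0|apply: addr_ge0; exact: osc_ge0].
Qed.

Lemma dot_ge0 k : 0 <= dot k k.
Proof. by rewrite /dot -!expr2 addr_ge0 ?sqr_ge0. Qed.

(** With 4^n <= 1 + |k|^2 < 4^(n+1) each coordinate contributes O(wq^n), and wq^n <= (1 +
    |k|^2)^s. *)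
Lemma symbol_upper : exists2 c, 0 < c &
  forall N k, symbol_sum N k <= c * (1 + dot k k) `^ s.
Proof.
pose c0 := 8 / (wq - 1) + 4.
have c00 : 0 < c0 by rewrite addr_gt0// divr_gt0// subr_gt0 wq_gt1.
exists (1 + (c0 + c0)) => [|N k]; first by rewrite addr_gt0// addr_gt0.
set M := 1 + dot k k.
have M1 : 1 <= M by rewrite lerDl dot_ge0.
have M0 : 0 <= M by apply: le_trans M1.
have [n [n1 n2]] := @expn_bracket 4 M isT M1.
have qn : wq ^+ n <= M `^ s.
  by rewrite wqX ge0_ler_powR ?nnegrE ?exprn_ge0// ltW.
have q1 : 1 <= M `^ s.
  have {1}-> : 1 = 1 `^ s :> R by rewrite powR1.
  by rewrite ge0_ler_powR ?nnegrE// ltW.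
have ht t : t ^+ 2 <= dot k k -> \sum_(j < N) wq ^+ j * osc (t / 2 ^+ j) <= c0 * wq ^+ n.
  move=> tk; apply: osc_sum_upper; [exact: wq_gt1|exact: ltW wq_lt2|].
  rewrite real_normK ?num_real//; apply: le_lt_trans n2; apply: le_trans tk _.
  by rewrite lerDr.
have h1 := ht k.1 ltac:(by rewrite /dot -!expr2 lerDl sqr_ge0).
have h2 := ht k.2 ltac:(by rewrite /dot -!expr2 lerDr sqr_ge0).
rewrite /symbol_sum; under eq_bigr do rewrite mulrDr.
rewrite big_split/=.
have : c0 * wq ^+ n <= c0 * M `^ s by rewrite ler_wpM2l// ltW.
move=> cq; clearbody c0; rewrite mulrDl mul1r mulrDl; apply: lerD => //.
by apply: lerD; [exact: le_trans h1 cq|exact: le_trans h2 cq].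
Qed.

(** One term suffices: that of the larger coordinate t at the scale n which brings |t| / 2^n into
    [1, 2], where [osc] is bounded below. This scale, hence [N], depends on k. *)
Lemma symbol_lower : exists2 c, 0 < c &
  forall k, exists N, (1 + dot k k) `^ s <= c * symbol_sum N k.
Proof.
have [d d0 hd] := osc_lower.
(* The 12 comes from 1 + |k|^2 <= 3 t^2 <= 12 . 4^n; the summand 1 covers low frequencies, and d^-1
   the lower bound on [osc]. *)
exists (12 * (1 + d^-1)) => [|k]; first by rewrite mulr_gt0// addr_gt0// invr_gt0.
set M := 1 + dot k k.
have M1 : 1 <= M by rewrite lerDl dot_ge0.
have M0 : 0 <= M by apply: le_trans M1.
have di : 0 < d^-1 by rewrite invr_gt0.
have pow12 (A : R) : 0 <= A -> (12 * A) `^ s <= 12 * A `^ s.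
  move=> A0; rewrite powRM// ler_wpM2r ?powR_ge0//.
  by apply: ler1_powR; [rewrite ler1n|apply: le_trans (ltW s1) _; lra].
have big t : 1 <= `|t| -> dot k k <= 2 * t ^+ 2 ->
    (forall N : nat, \sum_(j < N) wq ^+ j * osc (t / 2 ^+ j) <= symbol_sum N k) ->
    exists N, M `^ s <= 12 * (1 + d^-1) * symbol_sum N k.
  move=> t1 tk hsum; have [n [n1 n2]] := @expn_bracket 2 `|t| isT t1.
  exists n.+1.
  have p0 : (0 : R) < 2 ^+ n by rewrite exprn_gt0.
  have tn : d <= osc (t / 2 ^+ n).
    apply: hd; rewrite normrM normfV (ger0_norm (ltW p0)).
      by rewrite ler_pdivlMr// mul1r.
    by rewrite ler_pdivrMr// -exprS ltW.
  have t4 : t ^+ 2 <= 4 * 4 ^+ n.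
    rewrite -(real_normK (num_real t)).
    have -> : 4 * 4 ^+ n = (2 ^+ n.+1) ^+ 2 :> R.
      by rewrite -exprM mulnC exprM -exprS; congr (_ ^+ _); ring.
    by rewrite ler_sqr ?nnegrE// ?exprn_ge0// ltW.
  have t1' : 1 <= t ^+ 2 by rewrite -(real_normK (num_real t)) expr_ge1.
  have MA : M <= 12 * 4 ^+ n by rewrite /M; lra.
  apply: (@le_trans _ _ (12 * wq ^+ n)).
    rewrite wqX; apply: le_trans (pow12 _ _); last exact: exprn_ge0.
    by apply: ge0_ler_powR; rewrite ?nnegrE ?(ltW s0)// mulr_ge0// exprn_ge0.
  rewrite -mulrA ler_wpM2l//.
  have := hsum n.+1; rewrite big_ord_recr /= => hh.
  have S0 : 0 <= \sum_(j < n) wq ^+ j * osc (t / 2 ^+ j).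
    by apply: sumr_ge0 => j _; rewrite mulr_ge0 ?osc_ge0 ?wqX_ge0.
  have q0 := wqX_ge0 n.
  have : wq ^+ n * d <= symbol_sum n.+1 k.
    apply: le_trans hh; apply: le_trans (_ : wq ^+ n * osc (t / 2 ^+ n) <= _).
      by rewrite ler_wpM2l.
    by rewrite lerDr.
  rewrite -ler_pdivlMr// => hq.
  have := symbol_sum_ge1 n.+1 k => hs.
  rewrite mulrDl mul1r [d^-1 * _]mulrC; lra.
have sumle (i : bool) (N : nat) : \sum_(j < N) wq ^+ j * osc ((if i then k.1 else k.2) / 2 ^+ j) <= symbol_sum N k.
  rewrite /symbol_sum; apply: (@le_trans _ _ (\sum_(j < N) wq ^+ j * (osc (k.1 / 2 ^+ j) + osc (k.2 / 2 ^+ j)))).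
    apply: ler_sum => j _; rewrite ler_wpM2l ?wqX_ge0//.
    by case: i; rewrite ?lerDl ?lerDr osc_ge0.
  by rewrite lerDr.
have dk : dot k k = k.1 ^+ 2 + k.2 ^+ 2 by rewrite /dot !expr2.
(* Below the threshold the constant term 1 of the symbol is enough; above it the larger coordinate
   is at least 1 in absolute value. *)
have [h1|h1] := leP 2 (dot k k); last first.
  exists 0%N; apply: (@le_trans _ _ (12 * 1)).
    apply: (@le_trans _ _ ((12 * 1) `^ s)).
      by apply: ge0_ler_powR; rewrite ?nnegrE ?(ltW s0)//; rewrite /M; lra.
    by apply: le_trans (pow12 1 ler01) _; rewrite powR1.
  rewrite /symbol_sum big_ord0 addr0 mulr1 mulr1; lra.
have sq1 t : 1 <= t ^+ 2 -> 1 <= `|t|.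
  by rewrite -(real_normK (num_real t)) expr_ge1.
have [h2|/ltW h2] := leP (k.2 ^+ 2) (k.1 ^+ 2).
- by apply: (big k.1); [apply: sq1; lra|lra|exact: (sumle true)].
- by apply: (big k.2); [apply: sq1; lra|lra|exact: (sumle false)].
Qed.

End Symbol.

(** * Comparison of the energy with the norm of H^s *)

Section DyadicEnergy.
Variable R : realType.
Local Notation line := (measurableTypeR R).
Local Notation plane := (line * line)%type.
Local Notation C := (R[i]).
Local Notation mu := (leb2 R).
Implicit Types (k x v : plane) (f g : plane -> C).
Variable s : R.

Definition dyad1 (j : nat) : plane := ((2 ^+ j)^-1, 0).
Definition dyad2 (j : nat) : plane := (0, (2 ^+ j)^-1).

Definition energy (N : nat) f : \bar R :=
  (csqint f + \sum_(j < N) (wq s ^+ j)%:E *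
     (csqint (tdiff (dyad1 j) f) + csqint (tdiff (dyad2 j) f)))%E.

(** The square of [Hs_norm], which spares square roots until the end. *)
Definition Hs_sq f : \bar R :=
  csqint (fun k => Complex ((1 + dot k k) `^ (s / 2)) 0 * fourier f k).

Lemma Hs_sqE f : (Hs_norm s f = Hs_sq f `^ 2^-1)%E.
Proof. exact: L2normE. Qed.

Lemma nsq_weight k (z : C) :
  nsq (Complex ((1 + dot k k) `^ (s / 2)) 0 * z) = (1 + dot k k) `^ s * nsq z.
Proof.
rewrite nsqM; congr (_ * _); rewrite /nsq /= expr0n addr0.
by rewrite -powR_mulrn ?powR_ge0// -powRrM; congr (_ `^ _); field.
Qed.

Lemma measurable_coord : measurable_fun setT (fun k => k.1 : R) /\ measurable_fun setT (fun k => k.2 : R).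
Proof. by split; [exact: measurable_fst|exact: measurable_snd]. Qed.

Lemma measurable_osc (a : plane -> R) : measurable_fun setT a -> measurable_fun setT (fun k => osc (a k)).
Proof.
move=> ma; apply: measurable_funB => //; apply: measurable_funM => //.
apply: (measurableT_comp (f := cos)) ma; apply: continuous_measurable_fun; exact: continuous_cos.
Qed.

Lemma measurable_symbol_sum N : measurable_fun setT (symbol_sum s N).
Proof.
have [m1 m2] := measurable_coord.
apply: measurable_funD => //; apply: measurable_sum => j; apply: measurable_funM => //.
by apply: measurable_funD; apply: measurable_osc; apply: measurable_funM.
Qed.

Lemma measurable_weight (r : R) : measurable_fun setT (fun k => (1 + dot k k) `^ r).
Proof.
have [m1 m2] := measurable_coord.
apply: (measurableT_comp (measurable_powR r)); apply: measurable_funD => //.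
by apply: measurable_funD; apply: measurable_funM.
Qed.

Lemma csqint_tdiff_fourier v f g : L2 setT f -> is_fourier f g ->
  csqint (tdiff v f) = (\int[mu]_k (osc (dot k v) * nsq (g k))%:E)%E.
Proof.
move=> f2 fg; rewrite -(is_fourier_csqint (L2_tdiff v f2) (is_fourier_tdiff v f2 fg)).
by apply: eq_integral => k _; rewrite nsqM nsq_symb.
Qed.

Lemma measurable_weightM (w : plane -> R) g : measurable_fun setT w -> cmeasurable setT g ->
  measurable_fun setT (fun k => (w k * nsq (g k))%:E).
Proof.
by move=> mw mg; apply/measurable_EFinP; apply: measurable_funM => //; exact: measurable_nsq.
Qed.

Lemma integral_weightD (w w' : plane -> R) (r : R) g : measurable_fun setT w -> measurable_fun setT w' ->
  (forall k, 0 <= w k) -> (forall k, 0 <= w' k) -> 0 <= r -> cmeasurable setT g ->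
  (\int[mu]_k ((w k + r * w' k) * nsq (g k))%:E =
   \int[mu]_k (w k * nsq (g k))%:E + r%:E * \int[mu]_k (w' k * nsq (g k))%:E)%E.
Proof.
move=> mw mw' w0 w0' r0 mg.
rewrite -ge0_integralZl_EFin; last 4 first.
- exact: measurableT.
- by move=> k _; rewrite lee_fin mulr_ge0 ?nsq_ge0.
- exact: measurable_weightM.
- exact: r0.
rewrite -ge0_integralD; last 5 first.
- exact: measurableT.
- by move=> k _; rewrite lee_fin mulr_ge0 ?nsq_ge0.
- exact: measurable_weightM.
- by move=> k _; rewrite -EFinM lee_fin mulr_ge0 ?mulr_ge0 ?nsq_ge0.
- by apply: measurable_funeM; exact: measurable_weightM.
by apply: eq_integral => k _; rewrite -EFinM -EFinD mulrDl mulrA.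
Qed.

Lemma energyE N f g : L2 setT f -> is_fourier f g ->
  energy N f = (\int[mu]_k (symbol_sum s N k * nsq (g k))%:E)%E.
Proof.
move=> f2 fg; have [mg _] : L2 setT g by have [] := fg.
have [m1 m2] := measurable_coord.
have symb0 N' k : 0 <= symbol_sum s N' k by apply: le_trans (symbol_sum_ge1 _ _ _).
elim: N => [|N IH].
  rewrite /energy big_ord0 adde0 -(is_fourier_csqint f2 fg); apply: eq_integral => k _.
  by rewrite /symbol_sum big_ord0 addr0 mul1r.
have -> : energy N.+1 f = (energy N f + (wq s ^+ N)%:E *
   (csqint (tdiff (dyad1 N) f) + csqint (tdiff (dyad2 N) f)))%E.
  by rewrite /energy big_ord_recr /= addeA.
rewrite IH !(csqint_tdiff_fourier _ f2 fg).
have mo v : measurable_fun setT (fun k => osc (dot k v)).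
  by apply: measurable_osc; under eq_fun do rewrite dotC; exact: measurable_dot1.
have mo2 : measurable_fun setT (fun k => osc (dot k (dyad1 N)) + 1 * osc (dot k (dyad2 N))).
  by apply: measurable_funD => //; exact: measurable_funM.
have ow k : 0 <= osc (dot k (dyad1 N)) + 1 * osc (dot k (dyad2 N)).
  by rewrite mul1r addr_ge0 ?osc_ge0.
rewrite -[X in (_ * (_ + X))%E]mul1e -integral_weightD//; last 2 first.
- by move=> k; exact: osc_ge0.
- by move=> k; exact: osc_ge0.
rewrite -(integral_weightD (measurable_symbol_sum N) mo2 (symb0 N) ow (wqX_ge0 s N) mg).
apply: eq_integral => k _; rewrite /symbol_sum big_ord_recr /= mul1r.
have -> : dot k (dyad1 N) = k.1 / 2 ^+ N by rewrite /dot /= mulr0 addr0.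
have -> : dot k (dyad2 N) = k.2 / 2 ^+ N by rewrite /dot /= mulr0 add0r.
by congr (_ * _)%:E; rewrite -addrA.
Qed.

Lemma Hs_sq_weight f : Hs_sq f = (\int[mu]_k ((1 + dot k k) `^ s * nsq (fourier f k))%:E)%E.
Proof. by apply: eq_integral => k _; rewrite nsq_weight. Qed.

Hypotheses (s0 : 0 < s) (s1 : s < 1 / 2).

Lemma energy_le : exists2 c, 0 < c & forall N f, L2 setT f -> (energy N f <= c%:E * Hs_sq f)%E.
Proof.
have [c c0 H] := symbol_upper s0 s1; exists c => // N f f2.
have fg := fourierP f2; have [mg _] : L2 setT (fourier f) by have [] := fg.
rewrite (energyE N f2 fg) Hs_sq_weight -ge0_integralZl_EFin; last 4 first.
- exact: measurableT.
- by move=> k _; rewrite lee_fin mulr_ge0 ?nsq_ge0 ?powR_ge0.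
- by apply: measurable_weightM => //; exact: measurable_weight.
- exact: ltW.
apply: ge0_le_integral; [exact: measurableT| | | |].
- move=> k _; rewrite lee_fin mulr_ge0 ?nsq_ge0//; exact: le_trans (symbol_sum_ge1 _ _ _).
- by apply: measurable_weightM => //; exact: measurable_symbol_sum.
- by apply: measurable_funeM; apply: measurable_weightM => //; exact: measurable_weight.
- by move=> k _; rewrite -EFinM lee_fin mulrA ler_wpM2r ?nsq_ge0.
Qed.

(** The symbols increase with N, so monotone convergence bounds the integral of their limit by B.
    Passing to the limit absorbs the dependence of N on k in [symbol_lower]. *)
Lemma le_energy : exists2 c, 0 < c & forall f (B : \bar R), L2 setT f ->
  (forall N, energy N f <= B)%E -> (Hs_sq f <= c%:E * B)%E.
Proof.
have [c c0 H] := symbol_lower s0 s1; exists c => // f B f2 HB.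
have fg := fourierP f2; have [mg _] : L2 setT (fourier f) by have [] := fg.
pose F (N : nat) k : \bar R := (symbol_sum s N k * nsq (fourier f k))%:E.
have F0 N k : (0 <= F N k)%E.
  rewrite lee_fin mulr_ge0 ?nsq_ge0//; exact: le_trans (symbol_sum_ge1 _ _ _).
have mF N : measurable_fun setT (F N).
  by apply: measurable_weightM => //; exact: measurable_symbol_sum.
have ndF k : {homo F^~ k : n m / (n <= m)%N >-> (n <= m)%E}.
  by move=> n m nm; rewrite lee_fin ler_wpM2r ?nsq_ge0// symbol_sum_le.
have cF k : cvgn (F^~ k) by exact: ereal_nondecreasing_is_cvgn.
pose G k := limn (F^~ k).
have G0 k : (0 <= G k)%E by apply: lime_ge => //; apply: nearW => n; exact: F0.
have mG : measurable_fun setT G by apply: (emeasurable_fun_cvg F) => // k _; exact: cF.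
have intG : (\int[mu]_k G k <= B)%E.
  have h := @cvg_monotone_convergence _ _ _ mu _ measurableT _ mF (fun n k _ => F0 n k) (fun k _ => ndF k).
  have <- := cvg_lim (@ereal_hausdorff R) h.
  apply: lime_le; first by apply/cvg_ex; eexists; exact: h.
  by apply: nearW => N; rewrite -(energyE N f2 fg).
apply: (@le_trans _ _ (c%:E * \int[mu]_k G k)%E); last by rewrite lee_wpmul2l// lee_fin ltW.
rewrite Hs_sq_weight -ge0_integralZl_EFin; last 4 first.
- exact: measurableT.
- by move=> k _; exact: G0.
- exact: mG.
- exact: ltW.
apply: ge0_le_integral; [exact: measurableT| | | |].
- by move=> k _; rewrite lee_fin mulr_ge0 ?nsq_ge0 ?powR_ge0.
- by apply: measurable_weightM => //; exact: measurable_weight.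
- exact: measurable_funeM.
- move=> k _; have [N HN] := H k.
  apply: (@le_trans _ _ (c%:E * F N k)%E).
    by rewrite -EFinM lee_fin mulrA ler_wpM2r ?nsq_ge0.
  apply: lee_wpmul2l; first by rewrite lee_fin ltW.
  by apply: lime_ge => //; exists N => // n /= Nn; exact: ndF.
Qed.

End DyadicEnergy.

(** * Cutting off to the quadrant *)

Section Hardy.
Variable R : realType.
Local Notation line := (measurableTypeR R).
Local Notation plane := (line * line)%type.
Local Notation C := (R[i]).
Local Notation mu := (leb2 R).
Local Notation Q := (@quadrant R).
Implicit Types (x v : plane) (f g : plane -> C).

(** With A the sum on the left and D that on the right, weighting the recursion by q^(j+1) and
    summing gives A <= F + q rho A + kappa D; the finite sum A is absorbed because q rho < 1. *)
Lemma geometric_recursion (q rho kappa F : R) (al de : nat -> R) (N : nat) :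
  0 <= q -> 0 <= rho -> q * rho < 1 -> 0 <= kappa ->
  (forall j, 0 <= al j) -> (forall j, 0 <= de j) -> al 0%N <= F ->
  (forall j, al j.+1 <= rho * al j + kappa * de j.+1) ->
  \sum_(j < N) q ^+ j * al j <= (F + kappa * \sum_(j < N) q ^+ j * de j) / (1 - q * rho).
Proof.
move=> q0 rho0 qr k0 al0 de0 alF rec.
have r0 : 0 < 1 - q * rho by rewrite subr_gt0.
have F0 : 0 <= F by exact: le_trans alF.
case: N => [|N]; first by rewrite !big_ord0 mulr0 addr0 divr_ge0// ltW.
rewrite ler_pdivlMr// mulrBr mulr1 lerBlDr.
have AN : \sum_(j < N) q ^+ j * al j <= \sum_(j < N.+1) q ^+ j * al j.
  by rewrite big_ord_recr /= lerDl mulr_ge0// exprn_ge0.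
apply: (@le_trans _ _ (F + (q * rho * (\sum_(j < N) q ^+ j * al j) +
    kappa * \sum_(j < N) q ^+ j.+1 * de j.+1))); last first.
  rewrite -addrA lerD2l [leRHS]addrC; apply: lerD.
    rewrite [leRHS]mulrC.
    by apply: ler_wpM2l => //; exact: mulr_ge0.
  by apply: ler_wpM2l => //; rewrite [leRHS]big_ord_recl /= lerDr mulr_ge0// exprn_ge0.
rewrite big_ord_recl /= expr0 mul1r; apply: lerD => //.
rewrite !mulr_sumr -big_split /=; apply: ler_sum => j _.
apply: (@le_trans _ _ (q ^+ j.+1 * (rho * al j + kappa * de j.+1))).
  by rewrite ler_wpM2l// exprn_ge0.
by rewrite exprS le_eqVlt; apply/orP; left; apply/eqP; ring.
Qed.

Lemma measurable_quadrant : measurable Q.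
Proof.
rewrite (_ : Q = (fst @^-1` `]0, +oo[%classic) `&` (snd @^-1` `]0, +oo[%classic)).
  apply: measurableI; rewrite -[_ @^-1` _]setTI.
    by apply: measurable_fst => //; exact: measurable_itv.
  by apply: measurable_snd => //; exact: measurable_itv.
by apply/seteqP; split=> x /=; rewrite /Q /= !in_itv/= !andbT.
Qed.

Lemma zero_extE f x : zero_ext f x = if x \in Q then f x else 0.
Proof. by []. Qed.

Lemma nsq0 : nsq (0 : C) = 0.
Proof. by rewrite /nsq /= expr0n addr0. Qed.

Lemma cmeasurable_zero_ext f : cmeasurable Q f -> cmeasurable setT (zero_ext f).
Proof.
move=> [m1 m2]; split.
  rewrite (_ : (fun x => _) = (fun x => complex.Re (f x)) \_ Q).
    by apply/(measurable_restrictT _ measurable_quadrant).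
  by apply/funext => x; rewrite zero_extE /patch; case: ifP.
rewrite (_ : (fun x => _) = (fun x => complex.Im (f x)) \_ Q).
  by apply/(measurable_restrictT _ measurable_quadrant).
by apply/funext => x; rewrite zero_extE /patch; case: ifP.
Qed.

Lemma L2_zero_ext f : L2 Q f -> L2 setT (zero_ext f).
Proof.
move=> [mf fi]; apply/L2_csqint; split; first exact: cmeasurable_zero_ext.
apply: le_lt_trans fi; rewrite le_eqVlt; apply/orP; left; apply/eqP.
rewrite [RHS]integral_mkcond; apply: eq_integral => x _.
rewrite zero_extE /patch; case: ifP => _; by rewrite ?normc_sqr// nsq0.
Qed.

Lemma cmeasurable_sub (D : set plane) f : measurable D -> cmeasurable setT f -> cmeasurable D f.
Proof. by move=> mD [m1 m2]; split; apply: (measurable_funS measurableT). Qed.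

Lemma L2_quadrant f : L2 setT f -> L2 Q f.
Proof.
move=> [mf fi]; split; first by apply: cmeasurable_sub => //; exact: measurable_quadrant.
apply: le_lt_trans fi; apply: ge0_subset_integral => //; first exact: measurable_quadrant.
  by apply/measurable_EFinP; apply: measurable_funX; exact: measurable_normc.
by move=> x _; rewrite lee_fin sqr_ge0.
Qed.

Lemma csqint_zero_ext f : cmeasurable setT f -> (csqint (zero_ext f) <= csqint f)%E.
Proof.
move=> mf; rewrite -[leRHS]mul1e; apply: csqint_leZ => //.
  by apply: cmeasurable_zero_ext; apply: cmeasurable_sub => //; exact: measurable_quadrant.
by move=> x; rewrite mul1r zero_extE; case: ifP => _//; rewrite nsq0 nsq_ge0.
Qed.

(** One argument for both directions: [c] is a coordinate and [v j] the translation by 2^-j along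
    it. [Qnc] says that a translation enters Q only across the face c = 0. *)
Variables (v : nat -> plane) (c : plane -> R).
Hypothesis mc : measurable_fun setT c.
Hypothesis cv : forall j x, c (shift (v j) x) = c x + (2 ^+ j)^-1.
Hypothesis Qv : forall j x, Q x -> Q (shift (v j) x).
Hypothesis Qc : forall x, Q x -> 0 < c x.
Hypothesis Qnc : forall j x, ~ Q x -> Q (shift (v j) x) -> c x <= 0.

Definition strip (j : nat) : set plane := [set x | Q x /\ c x <= (2 ^+ j)^-1].

Lemma measurable_strip j : measurable (strip j).
Proof.
rewrite (_ : strip j = Q `&` (c @^-1` `]-oo, (2 ^+ j)^-1]%classic)).
  apply: measurableI; first exact: measurable_quadrant.
  by rewrite -[_ @^-1` _]setTI; apply: mc => //; exact: measurable_itv.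
by apply/seteqP; split=> x /=; rewrite /strip /= in_itv/=.
Qed.

Definition csqint_on (A : set plane) f : \bar R := (\int[mu]_x (\1_A x * nsq (f x))%:E)%E.

Section FixedFunction.
Variable f : plane -> C.
Hypothesis f2 : L2 setT f.
Let mf : cmeasurable setT f. Proof. by have [] := f2. Qed.
Let fi : (csqint f < +oo)%E. Proof. by have /L2_csqint[] := f2. Qed.

Local Notation J A := (csqint_on A f).

Lemma csqint_on_ge0 A : (0 <= J A)%E.
Proof. by apply: integral_ge0 => x _; rewrite lee_fin mulr_ge0 ?nsq_ge0. Qed.

Let mJ A : measurable A -> measurable_fun setT (fun x => (\1_A x * nsq (f x))%:E).
Proof. by move=> mA; apply: measurable_weightM => //; exact: measurable_indic. Qed.

Lemma csqint_on_le A : measurable A -> (J A <= csqint f)%E.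
Proof.
move=> mA; apply: ge0_le_integral; [exact: measurableT| | | |].
- by move=> x _; rewrite lee_fin mulr_ge0 ?nsq_ge0.
- exact: mJ.
- by apply/measurable_EFinP; exact: measurable_nsq.
- by move=> x _; rewrite lee_fin ler_piMl ?nsq_ge0// indicE; case: (_ \in _).
Qed.

Lemma csqint_on_fin A : measurable A -> J A \is a fin_num.
Proof. by move=> mA; rewrite ge0_fin_numE ?csqint_on_ge0// (le_lt_trans (csqint_on_le mA)). Qed.

Let J_shift w A : measurable A ->
  (\int[mu]_x (\1_A (shift w x) * nsq (f (shift w x)))%:E)%E = J A.
Proof.
move=> mA; rewrite (ge0_integral_preserves (f := fun x => (\1_A x * nsq (f x))%:E) (preserves_shift w))//.
  exact: mJ.
by move=> x; rewrite lee_fin mulr_ge0 ?nsq_ge0.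
Qed.

Let mshift w A : measurable A -> measurable_fun setT (fun x => (\1_A (shift w x) * nsq (f (shift w x)))%:E).
Proof. by move=> mA; exact: (measurableT_comp (mJ mA) (measurable_shift w)). Qed.

Let mtd j : cmeasurable setT (tdiff (v j) f).
Proof. by apply: cmeasurableB => //; exact: cmeasurable_shift. Qed.

Let dfin j : csqint (tdiff (v j) f) \is a fin_num.
Proof. by rewrite ge0_fin_numE ?csqint_ge0//; have /L2_csqint[] := L2_tdiff (v j) f2. Qed.

Let S_sub j : strip j.+1 `<=` strip j.
Proof.
move=> x [Qx cx]; split => //; apply: le_trans cx _.
by rewrite lef_pV2 ?posrE ?exprn_gt0// ler_weXn2l// ler1n.
Qed.

(** Landing in the difference of two strips, not just in the larger one, is the gain: the mass there
    is a_j - a_(j+1), and moving (1 + e) a_(j+1) to the left raises its coefficient from 1 to 2 + e.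
    The recursion thus has a ratio close to 1/2. *)
Lemma strip_recursion (e : R) j : 0 < e ->
  (2 + e) * fine (J (strip j.+1)) <= (1 + e) * fine (J (strip j)) + (1 + e^-1) * fine (csqint (tdiff (v j.+1) f)).
Proof.
move=> e0; pose T := strip j `\` strip j.+1.
have mS := measurable_strip.
have mT : measurable T by exact: measurableD.
have JT : J (strip j) = (J T + J (strip j.+1))%E.
  rewrite /csqint_on -ge0_integralD; last 5 first.
  - exact: measurableT.
  - by move=> x _; rewrite lee_fin mulr_ge0 ?nsq_ge0.
  - exact: mJ.
  - by move=> x _; rewrite lee_fin mulr_ge0 ?nsq_ge0.
  - exact: mJ.
  apply: eq_integral => x _; rewrite -EFinD -mulrDl; congr (_ * _)%:E.
  rewrite !indicE /T in_setD; have := @S_sub j x.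
  case: (boolP (x \in strip j)) => h1; case: (boolP (x \in strip j.+1)) => h2 //= h3; rewrite ?addr0 ?add0r//.
  by move: h1; rewrite notin_setE => h1; exfalso; apply/h1/h3; rewrite -inE.
have e1 : 0 <= 1 + e by rewrite addr_ge0// ltW.
have e2 : 0 <= 1 + e^-1 by rewrite addr_ge0// invr_ge0 ltW.
have main : (J (strip j.+1) <= (1 + e)%:E * J T + (1 + e^-1)%:E * csqint (tdiff (v j.+1) f))%E.
  rewrite -(J_shift (v j.+1) mT) /csqint.
  rewrite -ge0_integralZl_EFin; last 4 first.
  - exact: measurableT.
  - by move=> x _; rewrite lee_fin mulr_ge0 ?nsq_ge0.
  - exact: mshift.
  - exact: e1.
  rewrite -ge0_integralZl_EFin; last 4 first.
  - exact: measurableT.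
  - by move=> x _; rewrite lee_fin nsq_ge0.
  - by apply/measurable_EFinP; exact: measurable_nsq.
  - exact: e2.
  rewrite -ge0_integralD; last 5 first.
  - exact: measurableT.
  - by move=> x _; rewrite -EFinM lee_fin mulr_ge0// mulr_ge0 ?nsq_ge0.
  - by apply: measurable_funeM; exact: mshift.
  - by move=> x _; rewrite -EFinM lee_fin mulr_ge0// nsq_ge0.
  - by apply: measurable_funeM; apply/measurable_EFinP; exact: measurable_nsq.
  apply: ge0_le_integral; [exact: measurableT| | | |].
  - by move=> x _; rewrite lee_fin mulr_ge0 ?nsq_ge0.
  - exact: mJ.
  - apply: emeasurable_funD; apply: measurable_funeM; first exact: mshift.
    by apply/measurable_EFinP; exact: measurable_nsq.
  move=> x _; rewrite -!EFinM -EFinD lee_fin.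
  have td0 : 0 <= (1 + e^-1) * nsq (tdiff (v j.+1) f x) by rewrite mulr_ge0 ?nsq_ge0.
  rewrite {1}indicE; have [xS|xS] := boolP (x \in strip j.+1); last first.
    by rewrite mul0r addr_ge0// mulr_ge0// mulr_ge0 ?nsq_ge0.
  rewrite mul1r; move: xS; rewrite inE => -[Qx cx].
  (* the translation maps [strip j.+1] into its complement in [strip j] *)
  have xT : T (shift (v j.+1) x).
    have c0 := Qc Qx.
    have half : (2 ^+ j)^-1 = (2 ^+ j.+1)^-1 + (2 ^+ j.+1)^-1 :> R.
      by rewrite exprS invfM; set r := (_ ^+ _)^-1; field.
    split; first by split; [exact: Qv|rewrite cv half; lra].
    by move=> [_]; rewrite cv; lra.
  rewrite indicE mem_set// mul1r.
  have {1}-> : f x = f (shift (v j.+1) x) + - tdiff (v j.+1) f x by rewrite /tdiff; ring.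
  have -> : nsq (tdiff (v j.+1) f x) = nsq (- tdiff (v j.+1) f x).
    by rewrite -[in LHS](subr0 (tdiff _ _ _)) nsqBC sub0r.
  exact: nsqD_le.
have h1 := csqint_on_fin (mS j); have h2 := csqint_on_fin (mS j.+1); have h3 := csqint_on_fin mT; have h4 := dfin j.+1.
have {}main : fine (J (strip j.+1)) <= (1 + e) * fine (J T) + (1 + e^-1) * fine (csqint (tdiff (v j.+1) f)).
  by rewrite -lee_fin (fineK h2) [leRHS]EFinD EFinM (fineK h3) EFinM (fineK h4).
have : fine (J (strip j)) = fine (J T) + fine (J (strip j.+1)) by rewrite JT fineD.
by move=> ->; lra.
Qed.

(** If x is in Q, so is its translate, and the difference is unchanged. If only the translate is in
    Q, it has crossed the face and is within 2^-j of it, hence in the strip. *)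
Lemma tdiff_zero_ext_le j :
  (csqint (tdiff (v j) (zero_ext f)) <= csqint (tdiff (v j) f) + J (strip j))%E.
Proof.
have mS := measurable_strip.
rewrite -(J_shift (v j) (mS j)) -ge0_integralD; last 5 first.
- exact: measurableT.
- by move=> x _; rewrite lee_fin nsq_ge0.
- by apply/measurable_EFinP; exact: measurable_nsq.
- by move=> x _; rewrite lee_fin mulr_ge0 ?nsq_ge0.
- exact: mshift.
have mz : cmeasurable setT (zero_ext f).
  by apply: cmeasurable_zero_ext; apply: cmeasurable_sub => //; exact: measurable_quadrant.
apply: ge0_le_integral; [exact: measurableT| | | |].
- by move=> x _; rewrite lee_fin nsq_ge0.
- apply/measurable_EFinP; apply: measurable_nsq; apply: cmeasurableB => //.
  exact: cmeasurable_shift.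
- apply: emeasurable_funD; last exact: mshift.
  by apply/measurable_EFinP; exact: measurable_nsq.
move=> x _; rewrite -EFinD lee_fin /tdiff !zero_extE.
have p0 : 0 <= \1_(strip j) (shift (v j) x) * nsq (f (shift (v j) x)).
  by rewrite mulr_ge0 ?nsq_ge0.
have [xQ|xQ] := boolP (x \in Q).
  have -> : shift (v j) x \in Q by rewrite inE; apply: Qv; rewrite -inE.
  by rewrite lerDl.
have [sQ|sQ] := boolP (shift (v j) x \in Q); last by rewrite subr0 nsq0 addr_ge0// nsq_ge0.
rewrite indicE mem_set; first by rewrite subr0 mul1r lerDr nsq_ge0.
rewrite inE in sQ; split => //; rewrite cv.
by rewrite gerDr (Qnc (j := j))//; rewrite notin_setE in xQ.
Qed.

End FixedFunction.

(** A fractional Hardy inequality in dyadic form. The constant depends neither on f nor on N, which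
    later allows the passage to the limit in N. *)
Lemma hardy (q : R) : 1 < q -> q < 2 -> exists2 K : R, 0 < K & forall f (N : nat), L2 setT f ->
  \sum_(j < N) q ^+ j * fine (csqint (tdiff (v j) (zero_ext f))) <=
  K * (fine (csqint f) + \sum_(j < N) q ^+ j * fine (csqint (tdiff (v j) f))).
Proof.
move=> q1 q2.
(* this choice gives q (1 + e) < 2 + e *)
pose e := (2 - q) / 2.
have e0 : 0 < e by rewrite divr_gt0// subr_gt0.
have ei : 0 < e^-1 by rewrite invr_gt0.
pose rho := (1 + e) / (2 + e); pose kappa := (1 + e^-1) / (2 + e).
have e2 : 0 < 2 + e by rewrite addr_gt0.
have rho0 : 0 <= rho by rewrite divr_ge0// addr_ge0// ltW.
have kappa0 : 0 <= kappa by rewrite divr_ge0// ?addr_ge0// ltW.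
have qr : q * rho < 1.
  rewrite /rho mulrA ltr_pdivrMr// mul1r.
  have : e * (q - 1) < e * 1 by rewrite ltr_pM2l//; lra.
  have : 2 * e = 2 - q by rewrite /e; field.
  nra.
have r0 : 0 < 1 - q * rho by rewrite subr_gt0.
have ri : 0 < (1 - q * rho)^-1 by rewrite invr_gt0.
have q0 : 0 <= q by apply: le_trans (ltW q1).
(* The first 1 pays for the differences of f, the quotient for the strips: F + kappa D <= (1 +
   kappa) (F + D). *)
exists (1 + (1 + kappa) / (1 - q * rho)) => [|f N f2].
  by rewrite addr_gt0// divr_gt0// ltr_wpDr.
have [mf fi] := (L2_csqint f).1 f2.
pose al j := fine (csqint_on (strip j) f); pose de j := fine (csqint (tdiff (v j) f)).
have ff : csqint f \is a fin_num by rewrite ge0_fin_numE ?csqint_ge0.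
have al0 j : 0 <= al j by rewrite fine_ge0// csqint_on_ge0.
have de0 j : 0 <= de j by rewrite fine_ge0// csqint_ge0.
have alF : al 0%N <= fine (csqint f).
  by rewrite fine_le// ?csqint_on_fin// ?csqint_on_le//; exact: measurable_strip.
have rec j : al j.+1 <= rho * al j + kappa * de j.+1.
  have := strip_recursion f2 j e0; rewrite -/(al j) -/(al j.+1) -/(de j.+1) => h.
  rewrite /rho /kappa !(mulrAC _ (2 + e)^-1) -mulrDl ler_pdivlMr// mulrC //.
have A := geometric_recursion N q0 rho0 qr kappa0 al0 de0 alF rec.
set D := \sum_(j < N) q ^+ j * de j in A *; set F := fine (csqint f) in A *.
have D0 : 0 <= D by apply: sumr_ge0 => j _; rewrite mulr_ge0// exprn_ge0.
have F0 : 0 <= F by rewrite fine_ge0// csqint_ge0.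
apply: (@le_trans _ _ (D + \sum_(j < N) q ^+ j * al j)).
  rewrite -big_split /=; apply: ler_sum => j _; rewrite -mulrDr ler_wpM2l ?exprn_ge0//.
  have m1 := measurable_strip j.
  have df : csqint (tdiff (v j) f) \is a fin_num.
    by rewrite ge0_fin_numE ?csqint_ge0//; have /L2_csqint[] := L2_tdiff (v j) f2.
  rewrite /de /al -fineD ?csqint_on_fin//; apply: fine_le; last exact: tdiff_zero_ext_le.
    rewrite ge0_fin_numE ?csqint_ge0//; apply: le_lt_trans (tdiff_zero_ext_le f2 j) _.
    by rewrite lte_add_pinfty// -ge0_fin_numE ?csqint_ge0 ?csqint_on_ge0// csqint_on_fin.
  by rewrite fin_numD df csqint_on_fin.
apply: le_trans (lerD (lexx D) A) _.
rewrite [leRHS]mulrDl mul1r; apply: lerD; first by rewrite lerDr.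
rewrite [leRHS]mulrAC ler_wpM2r ?(ltW ri)// [leRHS]mulrDl mul1r mulrDr.
have : 0 <= kappa * F by rewrite mulr_ge0.
lra.
Qed.

End Hardy.

(** * Boundedness of the zero extension *)

Section ZeroExtension.
Variable R : realType.
Local Notation line := (measurableTypeR R).
Local Notation plane := (line * line)%type.
Local Notation C := (R[i]).
Local Notation mu := (leb2 R).
Local Notation Q := (@quadrant R).
Implicit Types (x : plane) (f g u : plane -> C).

Lemma csqint_ae_eq f g : cmeasurable setT f -> cmeasurable setT g ->
  {ae mu, forall x, f x = g x} -> csqint f = csqint g.
Proof.
move=> mf mg fg; apply: ge0_ae_eq_integral => //.
- by apply/measurable_EFinP; exact: measurable_nsq.
- by apply/measurable_EFinP; exact: measurable_nsq.
- by move=> x _; rewrite lee_fin nsq_ge0.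
- by move=> x _; rewrite lee_fin nsq_ge0.
- by apply: filterS fg => x -> _.
Qed.

(** Functions equal almost everywhere have the same set of Fourier transforms, and [xget] depends
    only on that set; hence an equality at every point. *)
Lemma fourier_ae_eq f g : cmeasurable setT f -> cmeasurable setT g ->
  {ae mu, forall x, f x = g x} -> fourier f = fourier g.
Proof.
move=> mf mg fg; rewrite /fourier; congr xget.
have sub f1 f2 : cmeasurable setT f1 -> cmeasurable setT f2 ->
    {ae mu, forall x, f1 x = f2 x} -> [set h | is_fourier f1 h] `<=` [set h | is_fourier f2 h].
  move=> m1 m2 f12 h [h2 [h_ [h12 c1 c2]]]; split=> //; exists h_; split=> //.
  rewrite (_ : (fun n => _) = (fun n => L2norm (fun x => h_ n x - f1 x)))//.
  apply/funext => n; rewrite !L2normE; congr (_ `^ _)%E.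
  have [[mh _] _] := h12 n.
  apply: csqint_ae_eq; [exact: cmeasurableB|exact: cmeasurableB|].
  by apply: filterS f12 => x ->.
by apply/seteqP; split; apply: sub => //; apply: filterS fg => x ->.
Qed.

Variable s : R.
Hypotheses (s0 : 0 <= s) (s1 : s < 1 / 2).

Let Hs_sq_bound_pos : 0 < s -> exists2 K, 0 < K &
  forall f, L2 setT f -> (Hs_sq s (zero_ext f) <= K%:E * Hs_sq s f)%E.
Proof.
move=> s0'; have q1 := wq_gt1 s0'; have q2 := wq_lt2 s1.
have [m1 m2] := measurable_coord R.
have inv0 j : 0 < (2 ^+ j)^-1 :> R by rewrite invr_gt0 exprn_gt0.
have [K1 K10 H1] : exists2 K : R, 0 < K & forall f (N : nat), L2 setT f ->
  \sum_(j < N) wq s ^+ j * fine (csqint (tdiff (dyad1 R j) (zero_ext f))) <=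
  K * (fine (csqint f) + \sum_(j < N) wq s ^+ j * fine (csqint (tdiff (dyad1 R j) f))).
  apply: (hardy (c := fst)) => //.
  - by move=> j x [x1 x2]; split; rewrite /= ?addr0// addr_gt0.
  - by move=> x [].
  - move=> j x nQ [/= h1]; rewrite addr0 => h2; rewrite leNgt; apply/negP => h3.
    exact: nQ.
have [K2 K20 H2] : exists2 K : R, 0 < K & forall f (N : nat), L2 setT f ->
  \sum_(j < N) wq s ^+ j * fine (csqint (tdiff (dyad2 R j) (zero_ext f))) <=
  K * (fine (csqint f) + \sum_(j < N) wq s ^+ j * fine (csqint (tdiff (dyad2 R j) f))).
  apply: (hardy (c := snd)) => //.
  - by move=> j x [x1 x2]; split; rewrite /= ?addr0// addr_gt0.
  - by move=> x [].
  - move=> j x nQ [/=]; rewrite addr0 => h1 h2; rewrite leNgt; apply/negP => h3.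
    exact: nQ.
have [c c0 Hc] := energy_le s0' s1; have [d d0 Hd] := le_energy s0' s1.
(* With F the squared L^2 norm of f, F + K1 (F + D1) + K2 (F + D2) <= K (F + D1 + D2). *)
pose K := 1 + K1 + K2.
have K0 : 0 < K by rewrite !addr_gt0.
exists (d * (K * c)); first by rewrite !mulr_gt0.
move=> f f2; have [mf fi] := (L2_csqint f).1 f2.
have z2 : L2 setT (zero_ext f). by exact: L2_zero_ext (L2_quadrant f2).
have fin g v : L2 setT g -> csqint (tdiff v g) \is a fin_num.
  by move=> g2; rewrite ge0_fin_numE ?csqint_ge0//; have /L2_csqint[] := L2_tdiff v g2.
have fin0 g : L2 setT g -> csqint g \is a fin_num.
  by move=> /L2_csqint[_ gi]; rewrite ge0_fin_numE ?csqint_ge0.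
have energy_fin N g : L2 setT g -> energy s N g =
    (fine (csqint g) + (\sum_(j < N) wq s ^+ j * fine (csqint (tdiff (dyad1 R j) g)) +
     \sum_(j < N) wq s ^+ j * fine (csqint (tdiff (dyad2 R j) g))))%:E.
  move=> g2; rewrite /energy -big_split /= EFinD fineK ?fin0//; congr (_ + _)%E.
  rewrite -sumEFin; apply: eq_bigr => j _.
  by rewrite -mulrDr EFinM EFinD !fineK ?fin.
have := Hd (zero_ext f) ((K * c)%:E * Hs_sq s f)%E z2.
rewrite muleA -EFinM; apply => N.
apply: (@le_trans _ _ (K%:E * energy s N f)%E); last first.
  by rewrite EFinM -muleA; apply: lee_wpmul2l; [rewrite lee_fin ltW|exact: Hc].
rewrite !energy_fin// -EFinM lee_fin.
have hz : fine (csqint (zero_ext f)) <= fine (csqint f).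
  by apply: fine_le; rewrite ?fin0//; exact: csqint_zero_ext.
have := H1 f N f2; have := H2 f N f2.
set D1 := \sum_(j < N) _ * fine (csqint (tdiff (dyad1 R j) f)).
set D2 := \sum_(j < N) _ * fine (csqint (tdiff (dyad2 R j) f)).
set E1 := \sum_(j < N) _; set E2 := \sum_(j < N) _ => h2 h1.
have q0 : 0 <= wq s by exact: powR_ge0.
have D10 : 0 <= D1 by apply: sumr_ge0 => j _; rewrite mulr_ge0 ?exprn_ge0// fine_ge0// csqint_ge0.
have D20 : 0 <= D2 by apply: sumr_ge0 => j _; rewrite mulr_ge0 ?exprn_ge0// fine_ge0// csqint_ge0.
have p1 : 0 <= K1 * D2 by rewrite mulr_ge0// ltW.
have p2 : 0 <= K2 * D1 by rewrite mulr_ge0// ltW.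
rewrite /K; nra.
Qed.

(** For s = 0 the weights 4^(s j) are all 1 and the symbol grows logarithmically, so the energy no
    longer describes the norm; Plancherel and |1_Q f| <= |f| replace it. *)
Lemma Hs_sq_bound : exists2 K, 0 < K &
  forall f, L2 setT f -> (Hs_sq s (zero_ext f) <= K%:E * Hs_sq s f)%E.
Proof.
have [s0'|] := ltP 0 s; first exact: Hs_sq_bound_pos.
move=> sle; have sE : s = 0 by apply/eqP; rewrite eq_le sle s0.
have Hs0 f : L2 setT f -> Hs_sq s f = csqint f.
  move=> f2; rewrite -(is_fourier_csqint f2 (fourierP f2)) Hs_sq_weight sE.
  by apply: eq_integral => k _; rewrite powRr0 mul1r.
exists 1 => // f f2; have [mf fi] := (L2_csqint f).1 f2.
rewrite mul1e !Hs0//; first exact: csqint_zero_ext.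
exact: L2_zero_ext (L2_quadrant f2).
Qed.

(** The constant is uniform over all extensions f of u, as the infimum in [HsQ_norm] requires. *)
Lemma Hs_norm_zero_ext_le : exists2 c : R, 0 < c &
  forall f u, L2 Q u -> L2 setT f -> restricts_to f u ->
    (Hs_norm s (zero_ext u) <= c%:E * Hs_norm s f)%E.
Proof.
have [K K0 HK] := Hs_sq_bound; exists (Num.sqrt K); first by rewrite sqrtr_gt0.
move=> f u u2 f2 fu.
(* The two zero extensions agree almost everywhere, although u and f are unrelated off Q. *)
have -> : Hs_norm s (zero_ext u) = Hs_norm s (zero_ext f).
  rewrite /Hs_norm (@fourier_ae_eq (zero_ext u) (zero_ext f))//.
  - by apply: cmeasurable_zero_ext; have [] := u2.
  - by apply: cmeasurable_zero_ext; have [] := L2_quadrant f2.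
  - apply: filterS fu => x fx; rewrite !zero_extE; case: ifPn => //.
    by rewrite inE => /fx ->.
have H0 g : (0 <= Hs_sq s g)%E by exact: csqint_ge0.
have KE : (0 <= K%:E)%E by rewrite lee_fin ltW.
rewrite !Hs_sqE -(powR12_sqrt (ltW K0)) -poweR_EFin -(poweRM 2^-1 KE (H0 f)).
apply: gt0_ler_poweR => //.
- by rewrite in_itv/= leey andbT H0.
- by rewrite in_itv/= leey andbT mule_ge0.
- exact: HK.
Qed.

End ZeroExtension.

Theorem propositionB1 (R : realType) (s : R) (hs0 : 0 <= s) (hs1 : s < 1 / 2) :
  Es s = HsQ s /\
  exists c : R, 0 < c /\
    forall u, Es s u -> (Hs_norm s (zero_ext u) <= c%:E * HsQ_norm s u)%E.
Proof.
have [c c0 Hc] := Hs_norm_zero_ext_le hs0 hs1.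
split.
  apply/seteqP; split=> u.
    (* The zero extension is itself an extension of u in H^s. *)
    move=> [u2 zu]; split=> //; exists (zero_ext u); split=> //.
    by apply: nearW => x Qx; rewrite zero_extE mem_set.
  move=> [u2 [f [[f2 Hf] fu]]]; split=> //; split; first exact: L2_zero_ext.
  apply: le_lt_trans (Hc f u u2 f2 fu) _.
  by rewrite lte_mul_pinfty ?lee_fin// ltW.
exists c; split=> // u [u2 _].
(* Dividing by c turns the claim into a lower bound for the norm of each extension, hence for their
   infimum. *)
rewrite -lee_pdivrMl//; apply: le_ereal_inf_tmp => _ [f [[f2 _] fu] <-].
by rewrite lee_pdivrMl//; exact: Hc.
Qed.
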